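(* Let $n\ge 0$ be an integer and $w\in\mathbb{C}$ with $\Re w>0$. Then $$\mathbf{S}_n(w)=\sum_{k\ge 1}^{\mathcal R}(k+w)^n\log(k+w)+(-1)^{n+1}n!\,b_n(w)H_n+\frac{(w+1)^{n+1}}{(n+1)^2}-\frac{(w+1)^{n+1}}{n+1}\log(w+1)+w^n\log w,$$ where $\sum^{\mathcal R}_{k\ge1}$ denotes the Ramanujan-Candelpergher sum.
   Context: Logarithms are principal branches; $H_n$ is the $n$-th harmonic number ($H_0=0$). For an integer $n\ge 0$ and $\Re w>0$, the partial sum $\sum_{k=0}^{s-1}(k+w)^n\log(k+w)$ has, as the integer $s\to+\infty$, a unique asymptotic expansion in the family of functions $s^m\log s$ ($m\ge 0$) and $s^m$ ($m\in\mathbb{Z}$); $\mathbf{S}_n(w)$ is its constant term (coefficient of $s^0$). The modified Bernoulli polynomials $b_k(w)$ are defined by $\frac{e^{-wt}}{1-e^{-t}}=\frac1t+\sum_{k\ge0}b_k(w)t^k$. Ramanujan-Candelpergher sum: let $\mathcal{O}^\pi$ be the vector space of functions holomorphic in a half plane $\{\Re s>\sigma_0\}$ for some $\sigma_0<1$ and satisfying there $|f(s)|\le Ce^{\beta|s|}$ for some $C>0$ and $\beta<\pi$. For $f\in\mathcal{O}^\pi$ there is a unique $\varphi\in\mathcal{O}^\pi$, holomorphic with such a bound on a half plane $\{\Re s>\sigma_1\}$ with $\sigma_1<0$, solving the difference equation $\varphi(s)-\varphi(s-1)=f(s)$ with $\varphi(0)=0$ (so $\varphi(s)=\sum_{k=1}^sf(k)$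 for integers $s\ge1$). Then $\sum_{k\ge1}^{\mathcal R}f(k)=\int_0^1\varphi(s)\,ds$. Here $f(s)=(s+w)^n\log(s+w)$. *)

(* Defs.v *)
(* Stdlib reals, with the complex numbers, derivatives and integrals of
   Coquelicot. *)
From Stdlib Require Import Reals ZArith.
From Coquelicot Require Export Coquelicot.

Open Scope R_scope.

(** * Elementary complex functions *)

Definition Cexp (z : C) : C := (exp (Re z) * cos (Im z), exp (Re z) * sin (Im z)).

(* Principal argument, in (-PI, PI]; the value at 0 is meaningless. *)
Definition Carg (z : C) : R :=
  if Rle_dec 0 (Im z) then acos (Re z / Cmod z) else - acos (Re z / Cmod z).

(* Principal branch; the value at 0 is meaningless. *)
Definition Clog (z : C) : C := (ln (Cmod z), Carg z).

Definition powlog (n : nat) (z : C) : C := (z ^ n * Clog z)%C.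

Definition harmonic (n : nat) : R := sum_n_m (fun k => / INR k) 1 n.

(** * Asymptotic expansions *)

(* Poincare expansion of [u s], for integers s -> +oo,
     sum_(0 <= m <= M) a_m s^m log s + sum_(m <= M, m in Z) b_m s^m :
   for every N, truncating the second sum at m = -N leaves an error o(s^(-N)).
   The range -N <= m <= M is enumerated as m = M - j with 0 <= j <= M + N. *)
Definition is_asymptotic_expansion
    (u : nat -> C) (M : nat) (a : nat -> C) (b : Z -> C) : Prop :=
  forall N : nat,
    is_lim_seq
      (fun s : nat =>
         INR s ^ N *
         Cmod (u s
               - sum_n (fun m : nat => a m * RtoC (INR s ^ m * ln (INR s))) M
               - sum_n (fun j : nat =>
                          let m := (Z.of_nat M - Z.of_nat j)%Z in
                          b m * RtoC (powerRZ (INR s) m)) (M + N))%C)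
      0.

Definition is_constant_term (u : nat -> C) (c : C) : Prop :=
  exists (M : nat) (a : nat -> C) (b : Z -> C),
    is_asymptotic_expansion u M a b /\ b 0%Z = c.

(* [iota P] is the element satisfying [P] when there is exactly one. *)
Definition constant_term (u : nat -> C) : C :=
  iota (T := C_CompleteNormedModule) (is_constant_term u).

(* For s >= 1 the argument of [constant_term] is the sum over 0 <= k <= s - 1;
   its value at s = 0 is irrelevant to the expansion. *)
Definition Sconst (n : nat) (w : C) : C :=
  constant_term
    (fun s : nat => sum_n (fun k : nat => powlog n (RtoC (INR k) + w)%C) (pred s)).

(** * Modified Bernoulli polynomials *)

Definition is_modified_bernoulli (w : C) (b : nat -> C) : Prop :=
  exists r : R, 0 < r /\
    forall t : C, 0 < Cmod t < r ->
      is_pseries (K := C_AbsRing) (V := C_NormedModule) b t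
        (Cexp (- (w * t)) / (1 - Cexp (- t)) - 1 / t)%C.

Definition modified_bernoulli (k : nat) (w : C) : C :=
  iota (T := C_CompleteNormedModule)
    (fun v : C => exists b : nat -> C, is_modified_bernoulli w b /\ b k = v).

(** * Ramanujan-Candelpergher summation *)

(* Functions are total on [C]; only their values on Re s > sigma matter. *)
Definition Opi_on (sigma : R) (f : C -> C) : Prop :=
  (forall s : C, sigma < Re s ->
     ex_derive (K := C_AbsRing) (V := C_NormedModule) f s) /\
  exists c beta : R, 0 < c /\ beta < PI /\
    forall s : C, sigma < Re s -> Cmod (f s) <= c * exp (beta * Cmod s).

(* The difference equation is required wherever both [f] (on Re s > sigma0) and
   the two values of [phi] (on Re s > sigma1) are under control. *)
Definition is_RC_primitive (f phi : C -> C) : Prop :=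
  exists sigma0 sigma1 : R,
    sigma0 < 1 /\ Opi_on sigma0 f /\
    sigma1 < 0 /\ Opi_on sigma1 phi /\
    (forall s : C, sigma0 < Re s -> sigma1 < Re (s - 1)%C ->
       (phi s - phi (s - 1))%C = f s) /\
    phi 0 = 0.

Definition is_RC_sum (f : C -> C) (v : C) : Prop :=
  exists phi : C -> C, is_RC_primitive f phi /\
    is_RInt (V := C_R_NormedModule) (fun x : R => phi (RtoC x)) 0 1 v.

Definition RC_sum (f : C -> C) : C :=
  iota (T := C_CompleteNormedModule) (is_RC_sum f).

(* Main.v *)
Require Import Defs.
From Stdlib Require Import Reals ZArith Lra Lia Psatz ClassicalEpsilon.
From Coquelicot Require Import Coquelicot.

(* Let P_i = B_i / i! be the normalized Bernoulli polynomials, let G_0 be a primitive of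
   z^n log z, and G_(i+1) = G_i'.  By Taylor's formula and the convolution identity for the
   P_i, the Euler-Maclaurin polynomial sum_i P_i(w) G_i(s) has forward difference
   (s + w)^n log(s + w) up to an error of the order of the first omitted G_i, so that
     sum_(k < s) (k + w)^n log(k + w) = sum_i P_i(w) G_i(s) + K(w) + o(1).
   The constant K is holomorphic of moderate growth on Re w > 0, because the error is
   controlled together with its w-derivatives, and
     K(w + 1) = K(w) - w^n log w,   int_0^1 K(x + v) dx = - G_0(v).
   Hence s |-> K(w + 1) - K(s + w + 1) solves the difference equation, and both sides of
   the theorem are expressed through K(w); the harmonic number is the non-logarithmic part
   of G_(n+1)(s) = n! (log s + H_n).

   The same Euler-Maclaurin estimate, applied to the functions tau^(i-1) e^(tau z), gives
   the generating function of the P_i.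

   Uniqueness of the Ramanujan-Candelpergher sum: the difference p of two solutions is
   1-periodic of exponential type less than pi, so (p(s) - p(a))^2 / (e^(2 i pi (s - a)) - 1)
   has no poles, and shifting the contour from Im s = -Y to Im s = Y, with Y -> +oo, shows
   that (p(x) - p(a))^2 has integral 0 over [0, 1]. *)

(** The three quantities of the theorem are defined by [iota], so each needs uniqueness besides
    existence; for the constant term it comes from comparing growth rates, for the [b_k] from
    uniqueness of power series. Holomorphy is complex differentiability at each point, and estimates
    rest on the mean value inequality. The one form of Cauchy's theorem is Goursat's on rectangles,
    which serves only the uniqueness of the Ramanujan-Candelpergher sum. This shapes three choices.
    The Euler-Maclaurin formula is used as a difference identity, whose error is a finite
    combination of Taylor remainders rather than an integral of periodic Bernoulli functions. The
    limit K is differentiated by means of uniform bounds on second derivatives. And p(s) - p(a) is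
    squared: the quotient by a function with simple zeros is then differentiable at these zeros
    using first derivatives only, whereas the unsquared quotient would ask for second-order
    expansions. The doubled type stays below 2 pi precisely because the type is below pi. K grows
    polynomially; the rate 2 in the exponential bounds is a convenient number below pi. *)

Notation is_Cderive := (is_derive (K := C_AbsRing) (V := C_NormedModule)).
Notation is_curve_derive := (is_derive (K := R_AbsRing) (V := C_R_NormedModule)).

Ltac Cring := match goal with |- @eq _ ?a ?b => change (@eq C a b) end; ring.
Ltac Cfield := match goal with |- @eq _ ?a ?b => change (@eq C a b) end; field.

Lemma Cminus_0_r (z : C) : (z - 0)%C = z.
Proof. ring. Qed.

(** * Finite sums of complex numbers *)

Lemma Csum_S (u : nat -> C) (k : nat) :
  sum_n u (S k) = (sum_n u k + u (S k))%C.
Proof. exact (sum_Sn u k). Qed.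

Lemma Csum_shift (u : nat -> C) (k : nat) :
  sum_n u (S k) = (u 0%nat + sum_n (fun j => u (S j)) k)%C.
Proof.
  induction k as [|k IH].
  - now rewrite Csum_S, !sum_O.
  - rewrite Csum_S, IH, Csum_S. Cring.
Qed.

Lemma Csum_ext (u v : nat -> C) (k : nat) :
  (forall j, (j <= k)%nat -> u j = v j) -> sum_n u k = sum_n v k.
Proof. apply (sum_n_ext_loc u v). Qed.

Lemma Csum_scal (a : C) (u : nat -> C) (k : nat) :
  sum_n (fun j => a * u j)%C k = (a * sum_n u k)%C.
Proof. exact (sum_n_mult_l (K := C_Ring) a u k). Qed.

Lemma Csum_plus (u v : nat -> C) (k : nat) :
  sum_n (fun j => u j + v j)%C k = (sum_n u k + sum_n v k)%C.
Proof. exact (sum_n_plus u v k). Qed.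

Lemma Csum_minus (u v : nat -> C) (k : nat) :
  sum_n (fun j => u j - v j)%C k = (sum_n u k - sum_n v k)%C.
Proof.
  induction k as [|k IH]; [now rewrite !sum_O|]. rewrite !Csum_S, IH. Cring.
Qed.

Lemma Csum_rev (u : nat -> C) (k : nat) :
  sum_n u k = sum_n (fun j => u (k - j)%nat) k.
Proof.
  induction k as [|k IH]; [now rewrite !sum_O|].
  rewrite Csum_S, Csum_shift, IH, Nat.sub_0_r. simpl Nat.sub. Cring.
Qed.

Lemma Csum_pad (u : nat -> C) (k p : nat) :
  (forall j, (k < j)%nat -> u j = RtoC 0) -> sum_n u (k + p) = sum_n u k.
Proof.
  intros H. induction p as [|p IH]; [now rewrite Nat.add_0_r|].
  rewrite Nat.add_succ_r, Csum_S, IH, H by lia. Cring.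
Qed.

Lemma Csum_single (u : nat -> C) (i k : nat) :
  (forall j, j <> i -> u j = RtoC 0) -> (i <= k)%nat -> sum_n u k = u i.
Proof.
  intros H Hi. induction k as [|k IH].
  - rewrite sum_O. now replace i with 0%nat by lia.
  - rewrite Csum_S. destruct (Nat.eq_dec i (S k)) as [->|E].
    + rewrite (Csum_ext u (fun _ => 0 * 0)%C), Csum_scal; [Cring|].
      intros j Hj. rewrite H by lia. Cring.
    + rewrite IH, (H (S k)) by lia. Cring.
Qed.

Lemma Csum_bound (u : nat -> C) (M : nat -> R) (k : nat) :
  (forall j, (j <= k)%nat -> Cmod (u j) <= M j) -> Cmod (sum_n u k) <= sum_n M k.
Proof.
  induction k as [|k IH]; intros H.
  - rewrite !sum_O. now apply H.
  - rewrite Csum_S, sum_Sn. eapply Rle_trans; [apply Cmod_triangle|].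
    apply Rplus_le_compat; [apply IH; intros; apply H; lia | now apply H].
Qed.

Lemma Csum_bound_const (u : nat -> C) (M : R) (k : nat) :
  (forall j, (j <= k)%nat -> Cmod (u j) <= M) -> Cmod (sum_n u k) <= INR (S k) * M.
Proof.
  intros H. eapply Rle_trans; [now apply (Csum_bound u (fun _ => M))|].
  rewrite sum_n_const. apply Rle_refl.
Qed.

(** * Derivatives of complex functions and of curves in the plane *)

Lemma is_Cderive_eps (f : C -> C) (z l : C) :
  is_Cderive f z l <->
  forall eps : R, 0 < eps -> exists delta : R, 0 < delta /\
    forall y : C, Cmod (y - z) < delta ->
      Cmod (f y - f z - l * (y - z)) <= eps * Cmod (y - z).
Proof.
  split.
  - intros [_ H] eps Heps.
    destruct (H z (fun P HP => HP) (mkposreal eps Heps)) as [d Hd].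
    exists d; split; [apply cond_pos|].
    intros y Hy. specialize (Hd y Hy).
    change (Cmod (f y - f z - (y - z) * l) <= eps * Cmod (y - z)) in Hd.
    now rewrite (Cmult_comm l).
  - intros H. split.
    + apply (is_linear_scal_l (K := C_AbsRing) (V := C_NormedModule)).
    + intros x Hx eps.
      apply (is_filter_lim_locally_unique (V := AbsRing_NormedModule C_AbsRing)) in Hx.
      assert (z = x) as <-.
      { exact Hx. }
      destruct (H eps (cond_pos eps)) as [d [Hd H']].
      exists (mkposreal d Hd). intros y Hy.
      change (Cmod (f y - f z - (y - z) * l) <= eps * Cmod (y - z)).
      rewrite (Cmult_comm _ l). apply H'. exact Hy.
Qed.

Lemma is_curve_derive_eps (f : R -> C) (t : R) (l : C) :
  is_curve_derive f t l <->
  forall eps : R, 0 < eps -> exists delta : R, 0 < delta /\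
    forall y : R, Rabs (y - t) < delta ->
      Cmod (f y - f t - RtoC (y - t) * l) <= eps * Rabs (y - t).
Proof.
  split.
  - intros [_ H] eps Heps.
    destruct (H t (fun P HP => HP) (mkposreal eps Heps)) as [d Hd].
    exists d; split; [apply cond_pos|].
    intros y Hy. specialize (Hd y Hy).
    rewrite <- scal_R_Cmult. rewrite Cmod_norm. exact Hd.
  - intros H. split.
    + apply (is_linear_scal_l (K := R_AbsRing) (V := C_R_NormedModule)).
    + intros x Hx eps.
      apply (is_filter_lim_locally_unique (V := AbsRing_NormedModule R_AbsRing)) in Hx.
      assert (t = x) as <-.
      { exact Hx. }
      destruct (H eps (cond_pos eps)) as [d [Hd H']].
      exists (mkposreal d Hd). intros y Hy.
      specialize (H' y Hy).
      rewrite <- scal_R_Cmult in H'. rewrite Cmod_norm in H'. exact H'.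
Qed.

(** The product and identity rules, and the inner function in the chain rule, live in the module
    that the ring [C] forms over itself, not in [C_NormedModule]; the differentials are the same,
    and this lemma and the next pass between the two. *)
Lemma is_Cderive_AbsRing (f : C -> C) (z l : C) :
  is_derive (K := C_AbsRing) (V := AbsRing_NormedModule C_AbsRing) f z l ->
  is_Cderive f z l.
Proof.
  intros [_ H]. split; [|exact H].
  apply (is_linear_scal_l (K := C_AbsRing) (V := C_NormedModule)).
Qed.

Lemma is_Cderive_AbsRing_inv (f : C -> C) (z l : C) :
  is_Cderive f z l ->
  is_derive (K := C_AbsRing) (V := AbsRing_NormedModule C_AbsRing) f z l.
Proof.
  intros [_ H]. split; [|exact H].
  apply (is_linear_scal_l (K := C_AbsRing) (V := AbsRing_NormedModule C_AbsRing)).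
Qed.

Lemma is_Cderive_const (a z : C) : is_Cderive (fun _ => a) z (RtoC 0).
Proof. apply (is_derive_const (K := C_AbsRing) (V := C_NormedModule)). Qed.

Lemma is_Cderive_id (z : C) : is_Cderive (fun x => x) z (RtoC 1).
Proof. exact (is_Cderive_AbsRing _ _ _ (is_derive_id (K := C_AbsRing) z)). Qed.

Lemma is_Cderive_plus (f g : C -> C) (z lf lg : C) :
  is_Cderive f z lf -> is_Cderive g z lg ->
  is_Cderive (fun x => f x + g x)%C z (lf + lg)%C.
Proof. exact (is_derive_plus (K := C_AbsRing) (V := C_NormedModule) f g z lf lg). Qed.

Lemma is_Cderive_minus (f g : C -> C) (z lf lg : C) :
  is_Cderive f z lf -> is_Cderive g z lg ->
  is_Cderive (fun x => f x - g x)%C z (lf - lg)%C.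
Proof. exact (is_derive_minus (K := C_AbsRing) (V := C_NormedModule) f g z lf lg). Qed.

Lemma is_Cderive_mult (f g : C -> C) (z lf lg : C) :
  is_Cderive f z lf -> is_Cderive g z lg ->
  is_Cderive (fun x => f x * g x)%C z (lf * g z + f z * lg)%C.
Proof.
  intros Hf%is_Cderive_AbsRing_inv Hg%is_Cderive_AbsRing_inv.
  apply is_Cderive_AbsRing.
  exact (is_derive_mult (K := C_AbsRing) f g z lf lg Hf Hg Cmult_comm).
Qed.

Lemma is_Cderive_comp (f g : C -> C) (z lf lg : C) :
  is_Cderive f (g z) lf -> is_Cderive g z lg ->
  is_Cderive (fun x => f (g x)) z (lg * lf)%C.
Proof.
  intros Hf Hg%is_Cderive_AbsRing_inv.
  exact (is_derive_comp (K := C_AbsRing) (V := C_NormedModule) f g z lf lg Hf Hg).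
Qed.

Lemma is_Cderive_scal (a : C) (f : C -> C) (z l : C) :
  is_Cderive f z l -> is_Cderive (fun x => a * f x)%C z (a * l)%C.
Proof.
  intros Hf. replace (a * l)%C with (0 * f z + a * l)%C by ring.
  apply is_Cderive_mult; [apply is_Cderive_const | exact Hf].
Qed.

Lemma is_Cderive_shift (f : C -> C) (a z l : C) :
  is_Cderive f (z + a)%C l -> is_Cderive (fun x => f (x + a)%C) z l.
Proof.
  intros Hf. replace l with ((1 + 0) * l)%C by ring.
  apply (is_Cderive_comp f (fun x => x + a)%C); [exact Hf|].
  apply is_Cderive_plus; [apply is_Cderive_id | apply is_Cderive_const].
Qed.

Lemma is_Cderive_pow (k : nat) (z : C) :
  is_Cderive (fun x => x ^ k)%C z (RtoC (INR k) * z ^ (pred k))%C.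
Proof.
  induction k as [|k IH].
  - simpl. rewrite Cmult_0_l. apply is_Cderive_const.
  - replace (RtoC (INR (S k)) * z ^ pred (S k))%C
      with (1 * z ^ k + z * (RtoC (INR k) * z ^ pred k))%C.
    + simpl. apply (is_Cderive_mult (fun x => x) (fun x => x ^ k)%C);
        [apply is_Cderive_id | exact IH].
    + rewrite S_INR, RtoC_plus. destruct k as [|k]; simpl; ring.
Qed.

Lemma is_Cderive_sum_n (f l : nat -> C -> C) (m : nat) (z : C) :
  (forall k, (k <= m)%nat -> is_Cderive (f k) z (l k z)) ->
  is_Cderive (fun x => sum_n (fun k => f k x) m) z (sum_n (fun k => l k z) m).
Proof.
  induction m as [|m IH]; intros H.
  - rewrite sum_O. apply is_derive_ext with (f := f 0%nat);
      [intros t; symmetry; exact (sum_O (fun k => f k t))|].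
    now apply H.
  - rewrite sum_Sn. apply is_derive_ext with
      (f := fun t => (sum_n (fun k => f k t) m + f (S m) t)%C);
      [intros t; symmetry; exact (Csum_S (fun k => f k t) m)|].
    apply is_Cderive_plus; [apply IH; intros; apply H; lia | now apply H].
Qed.

Lemma is_curve_derive_line (f : C -> C) (a h l : C) (t : R) :
  is_Cderive f (a + RtoC t * h)%C l ->
  is_curve_derive (fun x : R => f (a + RtoC x * h)%C) t (h * l)%C.
Proof.
  rewrite is_Cderive_eps, is_curve_derive_eps. intros H eps Heps.
  pose proof (Cmod_ge_0 h) as Hh.
  (* [Cmod h + 1] rather than [Cmod h] allows [h = 0]. *)
  destruct (H (eps / (Cmod h + 1))) as [d [Hd H']].
  { apply Rdiv_lt_0_compat; lra. }
  exists (d / (Cmod h + 1)). split; [apply Rdiv_lt_0_compat; lra|].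
  intros y Hy.
  assert (E : ((a + RtoC y * h) - (a + RtoC t * h) = RtoC (y - t) * h)%C)
    by (rewrite RtoC_minus; ring).
  specialize (H' (a + RtoC y * h)%C). rewrite E in H'.
  rewrite Cmod_mult, Cmod_R in H'.
  pose proof (Rabs_pos (y - t)) as Hp.
  replace (RtoC (y - t) * (h * l))%C with (l * (RtoC (y - t) * h))%C by ring.
  eapply Rle_trans; [apply H'|].
  - apply Rle_lt_trans with (Rabs (y - t) * (Cmod h + 1)); [nra|].
    apply Rmult_lt_reg_r with (/ (Cmod h + 1)); [apply Rinv_0_lt_compat; lra|].
    rewrite Rmult_assoc, Rinv_r, Rmult_1_r by lra. exact Hy.
  - replace (eps / (Cmod h + 1) * (Rabs (y - t) * Cmod h))
      with (eps * Rabs (y - t) * (Cmod h / (Cmod h + 1))) by (field; lra).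
    rewrite <- (Rmult_1_r (eps * Rabs (y - t))) at 2.
    apply Rmult_le_compat_l; [nra|].
    apply Rmult_le_reg_r with (Cmod h + 1); [lra|].
    unfold Rdiv. rewrite Rmult_assoc, Rinv_l by lra. lra.
Qed.

Lemma is_derive_Re (f : R -> C) (t : R) (l : C) :
  is_curve_derive f t l -> is_derive (fun x => Re (f x)) t (Re l).
Proof.
  intros H. apply (filterdiff_comp' f (fst : C_R_NormedModule -> R) t
    (fun y => scal y l) fst H).
  apply filterdiff_linear, is_linear_fst.
Qed.

Lemma is_derive_Im (f : R -> C) (t : R) (l : C) :
  is_curve_derive f t l -> is_derive (fun x => Im (f x)) t (Im l).
Proof.
  intros H. apply (filterdiff_comp' f (snd : C_R_NormedModule -> R) t
    (fun y => scal y l) snd H).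
  apply filterdiff_linear, is_linear_snd.
Qed.

(** * Mean value inequality and Taylor's formula *)

Lemma curve_mvt (f df : R -> C) (M : R) :
  (forall t, 0 <= t <= 1 -> is_curve_derive f t (df t)) ->
  (forall t, 0 <= t <= 1 -> Cmod (df t) <= M) ->
  Cmod (f 1 - f 0) <= M.
Proof.
  intros Hd HM. set (v := (f 1 - f 0)%C).
  (* the mean value theorem for the real part of [conj v * f] *)
  destruct (MVT_gen (fun t => Re v * Re (f t) + Im v * Im (f t)) 0 1
    (fun t => Re v * Re (df t) + Im v * Im (df t))) as [c [Hc E]].
  - intros t Ht. rewrite Rmin_left, Rmax_right in Ht by lra.
    apply (is_derive_plus (fun t => Re v * Re (f t)) (fun t => Im v * Im (f t)));
      apply is_derive_scal; [apply is_derive_Re | apply is_derive_Im];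
      apply Hd; lra.
  - intros t Ht. rewrite Rmin_left, Rmax_right in Ht by lra.
    apply continuity_pt_plus; apply continuity_pt_mult;
      try (apply continuity_pt_const; intros ? ?; reflexivity);
      apply continuity_pt_filterlim, (ex_derive_continuous (K := R_AbsRing) (V := R_NormedModule));
      [exists (Re (df t)); apply is_derive_Re | exists (Im (df t)); apply is_derive_Im];
      apply Hd; lra.
  - rewrite Rmin_left, Rmax_right in Hc by lra.
    assert (E2 : Cmod v ^ 2 = Re v * Re (df c) + Im v * Im (df c)).
    { rewrite Rminus_0_r, Rmult_1_r in E. rewrite <- E, Cmod2_alt.
      assert (Re v = Re (f 1) - Re (f 0)) by (unfold v, Cminus; now rewrite re_plus, re_opp).
      assert (Im v = Im (f 1) - Im (f 0)) by (unfold v, Cminus; now rewrite im_plus, im_opp).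
      nra. }
    assert (E3 : Re v * Re (df c) + Im v * Im (df c) <= Cmod v * Cmod (df c)).
    { replace (Re v * Re (df c) + Im v * Im (df c)) with (Re (v * Cconj (df c))%C).
      - eapply Rle_trans; [apply Rle_abs|]. eapply Rle_trans; [apply re_le_Cmod|].
        rewrite Cmod_mult, Cmod_conj. lra.
      - rewrite re_mult, re_conj, im_conj. ring. }
    specialize (HM c Hc). pose proof (Cmod_ge_0 v). pose proof (Cmod_ge_0 (df c)).
    destruct (Req_dec (Cmod v) 0) as [E0|E0]; [rewrite E0; lra|].
    apply Rmult_le_reg_l with (Cmod v); [lra|].
    apply Rle_trans with (Cmod v * Cmod (df c)); [lra|nra].
Qed.

(* The crude constant (no factorial) suffices everywhere. *)
Lemma taylor_bound (g : nat -> C -> C) (a h : C) (M : R) (k : nat) :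
  (forall j t, (j <= k)%nat -> 0 <= t <= 1 ->
     is_Cderive (g j) (a + RtoC t * h)%C (g (S j) (a + RtoC t * h)%C)) ->
  (forall t, 0 <= t <= 1 -> Cmod (g (S k) (a + RtoC t * h)%C) <= M) ->
  Cmod (g 0%nat (a + h)%C
        - sum_n (fun j => g j a * (h ^ j / RtoC (INR (fact j)))) k)%C
    <= M * Cmod h ^ S k.
Proof.
  revert g h. induction k as [|k IH]; intros g h Hd HM.
  - rewrite sum_O. simpl.
    replace (g 0%nat (a + h) - g 0%nat a * (1 / 1))%C
      with (g 0%nat (a + RtoC 1 * h) - g 0%nat (a + RtoC 0 * h))%C
      by (rewrite Cmult_1_l, Cmult_0_l, Cplus_0_r; field).
    apply (curve_mvt (fun t => g 0%nat (a + RtoC t * h)%C)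
      (fun t => h * g 1%nat (a + RtoC t * h))%C).
    + intros t Ht. apply is_curve_derive_line. now apply Hd.
    + intros t Ht. rewrite Cmod_mult, Rmult_1_r, Rmult_comm.
      apply Rmult_le_compat_r; [apply Cmod_ge_0 | now apply HM].
  (* As a function of the increment, the remainder [r] has derivative [r'], the remainder of one
     order less for the shifted family [g (S j)]. The induction hypothesis bounds [r'] along the
     whole segment, and the mean value inequality returns to [r]. *)
  - set (r := fun z : C => (g 0%nat (a + z)
      - sum_n (fun j => g j a * (z ^ j / RtoC (INR (fact j)))) (S k))%C).
    set (r' := fun z : C => (g 1%nat (a + z)
      - sum_n (fun j => g (S j) a * (z ^ j / RtoC (INR (fact j)))) k)%C).
    assert (Hr0 : r (RtoC 0 * h)%C = 0%C).
    { unfold r. rewrite Cmult_0_l, Cplus_0_r, Csum_shift.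
      rewrite (Csum_ext _ (fun _ => (0 * 0)%C)).
      - rewrite Csum_scal. simpl. field.
      - intros j _. change (0 ^ S j)%C with (0 * 0 ^ j)%C.
        unfold Cdiv. ring. }
    assert (Hr1 : r (RtoC 1 * h)%C = r h) by now rewrite Cmult_1_l.
    change (Cmod (r h) <= M * Cmod h ^ S (S k)).
    replace (r h) with (r (RtoC 1 * h) - r (RtoC 0 * h))%C
      by (rewrite Hr0, Hr1; ring).
    assert (Hbase : forall t, 0 <= t <= 1 ->
      Cmod (r' (RtoC t * h)%C) <= M * Cmod h ^ S k).
    { intros t Ht. unfold r'.
      eapply Rle_trans; [apply (IH (fun j => g (S j)) (RtoC t * h)%C)|].
      - intros j x Hj Hx. rewrite Cmult_assoc, <- RtoC_mult.
        apply Hd; [lia|nra].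
      - intros x Hx. rewrite Cmult_assoc, <- RtoC_mult. apply HM. nra.
      - apply Rmult_le_compat_l.
        + eapply Rle_trans; [apply Cmod_ge_0 | apply (HM 0); lra].
        + apply pow_incr. split; [apply Cmod_ge_0|].
          rewrite Cmod_mult, Cmod_R, Rabs_pos_eq by lra.
          pose proof (Cmod_ge_0 h); nra. }
    apply (curve_mvt (fun t => r (RtoC t * h)%C) (fun t => h * r' (RtoC t * h))%C).
    + intros t Ht.
      apply is_derive_ext with (f := fun t => r (0 + RtoC t * h)%C);
        [intros; now rewrite Cplus_0_l|].
      apply is_curve_derive_line. rewrite Cplus_0_l. unfold r, r'.
      apply is_Cderive_minus.
      * apply is_derive_ext with (f := fun z => g 0%nat (z + a)%C);
          [intros z; now rewrite Cplus_comm|].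
        apply is_Cderive_shift. rewrite (Cplus_comm _ a). apply Hd; [lia|exact Ht].
      * apply is_derive_ext with (f := fun z : C => (g 0%nat a +
          sum_n (fun j => g (S j) a * (z ^ S j / RtoC (INR (fact (S j))))) k)%C);
          [intros z; rewrite Csum_shift; simpl; Cfield|].
        replace (sum_n (fun j => g (S j) a * ((RtoC t * h) ^ j / RtoC (INR (fact j)))) k)%C
          with (0 + sum_n (fun j => g (S j) a * ((RtoC t * h) ^ j / RtoC (INR (fact j)))) k)%C
          by ring.
        apply is_Cderive_plus; [apply is_Cderive_const|].
        apply (is_Cderive_sum_n
          (fun j z => g (S j) a * (z ^ S j / RtoC (INR (fact (S j)))))%C
          (fun j z => g (S j) a * (z ^ j / RtoC (INR (fact j))))%C).
        intros j _. apply is_Cderive_scal.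
        replace ((RtoC t * h) ^ j / RtoC (INR (fact j)))%C with
          (/ RtoC (INR (fact (S j))) * (RtoC (INR (S j)) * (RtoC t * h) ^ pred (S j)))%C.
        -- apply is_derive_ext with
             (f := fun z : C => (/ RtoC (INR (fact (S j))) * z ^ S j)%C);
             [intros z; unfold Cdiv; Cring|].
           apply is_Cderive_scal, is_Cderive_pow.
        -- rewrite fact_simpl, mult_INR, RtoC_mult. simpl pred.
           assert (RtoC (INR (S j)) <> 0%C) by (intros E; apply RtoC_inj in E; revert E; apply not_0_INR; lia).
           assert (RtoC (INR (fact j)) <> 0%C) by (intros E; apply RtoC_inj in E; revert E; apply INR_fact_neq_0).
           field. now split.
    + intros t Ht. rewrite Cmod_mult.
      change (Cmod h ^ S (S k)) with (Cmod h * Cmod h ^ S k).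
      specialize (Hbase t Ht). pose proof (Cmod_ge_0 h). nra.
Qed.

Lemma Csum_triangle (x : nat -> nat -> C) (L : nat) :
  sum_n (fun i => sum_n (fun j => x i j) (L - i)) L
  = sum_n (fun m => sum_n (fun i => x i (m - i)%nat) m) L.
Proof.
  induction L as [|L IH]; [now rewrite !sum_O|].
  rewrite Csum_S, (Csum_S _ L), <- IH, Csum_S, Nat.sub_diag, sum_O.
  rewrite (Csum_ext _ (fun i => sum_n (fun j => x i j) (L - i) + x i (S L - i)%nat)%C).
  - rewrite Csum_plus. Cring.
  - intros i Hi. replace (S L - i)%nat with (S (L - i)) by lia. apply Csum_S.
Qed.

(** * Bernoulli polynomials *)

(** The recursion for the [k]-th polynomial involves all earlier ones, so a structural fixpoint has
    to carry the whole table; entries with [i > k] are meaningless. *)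
Fixpoint bern_table (k : nat) (i : nat) (w : C) : C :=
  match k with
  | O => 1%C
  | S k' =>
      if Nat.eqb i k
      then (w ^ k / RtoC (INR (fact k))
            - sum_n (fun j => bern_table k' j w / RtoC (INR (fact (S k - j)))) k')%C
      else bern_table k' i w
  end.

(* [B_k(w) / k!], with generating function [t e^(wt) / (e^t - 1)]. *)
Definition bern (k : nat) (w : C) : C := bern_table k k w.

Lemma bern_table_bern (k i : nat) (w : C) : (i <= k)%nat -> bern_table k i w = bern i w.
Proof.
  induction k as [|k IH]; intros Hi.
  - now replace i with 0%nat by lia.
  - destruct (Nat.eq_dec i (S k)) as [->|E]; [reflexivity|].
    cbn [bern_table]. rewrite (proj2 (Nat.eqb_neq i (S k)) E). apply IH. lia.
Qed.

Lemma bern_0 (w : C) : bern 0 w = 1%C.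
Proof. reflexivity. Qed.

Lemma bern_S (k : nat) (w : C) :
  bern (S k) w = (w ^ S k / RtoC (INR (fact (S k)))
    - sum_n (fun j => bern j w / RtoC (INR (fact (S (S k) - j)))) k)%C.
Proof.
  unfold bern at 1. cbn [bern_table]. rewrite Nat.eqb_refl.
  f_equal.
  apply Csum_ext. intros j Hj. now rewrite bern_table_bern.
Qed.

Lemma RtoC_neq_0 (x : R) : x <> 0 -> RtoC x <> 0%C.
Proof. intros H E. apply RtoC_inj in E. now apply H. Qed.

Lemma fact_C_neq_0 (k : nat) : RtoC (INR (fact k)) <> 0%C.
Proof. apply RtoC_neq_0, INR_fact_neq_0. Qed.

Lemma div_fact_0 (z : C) : (z ^ 0 / RtoC (INR (fact 0)))%C = 1%C.
Proof. simpl. field. Qed.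

(** Comparison of the coefficients of [t^k] in [(e^t - 1)/t] times [t e^(wt)/(e^t - 1)], which is
    [e^(wt)]; the recursion [bern_S] is this identity solved for its last term. *)
Lemma bern_convolution (k : nat) (w : C) :
  sum_n (fun i => bern i w / RtoC (INR (fact (S k - i))))%C k
  = (w ^ k / RtoC (INR (fact k)))%C.
Proof.
  destruct k as [|k].
  - rewrite sum_O, bern_0. reflexivity.
  - rewrite Csum_S, bern_S. replace (S (S k) - S k)%nat with 1%nat by lia.
    change (RtoC (INR (fact 1))) with (RtoC 1). Cfield. apply fact_C_neq_0.
Qed.

Lemma is_Cderive_pow_fact (k : nat) (z : C) :
  is_Cderive (fun x => x ^ S k / RtoC (INR (fact (S k))))%C z
    (z ^ k / RtoC (INR (fact k)))%C.
Proof.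
  apply is_derive_ext with (f := fun x : C => (/ RtoC (INR (fact (S k))) * x ^ S k)%C);
    [intros x; unfold Cdiv; Cring|].
  replace (z ^ k / RtoC (INR (fact k)))%C with
    (/ RtoC (INR (fact (S k))) * (RtoC (INR (S k)) * z ^ pred (S k)))%C.
  - apply is_Cderive_scal, is_Cderive_pow.
  - rewrite fact_simpl, mult_INR, RtoC_mult. simpl pred. field.
    split; [apply fact_C_neq_0 | apply RtoC_neq_0, not_0_INR; lia].
Qed.

(** Differentiating the recursion kills the constant term [j = 0] and, by strong induction, lowers
    every other index by one: what remains is the recursion one level down. *)
Lemma is_Cderive_bern (k : nat) (z : C) : is_Cderive (bern (S k)) z (bern k z).
Proof.
  revert z. induction k as [k IH] using lt_wf_ind. intros z.
  apply is_derive_ext with (f := fun w => (w ^ S k / RtoC (INR (fact (S k)))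
    - sum_n (fun j => bern j w / RtoC (INR (fact (S (S k) - j)))) k)%C);
    [intros w; symmetry; apply bern_S|].
  destruct k as [|k].
  - replace (bern 0 z) with (z ^ 0 / RtoC (INR (fact 0)) - 0)%C
      by (rewrite bern_0; simpl; field).
    apply is_Cderive_minus; [apply is_Cderive_pow_fact|].
    apply is_derive_ext with (f := fun w : C => (1 / RtoC (INR (fact 2)))%C);
      [intros w; now rewrite sum_O, bern_0|].
    apply is_Cderive_const.
  - rewrite bern_S. apply is_Cderive_minus; [apply is_Cderive_pow_fact|].
    apply is_derive_ext with (f := fun w : C => (1 / RtoC (INR (fact (S (S (S k)))))
      + sum_n (fun j => bern (S j) w / RtoC (INR (fact (S (S k) - j)))) k)%C);
      [intros w; now rewrite Csum_shift|].
    rewrite <- (Cplus_0_l (sum_n _ k)).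
    apply is_Cderive_plus; [apply is_Cderive_const|].
    apply (is_Cderive_sum_n
      (fun j w => bern (S j) w / RtoC (INR (fact (S (S k) - j))))%C
      (fun j w => bern j w / RtoC (INR (fact (S (S k) - j))))%C).
    intros j Hj. unfold Cdiv.
    apply is_derive_ext with
      (f := fun w : C => (/ RtoC (INR (fact (S (S k) - j))) * bern (S j) w)%C);
      [intros w; Cring|].
    rewrite Cmult_comm. apply is_Cderive_scal, IH. lia.
Qed.

Lemma bern_translate (k : nat) (w : C) :
  (bern (S k) (w + 1) - bern (S k) w = w ^ k / RtoC (INR (fact k)))%C.
Proof.
  (* The successive derivatives of [bern (S k)], continued by 0 beyond the constant one. Taylor's
     bound then holds with [M = 0], so the expansion with increment 1 is exact, and its terms sum up
     by convolution. *)
  set (g := fun j z => if (j <=? S k)%nat then bern (S k - j) z else 0%C).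
  assert (H : Cmod (g 0%nat (w + 1)%C
    - sum_n (fun j => g j w * (1 ^ j / RtoC (INR (fact j)))) (S k))%C <= 0 * Cmod 1 ^ S (S k)).
  { apply taylor_bound.
    - intros j t Hj _. unfold g.
      rewrite (proj2 (Nat.leb_le j (S k)) Hj).
      destruct (Nat.leb_spec (S j) (S k)) as [H|H].
      + replace (S k - j)%nat with (S (S k - S j)) by lia. apply is_Cderive_bern.
      + replace (S k - j)%nat with 0%nat by lia.
        apply is_derive_ext with (f := fun _ : C => RtoC 1);
          [reflexivity | apply is_Cderive_const].
    - intros t _. unfold g. rewrite (proj2 (Nat.leb_gt _ _)) by lia.
      rewrite Cmod_0. lra. }
  rewrite Rmult_0_l in H.
  pose proof (Cmod_ge_0 (g 0%nat (w + 1)%C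
    - sum_n (fun j => g j w * (1 ^ j / RtoC (INR (fact j)))) (S k))%C) as H'.
  assert (E := Cmod_eq_0 _ (Rle_antisym _ _ H H')). clear H H'.
  apply Ceq_minus in E. unfold g at 1 in E. simpl Nat.leb in E. cbv iota in E.
  rewrite Nat.sub_0_r in E. rewrite E, <- bern_convolution.
  clear E.
  rewrite Csum_shift. unfold g at 1. simpl Nat.leb. cbv iota. rewrite Nat.sub_0_r.
  rewrite (Csum_rev (fun i => (bern i w / RtoC (INR (fact (S k - i))))%C)).
  rewrite (Csum_ext (fun j => g (S j) w * (1 ^ S j / RtoC (INR (fact (S j)))))%C
    (fun j => bern (k - j) w / RtoC (INR (fact (S k - (k - j)))))%C).
  - rewrite div_fact_0. set (X := sum_n _ k). Cring.
  - intros j Hj. unfold g. rewrite (proj2 (Nat.leb_le _ _)) by lia.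
    rewrite Cpow_1_l. replace (S k - (k - j))%nat with (S j) by lia.
    replace (S k - S j)%nat with (k - j)%nat by lia. Cfield. apply fact_C_neq_0.
Qed.

(** A geometric rate for the growth of [bern k w] in [k]. It is far from sharp; what counts is that
    it is affine in [Cmod w], so that each bound is polynomial in [w]. *)
Definition bern_radius (w : C) : R := 2 * (1 + Cmod w).

Lemma bern_radius_ge (w : C) : 2 <= bern_radius w.
Proof. unfold bern_radius. pose proof (Cmod_ge_0 w). lra. Qed.

Lemma pow2_le_fact_S (m : nat) : 2 ^ m <= INR (fact (S m)).
Proof.
  induction m as [|m IH]; [simpl; lra|].
  rewrite fact_simpl, mult_INR.
  assert (2 <= INR (S (S m))) by (rewrite !S_INR; pose proof (pos_INR m); lra).
  change (2 ^ S m) with (2 * 2 ^ m).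
  apply Rmult_le_compat; try lra. apply pow_le; lra.
Qed.

(** Each part of the recursion takes at most half of [r ^ S k]: the monomial because
    [Cmod w <= r / 2], the sum because the weights [1/(j+1)! <= 2^(-j)] and [r >= 2] make it grow
    geometrically towards its last term. *)
Lemma bern_bound (k : nat) (w : C) : Cmod (bern k w) <= bern_radius w ^ k.
Proof.
  pose proof (bern_radius_ge w) as HR. set (r := bern_radius w) in *.
  induction k as [k IH] using lt_wf_ind.
  destruct k as [|k]; [rewrite bern_0, Cmod_1; simpl; lra|].
  rewrite bern_S.
  assert (H1 : Cmod (w ^ S k / RtoC (INR (fact (S k)))) <= r ^ S k / 2).
  { rewrite Cmod_div, Cmod_pow, Cmod_R by apply fact_C_neq_0.
    pose proof (pow2_le_fact_S k) as H2.
    assert (1 <= INR (fact (S k))) by (pose proof (pow_R1_Rle 2 k); lra).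
    rewrite Rabs_pos_eq by lra.
    assert (Hw : Cmod w ^ S k <= (r / 2) ^ S k).
    { apply pow_incr. unfold r, bern_radius. pose proof (Cmod_ge_0 w). lra. }
    apply Rle_trans with (Cmod w ^ S k).
    - apply Rle_trans with (Cmod w ^ S k / 1); [|lra].
      apply Rmult_le_compat_l; [apply pow_le, Cmod_ge_0|].
      apply Rinv_le_contravar; lra.
    - unfold Rdiv in Hw. rewrite Rpow_mult_distr in Hw.
      assert ((/ 2) ^ S k <= / 2).
      { simpl. assert ((/ 2) ^ k <= 1); [|lra].
        rewrite <- (pow1 k). apply pow_incr. lra. }
      pose proof (pow_le r (S k) ltac:(lra)). nra. }
  assert (H2 : forall m, (m <= k)%nat ->
    Cmod (sum_n (fun j => bern j w / RtoC (INR (fact (S (S k) - j))))%C m)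
    <= r ^ S m / 2 * / 2 ^ (k - m)).
  { induction m as [|m IHm]; intros Hm.
    - rewrite sum_O, bern_0, Cmod_div, Cmod_1, Cmod_R by apply fact_C_neq_0.
      rewrite Rabs_pos_eq by apply pos_INR.
      replace (S (S k) - 0)%nat with (S (S k)) by lia.
      pose proof (pow2_le_fact_S (S k)) as H3.
      rewrite pow_1, Nat.sub_0_r. pose proof (pow_lt 2 k ltac:(lra)).
      apply Rle_trans with (1 / 2 ^ S k).
      + apply Rmult_le_compat_l; [lra|].
        apply Rinv_le_contravar; [apply pow_lt; lra | exact H3].
      + simpl. apply Rmult_le_reg_r with (2 * 2 ^ k); [lra|].
        field_simplify; nra.
    - rewrite Csum_S. eapply Rle_trans; [apply Cmod_triangle|].
      specialize (IHm ltac:(lia)).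
      assert (H3 : Cmod (bern (S m) w / RtoC (INR (fact (S (S k) - S m))))
        <= r ^ S m * / 2 ^ (k - m)).
      { rewrite Cmod_div, Cmod_R, Rabs_pos_eq by (apply fact_C_neq_0 || apply pos_INR).
        apply Rmult_le_compat.
        - apply Cmod_ge_0.
        - left. apply Rinv_0_lt_compat, INR_fact_lt_0.
        - apply IH. lia.
        - apply Rinv_le_contravar; [apply pow_lt; lra|].
          replace (S (S k) - S m)%nat with (S (k - m)) by lia. apply pow2_le_fact_S. }
      replace (k - m)%nat with (S (k - S m)) in IHm, H3 by lia.
      cbn [pow] in IHm, H3 |- *. pose proof (pow_lt 2 (k - S m) ltac:(lra)) as Hp.
      rewrite Rinv_mult in IHm, H3. pose proof (Rinv_0_lt_compat _ Hp).
      pose proof (pow_lt r m ltac:(lra)).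
      assert (0 < r * r ^ m * / 2 ^ (k - S m)) by (apply Rmult_lt_0_compat; [apply Rmult_lt_0_compat|]; lra).
      nra. }
  specialize (H2 k (Nat.le_refl k)). rewrite Nat.sub_diag in H2.
  unfold Cminus. eapply Rle_trans; [apply Cmod_triangle|]. rewrite Cmod_opp.
  rewrite pow_O, Rinv_1, Rmult_1_r in H2. lra.
Qed.

(** * The Euler-Maclaurin step *)

(** Each [g i (s + 1)] is expanded up to the order at which the remainder involves [g (S (S L))], so
    all remainders share the bound [M]. There are [L + 2] of them in the sum and one more for
    [g 1 (s + w)], whence the factor [L + 3]. *)
Lemma euler_maclaurin_step (g : nat -> C -> C) (L : nat) (s w : C) (M : R) :
  (forall j (z : C) t, (j <= S L)%nat -> z = 1%C \/ z = w -> 0 <= t <= 1 ->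
     is_Cderive (g j) (s + RtoC t * z)%C (g (S j) (s + RtoC t * z)%C)) ->
  (forall (z : C) t, z = 1%C \/ z = w -> 0 <= t <= 1 ->
     Cmod (g (S (S L)) (s + RtoC t * z)%C) <= M) ->
  Cmod (sum_n (fun i => bern i w * (g i (s + 1) - g i s)) (S L) - g 1%nat (s + w))%C
    <= M * INR (L + 3) * bern_radius w ^ S L.
Proof.
  intros Hd HM.
  assert (HM0 : 0 <= M).
  { eapply Rle_trans; [apply Cmod_ge_0 | apply (HM 1%C 0); [now left | lra]]. }
  set (rho := fun i => (g i (s + 1) -
    sum_n (fun j => g (i + j)%nat s / RtoC (INR (fact j))) (S L - i))%C).
  set (rw := (g 1%nat (s + w) -
    sum_n (fun j => g (1 + j)%nat s * (w ^ j / RtoC (INR (fact j)))) L)%C).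
  assert (Hrho : forall i, (i <= S L)%nat -> Cmod (rho i) <= M).
  { intros i Hi. unfold rho.
    rewrite (Csum_ext _ (fun j => g (i + j)%nat s * (1 ^ j / RtoC (INR (fact j))))%C).
    - replace (g i) with (g (i + 0)%nat) by (f_equal; lia).
      eapply Rle_trans; [apply (taylor_bound (fun j => g (i + j)%nat) s 1%C M)|].
      + intros j t Hj Ht. replace (i + S j)%nat with (S (i + j)) by lia.
        apply Hd; [lia | now left | exact Ht].
      + intros t Ht. replace (i + S (S L - i))%nat with (S (S L)) by lia.
        apply HM; [now left | exact Ht].
      + rewrite Cmod_1, pow1. lra.
    - intros j _. rewrite Cpow_1_l. Cfield. apply fact_C_neq_0. }
  assert (Hrw : Cmod rw <= M * Cmod w ^ S L).
  { apply (taylor_bound (fun j => g (1 + j)%nat) s w M).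
    - intros j t Hj Ht. apply Hd; [lia | now right | exact Ht].
    - intros t Ht. apply HM; [now right | exact Ht]. }
  assert (E : (sum_n (fun i => bern i w * (g i (s + 1) - g i s)) (S L) - g 1%nat (s + w)
    = sum_n (fun i => bern i w * rho i) (S L) - rw)%C).
  { set (T := fun i => sum_n (fun j =>
      bern i w * (g (i + j)%nat s / RtoC (INR (fact j))))%C (S L - i)).
    rewrite (Csum_ext _ (fun i => bern i w * rho i + (T i - bern i w * g i s))%C).
    2: { intros i _. unfold rho, T. rewrite Csum_scal. Cring. }
    (* Along [i + j = m + 1] the terms with [i <= m] add up by convolution to
       [g (m+1) s * w^m / m!], the Taylor term of [g 1 (s + w)]; the term [j = 0] cancels against
       the subtracted [bern i w * g i s]. *)
    rewrite Csum_plus, Csum_minus. unfold T. rewrite Csum_triangle.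
    set (A := sum_n (fun i => bern i w * rho i)%C (S L)).
    rewrite Csum_shift, (Csum_shift (fun i => bern i w * g i s)%C).
    cbv beta. rewrite sum_O.
    rewrite (Csum_ext (fun m => sum_n _ (S m))
      (fun m => bern (S m) w * g (S m) s
        + g (1 + m)%nat s * (w ^ m / RtoC (INR (fact m))))%C).
    - rewrite Csum_plus. unfold rw.
      change (RtoC (INR (fact (0 - 0)))) with (RtoC 1). change (0 + (0 - 0))%nat with 0%nat.
      set (B := sum_n _ L). set (D := sum_n _ L). Cfield.
    - intros m _. rewrite Csum_S, Nat.sub_diag.
      rewrite <- bern_convolution, <- Csum_scal.
      rewrite (Csum_ext (fun i => bern i w * _)%C
        (fun i => g (1 + m)%nat s * (bern i w / RtoC (INR (fact (S m - i)))))%C).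
      + change (RtoC (INR (fact 0))) with (RtoC 1).
        replace (S m + 0)%nat with (S m) by lia. set (B := sum_n _ m). Cfield.
      + intros i Hi. replace (i + (S m - i))%nat with (1 + m)%nat by lia.
        Cfield. apply fact_C_neq_0. }
  rewrite E. unfold Cminus. eapply Rle_trans; [apply Cmod_triangle|]. rewrite Cmod_opp.
  pose proof (bern_radius_ge w) as HR.
  assert (H1 : Cmod (sum_n (fun i => bern i w * rho i)%C (S L))
    <= INR (S (S L)) * (bern_radius w ^ S L * M)).
  { apply Csum_bound_const. intros i Hi. rewrite Cmod_mult.
    apply Rmult_le_compat; try apply Cmod_ge_0; [|now apply Hrho].
    eapply Rle_trans; [apply bern_bound|]. apply Rle_pow; [lra|exact Hi]. }
  assert (H2 : Cmod w ^ S L <= bern_radius w ^ S L).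
  { apply pow_incr. unfold bern_radius. pose proof (Cmod_ge_0 w). lra. }
  replace (L + 3)%nat with (S (S (S L))) by lia. rewrite (S_INR (S (S L))).
  pose proof (pow_le (bern_radius w) (S L) ltac:(lra)). nra.
Qed.

(** * Complex exponential and logarithm *)

Lemma Cmod_le_Re_Im (z : C) : Cmod z <= Rabs (Re z) + Rabs (Im z).
Proof.
  replace z with (RtoC (Re z) + Ci * RtoC (Im z))%C at 1.
  - eapply Rle_trans; [apply Cmod_triangle|].
    rewrite Cmod_mult, Cmod_Ci, !Cmod_R. lra.
  - apply injective_projections; simpl; unfold Re, Im; ring.
Qed.

Lemma im_le_Cmod (z : C) : Rabs (Im z) <= Cmod z.
Proof.
  eapply Rle_trans; [|apply Rmax_Cmod]. apply Rmax_r.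
Qed.

Lemma re_minus (a b : C) : Re (a - b)%C = Re a - Re b.
Proof. unfold Cminus. now rewrite re_plus, re_opp. Qed.

Lemma im_minus (a b : C) : Im (a - b)%C = Im a - Im b.
Proof. unfold Cminus. now rewrite im_plus, im_opp. Qed.

Lemma is_derive_R_eps (f : R -> R) (t l : R) :
  is_derive f t l ->
  forall eps : R, 0 < eps -> exists delta : R, 0 < delta /\
    forall y : R, Rabs (y - t) < delta ->
      Rabs (f y - f t - (y - t) * l) <= eps * Rabs (y - t).
Proof.
  intros [_ H] eps Heps.
  destruct (H t (fun P HP => HP) (mkposreal eps Heps)) as [d Hd].
  exists d. split; [apply cond_pos|]. exact Hd.
Qed.

Lemma is_curve_derive_components (f : R -> C) (t : R) (l : C) :
  is_derive (fun x => Re (f x)) t (Re l) ->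
  is_derive (fun x => Im (f x)) t (Im l) ->
  is_curve_derive f t l.
Proof.
  intros H1 H2. apply is_curve_derive_eps. intros eps Heps.
  destruct (is_derive_R_eps _ _ _ H1 (eps / 2)) as [d1 [Hd1 K1]]; [lra|].
  destruct (is_derive_R_eps _ _ _ H2 (eps / 2)) as [d2 [Hd2 K2]]; [lra|].
  exists (Rmin d1 d2). split; [now apply Rmin_glb_lt|].
  intros y Hy.
  specialize (K1 y (Rlt_le_trans _ _ _ Hy (Rmin_l _ _))).
  specialize (K2 y (Rlt_le_trans _ _ _ Hy (Rmin_r _ _))).
  eapply Rle_trans; [apply Cmod_le_Re_Im|].
  rewrite !re_minus, !im_minus, re_scal_l, im_scal_l. lra.
Qed.

Lemma exp_le (x y : R) : x <= y -> exp x <= exp y.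
Proof. intros [H| ->]; [left; now apply exp_increasing | apply Rle_refl]. Qed.

Lemma Cexp_0 : Cexp 0 = 1%C.
Proof. unfold Cexp. simpl. rewrite exp_0, cos_0, sin_0. apply injective_projections; simpl; ring. Qed.

Lemma Cexp_plus (a b : C) : Cexp (a + b)%C = (Cexp a * Cexp b)%C.
Proof.
  unfold Cexp. rewrite re_plus, im_plus, exp_plus, cos_plus, sin_plus.
  apply injective_projections; simpl; ring.
Qed.

Lemma Cmod_Cexp (z : C) : Cmod (Cexp z) = exp (Re z).
Proof.
  unfold Cmod, Cexp. simpl fst. simpl snd.
  replace ((exp (Re z) * cos (Im z)) ^ 2 + (exp (Re z) * sin (Im z)) ^ 2)
    with (exp (Re z) ^ 2).
  - apply sqrt_pow2. left. apply exp_pos.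
  - pose proof (sin2_cos2 (Im z)) as H. unfold Rsqr in H.
    replace (exp (Re z) ^ 2) with (exp (Re z) ^ 2 * (sin (Im z) * sin (Im z) + cos (Im z) * cos (Im z)))
      by (rewrite H; ring). ring.
Qed.

Lemma Cexp_neq_0 (z : C) : Cexp z <> 0%C.
Proof. apply Cmod_gt_0. rewrite Cmod_Cexp. apply exp_pos. Qed.

Lemma is_curve_derive_Cexp (h : C) (t : R) :
  is_curve_derive (fun x : R => Cexp (RtoC x * h)%C) t (h * Cexp (RtoC t * h))%C.
Proof.
  apply is_curve_derive_components.
  - apply is_derive_ext with (f := fun x => exp (x * Re h) * cos (x * Im h)).
    { intros x. unfold Cexp. now rewrite re_scal_l, im_scal_l. }
    unfold Cexp. rewrite re_mult, re_scal_l, im_scal_l. simpl.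
    auto_derive; [easy|]. ring.
  - apply is_derive_ext with (f := fun x => exp (x * Re h) * sin (x * Im h)).
    { intros x. unfold Cexp. now rewrite re_scal_l, im_scal_l. }
    unfold Cexp. rewrite im_mult, re_scal_l, im_scal_l. simpl.
    auto_derive; [easy|]. ring.
Qed.

Lemma Cexp_bound_1 (h : C) : Cmod (Cexp h - 1)%C <= Cmod h * exp (Cmod h).
Proof.
  replace (Cexp h - 1)%C with (Cexp (RtoC 1 * h) - Cexp (RtoC 0 * h))%C.
  - apply (curve_mvt (fun t => Cexp (RtoC t * h)%C) (fun t => h * Cexp (RtoC t * h))%C).
    + intros t _. apply is_curve_derive_Cexp.
    + intros t Ht. rewrite Cmod_mult, Cmod_Cexp, re_scal_l.
      apply Rmult_le_compat_l; [apply Cmod_ge_0|].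
      apply exp_le. pose proof (re_le_Cmod h) as H.
      pose proof (Rle_abs (Re h)). pose proof (Cmod_ge_0 h). nra.
  - now rewrite Cmult_1_l, Cmult_0_l, Cexp_0.
Qed.

Lemma Cexp_bound_2 (h : C) :
  Cmod (Cexp h - 1 - h)%C <= Cmod h * (Cmod h * exp (Cmod h)).
Proof.
  replace (Cexp h - 1 - h)%C
    with ((Cexp (RtoC 1 * h) - RtoC 1 * h) - (Cexp (RtoC 0 * h) - RtoC 0 * h))%C.
  - apply (curve_mvt (fun t => Cexp (RtoC t * h) - RtoC t * h)%C
      (fun t => h * Cexp (RtoC t * h) - 1 * h)%C).
    + intros t _.
      apply (is_derive_minus (K := R_AbsRing) (V := C_R_NormedModule)
        (fun t => Cexp (RtoC t * h)%C) (fun t => (RtoC t * h)%C)).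
      * apply is_curve_derive_Cexp.
      * rewrite Cmult_1_l. apply is_curve_derive_components.
        -- apply is_derive_ext with (f := fun x => x * Re h);
             [intros x; now rewrite re_scal_l|].
           auto_derive; [easy|ring].
        -- apply is_derive_ext with (f := fun x => x * Im h);
             [intros x; now rewrite im_scal_l|].
           auto_derive; [easy|ring].
    + intros t Ht.
      replace (h * Cexp (RtoC t * h) - 1 * h)%C with (h * (Cexp (RtoC t * h) - 1))%C by ring.
      rewrite Cmod_mult. apply Rmult_le_compat_l; [apply Cmod_ge_0|].
      eapply Rle_trans; [apply Cexp_bound_1|].
      rewrite Cmod_mult, Cmod_R, Rabs_pos_eq by lra.
      pose proof (Cmod_ge_0 h).
      apply Rmult_le_compat; [nra | left; apply exp_pos | nra|].
      apply exp_le. nra.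
  - rewrite Cmult_1_l, Cmult_0_l, Cexp_0. ring.
Qed.

Lemma Cexp_bound_small (h : C) : Cmod h <= 1 -> Cmod (Cexp h - 1 - h)%C <= 3 * Cmod h ^ 2.
Proof.
  intros Hh. eapply Rle_trans; [apply Cexp_bound_2|].
  assert (exp (Cmod h) <= 3) by (eapply Rle_trans; [apply exp_le, Hh | apply exp_le_3]).
  pose proof (Cmod_ge_0 h). nra.
Qed.

Lemma is_Cderive_Cexp (z : C) : is_Cderive Cexp z (Cexp z).
Proof.
  apply is_Cderive_eps. intros eps Heps.
  set (E := Cmod (Cexp z)).
  assert (HE : 0 < E) by (apply Cmod_gt_0, Cexp_neq_0).
  exists (Rmin 1 (eps / (3 * E))).
  assert (0 < eps / (3 * E)) by (apply Rdiv_lt_0_compat; lra).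
  split; [apply Rmin_glb_lt; lra|].
  intros y Hy. set (h := (y - z)%C) in *.
  assert (H1 : Cmod h <= 1) by (eapply Rle_trans; [left; exact Hy | apply Rmin_l]).
  assert (H2 : Cmod h <= eps / (3 * E)) by (eapply Rle_trans; [left; exact Hy | apply Rmin_r]).
  replace (Cexp y - Cexp z - Cexp z * h)%C with (Cexp z * (Cexp h - 1 - h))%C.
  - rewrite Cmod_mult. pose proof (Cexp_bound_small h H1) as H3.
    fold E. pose proof (Cmod_ge_0 h).
    assert (3 * E * Cmod h <= eps).
    { apply Rmult_le_compat_l with (r := 3 * E) in H2; [|lra].
      replace (3 * E * (eps / (3 * E))) with eps in H2 by (field; lra). lra. }
    nra.
  - replace y with (z + h)%C at 1 by (unfold h; ring). rewrite Cexp_plus. ring.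
Qed.

Lemma Re_pos_neq_0 (z : C) : 0 < Re z -> z <> 0%C.
Proof. intros H ->. simpl in H. lra. Qed.

Lemma Re_le_Cmod (z : C) : Re z <= Cmod z.
Proof. eapply Rle_trans; [apply Rle_abs | apply re_le_Cmod]. Qed.

Lemma Cmod_sqr (z : C) : Cmod z * Cmod z = Re z * Re z + Im z * Im z.
Proof. pose proof (Cmod2_alt z). nra. Qed.

(** On the right half plane a single arctangent replaces the two arccosine branches and is smooth
    across the real axis. *)
Lemma Carg_atan (z : C) : 0 < Re z -> Carg z = atan (Im z / Re z).
Proof.
  intros H. pose proof (Re_le_Cmod z) as Hm.
  assert (Hc : 0 < Cmod z) by lra.
  assert (E : acos (Re z / Cmod z) = atan (Rabs (Im z) / Re z)).
  { rewrite acos_atan by now apply Rdiv_lt_0_compat.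
    f_equal.
    replace (1 - (Re z / Cmod z)²) with ((Im z / Cmod z)²).
    - rewrite sqrt_Rsqr_abs. unfold Rdiv at 2. rewrite Rabs_mult, (Rabs_pos_eq (/ Cmod z)).
      + field. lra.
      + left. now apply Rinv_0_lt_compat.
    - unfold Rsqr. pose proof (Cmod_sqr z).
      apply Rmult_eq_reg_r with (Cmod z * Cmod z); [|nra].
      field_simplify; [nra | lra | lra]. }
  unfold Carg. rewrite E. destruct (Rle_dec 0 (Im z)) as [Hi|Hi].
  - now rewrite Rabs_pos_eq.
  - rewrite Rabs_left by lra. rewrite <- atan_opp. f_equal. field. lra.
Qed.

Lemma Cexp_Clog (z : C) : 0 < Re z -> Cexp (Clog z) = z.
Proof.
  intros H. pose proof (Re_le_Cmod z) as Hm.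
  assert (Hc : 0 < Cmod z) by lra.
  unfold Cexp, Clog. simpl Re. simpl Im. rewrite exp_ln by exact Hc.
  rewrite Carg_atan, cos_atan, sin_atan by exact H.
  assert (E : sqrt (1 + (Im z / Re z)²) = Cmod z / Re z).
  { replace (1 + (Im z / Re z)²) with ((Cmod z / Re z)²).
    - apply sqrt_Rsqr. left. now apply Rdiv_lt_0_compat.
    - unfold Rsqr. replace (Cmod z / Re z * (Cmod z / Re z))
        with (Cmod z * Cmod z / (Re z * Re z)) by (field; lra).
      rewrite Cmod_sqr. field. lra. }
  rewrite E. apply injective_projections; simpl; unfold Re, Im in *; field; lra.
Qed.

Lemma continuous_Cmod_eps (f : C -> R) (z : C) :
  continuous (T := C_UniformSpace) (U := R_UniformSpace) f z ->
  forall eps : R, 0 < eps -> exists delta : R, 0 < delta /\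
    forall y : C, Cmod (y - z) < delta -> Rabs (f y - f z) < eps.
Proof.
  intros H eps Heps.
  destruct (H _ (locally_ball (f z) (mkposreal eps Heps))) as [d Hd].
  exists d. split; [apply cond_pos|].
  intros y Hy. apply (Hd y). now apply C_NormedModule_mixin_compat1.
Qed.

Lemma continuous_Re (z : C) : continuous (T := C_UniformSpace) (U := R_UniformSpace) Re z.
Proof. apply (continuous_fst (U := R_UniformSpace) (V := R_UniformSpace)). Qed.

Lemma continuous_Im (z : C) : continuous (T := C_UniformSpace) (U := R_UniformSpace) Im z.
Proof. apply (continuous_snd (U := R_UniformSpace) (V := R_UniformSpace)). Qed.

Lemma Clog_continuous (z : C) : 0 < Re z ->
  forall eps : R, 0 < eps -> exists delta : R, 0 < delta /\
    forall y : C, Cmod (y - z) < delta -> 0 < Re y /\ Cmod (Clog y - Clog z)%C < eps.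
Proof.
  intros H eps Heps.
  (* The logarithm of the squared modulus avoids the square root; the resulting factor 2 is removed
     through [Hln]. *)
  assert (H1 : continuous (T := C_UniformSpace) (U := R_UniformSpace)
    (fun y => ln (Re y * Re y + Im y * Im y)) z).
  { apply continuous_comp with (f := fun y : C => Re y * Re y + Im y * Im y) (g := ln).
    - apply (continuous_plus (K := R_AbsRing) (V := R_NormedModule)
        (fun y : C => Re y * Re y) (fun y : C => Im y * Im y));
        apply (continuous_mult (K := R_AbsRing)); apply continuous_Re || apply continuous_Im.
    - apply (ex_derive_continuous (K := R_AbsRing) (V := R_NormedModule)).
      auto_derive. nra. }
  assert (H2 : continuous (T := C_UniformSpace) (U := R_UniformSpace)
    (fun y => atan (Im y / Re y)) z).
  { apply continuous_comp with (f := fun y : C => Im y / Re y) (g := atan).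
    - apply (continuous_mult (K := R_AbsRing) Im (fun y => / Re y)); [apply continuous_Im|].
      apply continuous_comp with (f := Re) (g := Rinv); [apply continuous_Re|].
      apply (ex_derive_continuous (K := R_AbsRing) (V := R_NormedModule)).
      auto_derive. lra.
    - apply (ex_derive_continuous (K := R_AbsRing) (V := R_NormedModule)).
      auto_derive; easy. }
  destruct (continuous_Cmod_eps _ _ H1 (eps / 2)) as [d1 [Hd1 K1]]; [lra|].
  destruct (continuous_Cmod_eps _ _ H2 (eps / 2)) as [d2 [Hd2 K2]]; [lra|].
  exists (Rmin (Re z) (Rmin d1 d2)). split; [repeat apply Rmin_glb_lt; lra|].
  intros y Hy.
  assert (Hy0 : Cmod (y - z) < Re z) by (eapply Rlt_le_trans; [exact Hy | apply Rmin_l]).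
  assert (Hy1 : Cmod (y - z) < d1)
    by (eapply Rlt_le_trans; [exact Hy | eapply Rle_trans; [apply Rmin_r | apply Rmin_l]]).
  assert (Hy2 : Cmod (y - z) < d2)
    by (eapply Rlt_le_trans; [exact Hy | eapply Rle_trans; [apply Rmin_r | apply Rmin_r]]).
  assert (HRy : 0 < Re y).
  { pose proof (re_le_Cmod (y - z)%C) as K. rewrite re_minus in K.
    unfold Rabs in K. destruct (Rcase_abs (Re y - Re z)); lra. }
  split; [exact HRy|].
  specialize (K1 y Hy1). specialize (K2 y Hy2).
  eapply Rle_lt_trans; [apply Cmod_le_Re_Im|].
  rewrite re_minus, im_minus. unfold Clog. simpl Re. simpl Im.
  rewrite !Carg_atan by assumption.
  assert (Hln : forall x : C, 0 < Re x -> ln (Re x * Re x + Im x * Im x) = 2 * ln (Cmod x)).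
  { intros x Hx. pose proof (Re_le_Cmod x). rewrite <- Cmod_sqr, ln_mult by lra. ring. }
  rewrite !Hln in K1 by assumption.
  replace (2 * ln (Cmod y) - 2 * ln (Cmod z)) with (2 * (ln (Cmod y) - ln (Cmod z))) in K1 by ring.
  rewrite Rabs_mult, (Rabs_pos_eq 2) in K1 by lra.
  pose proof (Rabs_pos (ln (Cmod y) - ln (Cmod z))). lra.
Qed.

(* [Clog] is a continuous right inverse of [Cexp], whose derivative does not vanish. *)
Lemma is_Cderive_Clog (z : C) : 0 < Re z -> is_Cderive Clog z (/ z)%C.
Proof.
  intros H. apply is_Cderive_eps. intros eps Heps.
  pose proof (Re_pos_neq_0 z H) as Hz. pose proof (proj1 (Cmod_gt_0 z) Hz) as Hm.
  (* For [Cmod k <= 1/6] the remainder [3 |k|^2] of the exponential is at most [|k|/2], so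
     [|k| <= 2 |e^k - 1|]. The remainder is therefore at most [6 |k| |e^k - 1|], which the second
     bound turns into [eps * |y - z|]. *)
  destruct (Clog_continuous z H (Rmin (/ 6) (eps * Cmod z / 6))) as [d [Hd K]].
  { apply Rmin_glb_lt; [lra|]. assert (0 < eps * Cmod z) by now apply Rmult_lt_0_compat. lra. }
  exists d. split; [exact Hd|]. intros y Hy.
  destruct (K y Hy) as [HRy Hk]. set (k := (Clog y - Clog z)%C) in *.
  assert (Hk1 : Cmod k < / 6) by (eapply Rlt_le_trans; [exact Hk | apply Rmin_l]).
  assert (Hk2 : Cmod k < eps * Cmod z / 6) by (eapply Rlt_le_trans; [exact Hk | apply Rmin_r]).
  assert (Ey : (y - z = z * (Cexp k - 1))%C).
  { rewrite <- (Cexp_Clog y HRy) at 1. replace (Clog y) with (Clog z + k)%C by (unfold k; ring).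
    rewrite Cexp_plus, Cexp_Clog by exact H. ring. }
  pose proof (Cexp_bound_small k ltac:(lra)) as B. pose proof (Cmod_ge_0 k) as Hk0.
  assert (B2 : Cmod k / 2 <= Cmod (Cexp k - 1)%C).
  { assert (Cmod k <= Cmod (Cexp k - 1)%C + Cmod (Cexp k - 1 - k)%C).
    { replace (Cmod k) with (Cmod ((Cexp k - 1) + - (Cexp k - 1 - k))%C) by (f_equal; ring).
      eapply Rle_trans; [apply Cmod_triangle|]. rewrite Cmod_opp. lra. }
    nra. }
  rewrite Ey, Cmod_mult.
  replace (k - / z * (z * (Cexp k - 1)))%C with (- (Cexp k - 1 - k))%C by (field; exact Hz).
  rewrite Cmod_opp.
  apply Rle_trans with (3 * Cmod k * (2 * Cmod (Cexp k - 1)%C)); [nra|].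
  pose proof (Cmod_ge_0 (Cexp k - 1)%C). nra.
Qed.

(** * The iterated derivatives of [powlog] *)

(** The pair [(a, b)] stands for [z^(n+1-i) (a log z + b)], starting from the primitive of
    [z^n log z] without constant term; the recursion is the product rule. *)
Fixpoint powlog_coef (n i : nat) : R * R :=
  match i with
  | O => (/ (INR n + 1), - / (INR n + 1) ^ 2)
  | S i' =>
      let (a, b) := powlog_coef n i' in
      ((INR n + 1 - INR i') * a, (INR n + 1 - INR i') * b + a)
  end.

Definition pl_log (n i : nat) : R := fst (powlog_coef n i).
Definition pl_pow (n i : nat) : R := snd (powlog_coef n i).

Lemma pl_log_S (n i : nat) : pl_log n (S i) = (INR n + 1 - INR i) * pl_log n i.
Proof. unfold pl_log. simpl. now destruct (powlog_coef n i). Qed.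

Lemma pl_pow_S (n i : nat) :
  pl_pow n (S i) = (INR n + 1 - INR i) * pl_pow n i + pl_log n i.
Proof. unfold pl_pow, pl_log. simpl. now destruct (powlog_coef n i). Qed.

(** The factor [n + 1 - i] vanishes at [i = n + 1]. From the next index on the derivatives are pure
    negative powers, which is the source of all decay estimates. *)
Lemma pl_log_0 (n i : nat) : (n + 2 <= i)%nat -> pl_log n i = 0.
Proof.
  intros H. induction i as [|i IH]; [lia|].
  rewrite pl_log_S. destruct (Nat.eq_dec i (n + 1)) as [->|E].
  - rewrite plus_INR. simpl. ring.
  - rewrite IH by lia. ring.
Qed.

(* The antiderivative of [powlog n] at index 0, [powlog n] at index 1, then its
   successive derivatives. *)
Definition pl (n i : nat) (z : C) : C :=
  (z ^ (n + 1) * (/ z) ^ i * (RtoC (pl_log n i) * Clog z + RtoC (pl_pow n i)))%C.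

Lemma is_Cderive_Cinv (z : C) : z <> 0%C -> is_Cderive Cinv z (- (/ z * / z))%C.
Proof.
  intros Hz. apply is_Cderive_eps. intros eps Heps.
  pose proof (proj1 (Cmod_gt_0 z) Hz) as Hm. set (m := Cmod z) in *.
  assert (Hm3 : 0 < m ^ 3) by now apply pow_lt.
  (* The remainder is [h^2 / (y z^2)], and [|y| > m/2] bounds it by [2 |h|^2 / m^3]. *)
  exists (Rmin (m / 2) (eps * m ^ 3 / 2)). split; [apply Rmin_glb_lt; nra|].
  intros y Hy. set (h := (y - z)%C) in *.
  assert (H1 : Cmod h < m / 2) by (eapply Rlt_le_trans; [exact Hy | apply Rmin_l]).
  assert (H2 : Cmod h < eps * m ^ 3 / 2) by (eapply Rlt_le_trans; [exact Hy | apply Rmin_r]).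
  assert (Hym : m / 2 < Cmod y).
  { assert (m <= Cmod y + Cmod h); [|lra].
    unfold m. replace z with (y + - h)%C at 1 by (unfold h; ring).
    eapply Rle_trans; [apply Cmod_triangle|]. rewrite Cmod_opp. lra. }
  assert (Hy0 : y <> 0%C) by (apply Cmod_gt_0; lra).
  replace (/ y - / z - - (/ z * / z) * h)%C with (h * (h * (/ y * (/ z * / z))))%C
    by (unfold h; field; now split).
  rewrite !Cmod_mult, !Cmod_inv by assumption. fold m.
  rewrite (Rmult_comm eps). apply Rmult_le_compat_l; [apply Cmod_ge_0|].
  apply Rle_trans with (Cmod h * (/ (m / 2) * (/ m * / m))).
  - apply Rmult_le_compat_l; [apply Cmod_ge_0|].
    apply Rmult_le_compat_r.
    + left. apply Rmult_lt_0_compat; now apply Rinv_0_lt_compat.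
    + apply Rinv_le_contravar; lra.
  - replace (Cmod h * (/ (m / 2) * (/ m * / m))) with (Cmod h * 2 / m ^ 3) by (field; lra).
    apply Rmult_le_reg_r with (m ^ 3); [lra|].
    unfold Rdiv. rewrite Rmult_assoc, Rinv_l by lra. lra.
Qed.

Lemma is_Cderive_pl (n i : nat) (z : C) : 0 < Re z -> is_Cderive (pl n i) z (pl n (S i) z).
Proof.
  intros H. pose proof (Re_pos_neq_0 z H) as Hz.
  set (e := (RtoC (INR n) + 1 - RtoC (INR i))%C).
  assert (D1 : is_Cderive (fun x => x ^ (n + 1) * (/ x) ^ i)%C z
    (RtoC (INR (n + 1)) * z ^ pred (n + 1) * (/ z) ^ i
     + z ^ (n + 1) * (- (/ z * / z) * (RtoC (INR i) * (/ z) ^ pred i)))%C).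
  { apply (is_Cderive_mult (fun x => x ^ (n + 1))%C (fun x => (/ x) ^ i)%C).
    - apply is_Cderive_pow.
    - apply (is_Cderive_comp (fun x => x ^ i)%C Cinv);
        [apply is_Cderive_pow | now apply is_Cderive_Cinv]. }
  replace (RtoC (INR (n + 1)) * z ^ pred (n + 1) * (/ z) ^ i
     + z ^ (n + 1) * (- (/ z * / z) * (RtoC (INR i) * (/ z) ^ pred i)))%C
    with (e * (z ^ (n + 1) * (/ z) ^ S i))%C in D1.
  2: { unfold e. rewrite Nat.add_1_r. simpl pred. rewrite S_INR, RtoC_plus.
       destruct i as [|i]; simpl; field; exact Hz. }
  assert (D2 : is_Cderive (fun x => RtoC (pl_log n i) * Clog x + RtoC (pl_pow n i))%C z
    (RtoC (pl_log n i) * / z + 0)%C).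
  { apply is_Cderive_plus; [|apply is_Cderive_const].
    apply is_Cderive_scal, is_Cderive_Clog, H. }
  unfold pl at 2. rewrite pl_log_S, pl_pow_S, !RtoC_plus, !RtoC_mult, !RtoC_minus, !RtoC_plus.
  replace (z ^ (n + 1) * (/ z) ^ S i * _)%C
    with (e * (z ^ (n + 1) * (/ z) ^ S i) * (RtoC (pl_log n i) * Clog z + RtoC (pl_pow n i))
          + z ^ (n + 1) * (/ z) ^ i * (RtoC (pl_log n i) * / z + 0))%C.
  - exact (is_Cderive_mult _ _ _ _ _ D1 D2).
  - unfold e. simpl. ring.
Qed.

Lemma pl_1 (n : nat) (z : C) : z <> 0%C -> pl n 1 z = powlog n z.
Proof.
  intros Hz. unfold pl, powlog.
  assert (Hn : INR n + 1 <> 0) by (pose proof (pos_INR n); lra).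
  replace (pl_log n 1) with 1 by (rewrite pl_log_S; unfold pl_log; simpl; field; exact Hn).
  replace (pl_pow n 1) with 0
    by (rewrite pl_pow_S; unfold pl_log, pl_pow; simpl; field; exact Hn).
  rewrite Nat.add_1_r. simpl. field. exact Hz.
Qed.

Lemma pl_0 (n : nat) (z : C) :
  pl n 0 z = (z ^ (n + 1) / (RtoC (INR n) + 1) * Clog z
              - z ^ (n + 1) / (RtoC (INR n) + 1) ^ 2)%C.
Proof.
  assert (Hn : INR n + 1 <> 0) by (pose proof (pos_INR n); lra).
  unfold pl, pl_log, pl_pow. cbn [powlog_coef fst snd].
  rewrite RtoC_opp, !RtoC_inv, RtoC_pow, RtoC_plus by (try apply pow_nonzero; exact Hn).
  assert (RtoC (INR n) + 1 <> 0)%C by (rewrite <- RtoC_plus; now apply RtoC_neq_0).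
  simpl. field. exact H.
Qed.

Lemma pl_log_pos (n i : nat) : (i <= n)%nat ->
  pl_log n (S i) = INR (fact n) / INR (fact (n - i)).
Proof.
  induction i as [|i IH]; intros Hi.
  - rewrite pl_log_S, Nat.sub_0_r. unfold pl_log. simpl. pose proof (pos_INR n).
    field. split; [apply INR_fact_neq_0 | lra].
  - rewrite pl_log_S, IH by lia.
    replace (n - i)%nat with (S (n - S i)) by lia.
    rewrite fact_simpl, mult_INR.
    replace (INR (S (n - S i))) with (INR n + 1 - INR (S i)).
    + field. split; [apply INR_fact_neq_0|]. rewrite S_INR.
      apply lt_INR in Hi. lra.
    + rewrite <- (Nat.sub_add (S i) n Hi) at 1. rewrite plus_INR, (S_INR (n - S i)). ring.
Qed.

Lemma harmonic_S (k : nat) : harmonic (S k) = harmonic k + / INR (S k).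
Proof. unfold harmonic. rewrite sum_n_Sm by lia. reflexivity. Qed.

(** Dividing the recursion for [pl_pow] by the one for [pl_log] shows that their ratio grows by
    [1/(n - i)] at each step; the increments telescope as harmonic numbers. *)
Lemma pl_pow_harmonic (n i : nat) : (i <= n)%nat ->
  pl_pow n (S i) = pl_log n (S i) * (harmonic n - harmonic (n - i)).
Proof.
  induction i as [|i IH]; intros Hi.
  - rewrite Nat.sub_0_r, pl_pow_S. unfold pl_log, pl_pow. simpl. pose proof (pos_INR n).
    field. lra.
  - rewrite pl_pow_S, IH, (pl_log_S n (S i)) by lia.
    replace (n - i)%nat with (S (n - S i)) by lia. rewrite harmonic_S.
    replace (INR (S (n - S i))) with (INR n + 1 - INR (S i)).
    + field. rewrite S_INR. apply lt_INR in Hi. lra.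
    + rewrite <- (Nat.sub_add (S i) n Hi) at 1. rewrite plus_INR, (S_INR (n - S i)). ring.
Qed.

Lemma pl_pow_const (n : nat) : pl_pow n (S n) = INR (fact n) * harmonic n.
Proof.
  rewrite pl_pow_harmonic, pl_log_pos, Nat.sub_diag by lia.
  unfold harmonic at 2. rewrite sum_n_m_zero by lia. change (zero : R) with 0. simpl. field.
Qed.

(** * Limits of complex sequences *)

Definition is_Clim (e : nat -> C) (l : C) : Prop :=
  is_lim_seq (fun m => Cmod (e m - l)%C) 0.

(** Built from the total [Lim_seq], so that constants can be defined as limits before convergence is
    known; it is meaningful only for convergent sequences. *)
Definition Clim (e : nat -> C) : C :=
  (real (Lim_seq (fun m => Re (e m))), real (Lim_seq (fun m => Im (e m)))).

Lemma is_Clim_eps (e : nat -> C) (l : C) :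
  is_Clim e l <->
  forall eps : R, 0 < eps -> exists N, forall m, (N <= m)%nat -> Cmod (e m - l)%C < eps.
Proof.
  unfold is_Clim. rewrite <- is_lim_seq_spec. split.
  - intros H eps Heps. destruct (H (mkposreal eps Heps)) as [N HN].
    exists N. intros m Hm. specialize (HN m Hm).
    rewrite Rminus_0_r, Rabs_pos_eq in HN by apply Cmod_ge_0. exact HN.
  - intros H eps. destruct (H eps (cond_pos eps)) as [N HN].
    exists N. intros m Hm. rewrite Rminus_0_r, Rabs_pos_eq by apply Cmod_ge_0.
    now apply HN.
Qed.

Lemma is_Clim_Re (e : nat -> C) (l : C) : is_Clim e l -> is_lim_seq (fun m => Re (e m)) (Re l).
Proof.
  rewrite is_Clim_eps. intros H. apply is_lim_seq_spec. intros eps.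
  destruct (H eps (cond_pos eps)) as [N HN]. exists N. intros m Hm.
  rewrite <- re_minus. eapply Rle_lt_trans; [apply re_le_Cmod | now apply HN].
Qed.

Lemma is_Clim_Im (e : nat -> C) (l : C) : is_Clim e l -> is_lim_seq (fun m => Im (e m)) (Im l).
Proof.
  rewrite is_Clim_eps. intros H. apply is_lim_seq_spec. intros eps.
  destruct (H eps (cond_pos eps)) as [N HN]. exists N. intros m Hm.
  rewrite <- im_minus. eapply Rle_lt_trans; [apply im_le_Cmod | now apply HN].
Qed.

Lemma Clim_unique (e : nat -> C) (l : C) : is_Clim e l -> Clim e = l.
Proof.
  intros H. unfold Clim.
  rewrite (is_lim_seq_unique _ _ (is_Clim_Re _ _ H)), (is_lim_seq_unique _ _ (is_Clim_Im _ _ H)).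
  now destruct l.
Qed.

Lemma inv_sqr_telescope (x : R) : 1 <= x -> / x ^ 2 <= 2 * (/ x - / (x + 1)).
Proof.
  intros Hx. apply Rmult_le_reg_r with (x ^ 2 * (x + 1)); [nra|].
  replace (/ x ^ 2 * (x ^ 2 * (x + 1))) with (x + 1) by (field; nra).
  replace (2 * (/ x - / (x + 1)) * (x ^ 2 * (x + 1))) with (2 * x) by (field; lra). lra.
Qed.

Lemma div_sqr_nonneg (z : C) (K : R) (m : nat) :
  Cmod z <= K / INR m ^ 2 -> (0 < m)%nat -> 0 <= K.
Proof.
  intros H Hm. assert (H0 : 0 < INR m ^ 2) by now apply pow_lt, lt_0_INR.
  pose proof (Cmod_ge_0 z).
  replace K with (K / INR m ^ 2 * INR m ^ 2) by (field; now apply not_0_INR, Nat.neq_0_lt_0).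
  nra.
Qed.

(** Increments of order [1/p^2] telescope against [2 (1/p - 1/(p+1))]. Keeping the difference
    explicit yields both the Cauchy property and the rate of convergence. *)
Lemma inv_sqr_steps (e : nat -> C) (K : R) (m : nat) :
  (forall p, (m <= p)%nat -> Cmod (e (S p) - e p)%C <= K / INR (S p) ^ 2) ->
  forall q, Cmod (e (m + q)%nat - e m)%C <= 2 * K * (/ INR (S m) - / INR (S (m + q))).
Proof.
  intros H. assert (HK : 0 <= K).
  { eapply div_sqr_nonneg; [exact (H m (Nat.le_refl m)) | lia]. }
  induction q as [|q IH].
  - rewrite Nat.add_0_r. replace (e m - e m)%C with (RtoC 0) by ring. rewrite Cmod_0. lra.
  - rewrite Nat.add_succ_r.
    replace (e (S (m + q)) - e m)%C with ((e (S (m + q)) - e (m + q)%nat) + (e (m + q)%nat - e m))%C by ring.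
    eapply Rle_trans; [apply Cmod_triangle|].
    specialize (H (m + q)%nat ltac:(lia)).
    pose proof (inv_sqr_telescope (INR (S (m + q)))) as H2.
    rewrite <- (S_INR (S (m + q))) in H2.
    assert (1 <= INR (S (m + q))) by (rewrite S_INR; pose proof (pos_INR (m + q)); lra).
    specialize (H2 ltac:(assumption)). unfold Rdiv in H. nra.
Qed.

Lemma inv_sqr_limit (e : nat -> C) (K : R) (l : C) (m : nat) :
  (forall p, (m <= p)%nat -> Cmod (e (S p) - e p)%C <= K / INR (S p) ^ 2) ->
  is_Clim e l -> Cmod (e m - l)%C <= 2 * K / INR (S m).
Proof.
  intros H Hl. apply le_epsilon. intros eps Heps.
  destruct (proj1 (is_Clim_eps e l) Hl eps Heps) as [N HN].
  specialize (HN (m + N)%nat ltac:(lia)).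
  pose proof (inv_sqr_steps e K m H N) as H1.
  assert (HK : 0 <= K).
  { eapply div_sqr_nonneg; [exact (H m (Nat.le_refl m)) | lia]. }
  replace (e m - l)%C with (- (e (m + N)%nat - e m) + (e (m + N)%nat - l))%C by ring.
  eapply Rle_trans; [apply Cmod_triangle|]. rewrite Cmod_opp.
  assert (0 < / INR (S (m + N))) by (apply Rinv_0_lt_compat, lt_0_INR; lia).
  unfold Rdiv. nra.
Qed.

Lemma Clim_correct (e : nat -> C) (K : R) :
  (forall p, Cmod (e (S p) - e p)%C <= K / INR (S p) ^ 2) -> is_Clim e (Clim e).
Proof.
  intros H.
  assert (HC : forall eps : R, 0 < eps -> exists N, forall m p, (N <= m)%nat -> (N <= p)%nat ->
    Cmod (e m - e p)%C < eps).
  { intros eps Heps. assert (HK : 0 <= K).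
    { specialize (H 0%nat). pose proof (Cmod_ge_0 (e 1%nat - e 0%nat)%C). simpl in H. lra. }
    destruct (archimed_cor1 (eps / (4 * K + 1))) as [N [HN HN0]];
      [apply Rdiv_lt_0_compat; lra|].
    assert (HB : forall m, (N <= m)%nat -> Cmod (e m - e N)%C < eps / 2).
    { intros m Hm. pose proof (inv_sqr_steps e K N (fun p _ => H p) (m - N)) as H1.
      replace (N + (m - N))%nat with m in H1 by lia.
      eapply Rle_lt_trans; [exact H1|].
      assert (0 < / INR (S m)) by (apply Rinv_0_lt_compat, lt_0_INR; lia).
      assert (/ INR (S N) <= / INR N)
        by (apply Rinv_le_contravar; [now apply lt_0_INR | apply le_INR; lia]).
      assert (0 < / INR N) by now apply Rinv_0_lt_compat, lt_0_INR.
      apply Rle_lt_trans with (2 * K * / INR N); [nra|].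
      apply Rmult_lt_compat_r with (r := (4 * K + 1)) in HN; [|lra].
      unfold Rdiv in HN. rewrite Rmult_assoc, Rinv_l in HN by lra. lra. }
    exists N. intros m p Hm Hp.
    replace (e m - e p)%C with ((e m - e N) + - (e p - e N))%C by ring.
    eapply Rle_lt_trans; [apply Cmod_triangle|]. rewrite Cmod_opp.
    pose proof (HB m Hm). pose proof (HB p Hp). lra. }
  assert (H1 : ex_finite_lim_seq (fun m => Re (e m))).
  { apply ex_lim_seq_cauchy_corr. intros eps. destruct (HC eps (cond_pos eps)) as [N HN].
    exists N. intros m p Hm Hp. rewrite <- re_minus.
    eapply Rle_lt_trans; [apply re_le_Cmod | now apply HN]. }
  assert (H2 : ex_finite_lim_seq (fun m => Im (e m))).
  { apply ex_lim_seq_cauchy_corr. intros eps. destruct (HC eps (cond_pos eps)) as [N HN].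
    exists N. intros m p Hm Hp. rewrite <- im_minus.
    eapply Rle_lt_trans; [apply im_le_Cmod | now apply HN]. }
  apply Lim_seq_correct' in H1, H2. apply is_lim_seq_spec in H1, H2.
  apply is_Clim_eps. intros eps Heps.
  assert (Heps2 : 0 < eps / 2) by lra.
  destruct (H1 (mkposreal _ Heps2)) as [N1 HN1]. destruct (H2 (mkposreal _ Heps2)) as [N2 HN2].
  exists (max N1 N2). intros m Hm.
  specialize (HN1 m ltac:(lia)). specialize (HN2 m ltac:(lia)). simpl in HN1, HN2.
  eapply Rle_lt_trans; [apply Cmod_le_Re_Im|]. rewrite re_minus, im_minus.
  unfold Clim. simpl Re at 2. simpl Im at 2. lra.
Qed.

Lemma is_lim_seq_inv_S (K : R) : is_lim_seq (fun m => K / INR (S m)) 0.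
Proof.
  replace (Finite 0) with (Rbar_mult K 0) by (simpl; f_equal; ring).
  apply (is_lim_seq_scal_l (fun m => / INR (S m)) K 0).
  replace (Finite 0) with (Rbar_inv p_infty) by reflexivity.
  apply is_lim_seq_inv; [|discriminate].
  apply (is_lim_seq_incr_1 INR). apply is_lim_seq_INR.
Qed.

Lemma is_Clim_of_bound (e : nat -> C) (l : C) (K : R) :
  (forall m, Cmod (e m - l)%C <= K / INR (S m)) -> is_Clim e l.
Proof.
  intros H. apply is_lim_seq_le_le with (u := fun _ => 0) (w := fun m => K / INR (S m)).
  - intros m. split; [apply Cmod_ge_0 | apply H].
  - apply is_lim_seq_const.
  - apply is_lim_seq_inv_S.
Qed.

Lemma is_Clim_unique (e : nat -> C) (l l' : C) : is_Clim e l -> is_Clim e l' -> l = l'.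
Proof. intros H H'. now rewrite <- (Clim_unique e l H), <- (Clim_unique e l' H'). Qed.

Lemma is_Clim_plus (e f : nat -> C) (l l' : C) :
  is_Clim e l -> is_Clim f l' -> is_Clim (fun m => e m + f m)%C (l + l')%C.
Proof.
  rewrite !is_Clim_eps. intros H H' eps Heps.
  destruct (H (eps / 2)) as [N HN]; [lra|]. destruct (H' (eps / 2)) as [N' HN']; [lra|].
  exists (max N N'). intros m Hm.
  specialize (HN m ltac:(lia)). specialize (HN' m ltac:(lia)).
  replace (e m + f m - (l + l'))%C with ((e m - l) + (f m - l'))%C by ring.
  eapply Rle_lt_trans; [apply Cmod_triangle | lra].
Qed.

Lemma is_Clim_scal (a : C) (e : nat -> C) (l : C) :
  is_Clim e l -> is_Clim (fun m => a * e m)%C (a * l)%C.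
Proof.
  rewrite !is_Clim_eps. intros H eps Heps. pose proof (Cmod_ge_0 a).
  destruct (H (eps / (Cmod a + 1))) as [N HN]; [apply Rdiv_lt_0_compat; lra|].
  exists N. intros m Hm. specialize (HN m Hm).
  replace (a * e m - a * l)%C with (a * (e m - l))%C by ring.
  rewrite Cmod_mult. pose proof (Cmod_ge_0 (e m - l)%C).
  apply Rmult_lt_compat_r with (r := Cmod a + 1) in HN; [|lra].
  unfold Rdiv in HN. rewrite Rmult_assoc, Rinv_l in HN by lra. nra.
Qed.

Lemma is_Clim_const (a : C) : is_Clim (fun _ => a) a.
Proof.
  apply is_Clim_eps. intros eps Heps. exists 0%nat. intros m _.
  replace (a - a)%C with (RtoC 0) by ring. now rewrite Cmod_0.
Qed.

Lemma is_Clim_bound (e : nat -> C) (l : C) (B : R) :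
  is_Clim e l -> (forall m, Cmod (e m) <= B) -> Cmod l <= B.
Proof.
  rewrite is_Clim_eps. intros H HB. apply le_epsilon. intros eps Heps.
  destruct (H eps Heps) as [N HN]. specialize (HN N (Nat.le_refl N)). specialize (HB N).
  replace l with (e N + - (e N - l))%C by ring.
  eapply Rle_trans; [apply Cmod_triangle|]. rewrite Cmod_opp. lra.
Qed.

(* The uniform bound on the second derivatives makes the first-order Taylor
   expansion of [d m] uniform in [m]. *)
Lemma is_Cderive_limit (d d' d'' : nat -> C -> C) (D : C -> C) (w D' : C) (delta B : R) :
  0 < delta ->
  (forall m z, Cmod (z - w)%C < delta -> is_Cderive (d m) z (d' m z)) ->
  (forall m z, Cmod (z - w)%C < delta -> is_Cderive (d' m) z (d'' m z)) ->
  (forall m z, Cmod (z - w)%C < delta -> Cmod (d'' m z) <= B) ->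
  (forall z, Cmod (z - w)%C < delta -> is_Clim (fun m => d m z) (D z)) ->
  is_Clim (fun m => d' m w) D' ->
  is_Cderive D w D'.
Proof.
  intros Hdelta H1 H2 HB HD HD'. apply is_Cderive_eps. intros eps Heps.
  assert (HB0 : 0 <= B).
  { eapply Rle_trans; [apply Cmod_ge_0 | apply (HB 0%nat w)].
    replace (w - w)%C with (RtoC 0) by ring. now rewrite Cmod_0. }
  exists (Rmin delta (eps / (B + 1))).
  assert (0 < eps / (B + 1)) by (apply Rdiv_lt_0_compat; lra).
  split; [now apply Rmin_glb_lt|].
  intros y Hy. set (h := (y - w)%C) in *.
  assert (Hh1 : Cmod h < delta) by (eapply Rlt_le_trans; [exact Hy | apply Rmin_l]).
  assert (Hh2 : Cmod h < eps / (B + 1)) by (eapply Rlt_le_trans; [exact Hy | apply Rmin_r]).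
  assert (Hseg : forall t, 0 <= t <= 1 -> Cmod ((w + RtoC t * h) - w)%C < delta).
  { intros t Ht. replace ((w + RtoC t * h) - w)%C with (RtoC t * h)%C by ring.
    rewrite Cmod_mult, Cmod_R, Rabs_pos_eq by lra. pose proof (Cmod_ge_0 h). nra. }
  assert (K : Cmod (D y - D w - D' * h)%C <= B * Cmod h ^ 2).
  { apply (is_Clim_bound (fun m => d m y + (- (1)) * d m w + (- h) * d' m w)%C).
    - replace (D y - D w - D' * h)%C with (D y + - (1) * D w + (- h) * D')%C by ring.
      repeat apply is_Clim_plus; try apply is_Clim_scal.
      + now apply HD.
      + apply HD. replace (w - w)%C with (RtoC 0) by ring. now rewrite Cmod_0.
      + exact HD'.
    - intros m.
      pose proof (taylor_bound (fun j => match j with O => d m | 1%nat => d' m | _ => d'' m end)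
        w h B 1) as T.
      rewrite Csum_S, sum_O in T. simpl fact in T. cbv beta iota in T.
      replace (w + h)%C with y in T by (unfold h; ring).
      replace (d m y + - (1) * d m w + - h * d' m w)%C
        with (d m y - (d m w * (h ^ 0 / RtoC (INR 1)) + d' m w * (h ^ 1 / RtoC (INR 1))))%C
        by (simpl; field).
      apply T.
      + intros j t Hj Ht. destruct j as [|[|j]]; [| |lia]; [apply H1 | apply H2]; now apply Hseg.
      + intros t Ht. now apply HB, Hseg. }
  eapply Rle_trans; [exact K|].
  pose proof (Cmod_ge_0 h).
  apply Rmult_lt_compat_r with (r := B + 1) in Hh2; [|lra].
  unfold Rdiv in Hh2. rewrite Rmult_assoc, Rinv_l in Hh2 by lra. nra.
Qed.

Lemma is_Cderive_locally_bounded (f : C -> C) (z l : C) :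
  is_Cderive f z l ->
  exists delta B, 0 < delta /\ forall y, Cmod (y - z)%C < delta -> Cmod (f y) <= B.
Proof.
  intros H. apply is_Cderive_eps with (eps := 1) in H; [|lra].
  destruct H as [d [Hd H]].
  exists d, (Cmod (f z) + (Cmod l + 1) * d). split; [exact Hd|].
  intros y Hy. specialize (H y Hy).
  replace (f y) with ((f y - f z - l * (y - z)) + (f z + l * (y - z)))%C by ring.
  eapply Rle_trans; [apply Cmod_triangle|].
  assert (Cmod (f z + l * (y - z))%C <= Cmod (f z) + Cmod l * Cmod (y - z)%C)
    by (eapply Rle_trans; [apply Cmod_triangle | rewrite Cmod_mult; lra]).
  pose proof (Cmod_ge_0 l). nra.
Qed.

(** * Integrals of complex functions along segments *)

Notation is_CRInt := (is_RInt (V := C_R_NormedModule)).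

(** The fundamental theorem of calculus along a segment; the derivative [f''] provides the
    continuity of the integrand. *)
Lemma is_CRInt_line (f f' f'' : C -> C) (a h : C) (x y : R) :
  (forall t, Rmin x y <= t <= Rmax x y ->
     is_Cderive f (a + RtoC t * h)%C (f' (a + RtoC t * h)%C)) ->
  (forall t, Rmin x y <= t <= Rmax x y ->
     is_Cderive f' (a + RtoC t * h)%C (f'' (a + RtoC t * h)%C)) ->
  is_CRInt (fun t => h * f' (a + RtoC t * h))%C x y
    (f (a + RtoC y * h) - f (a + RtoC x * h))%C.
Proof.
  intros H1 H2.
  apply (is_RInt_derive (V := C_R_CompleteNormedModule)
    (fun t => f (a + RtoC t * h)%C) (fun t => h * f' (a + RtoC t * h))%C).
  - intros t Ht. now apply is_curve_derive_line, H1.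
  - intros t Ht. apply (ex_derive_continuous (K := R_AbsRing) (V := C_R_NormedModule)).
    exists (h * (h * f'' (a + RtoC t * h)))%C.
    apply is_derive_ext with (f := fun t : R => (fun z => h * f' z)%C (a + RtoC t * h)%C);
      [reflexivity|].
    apply (is_curve_derive_line (fun z => h * f' z)%C).
    now apply is_Cderive_scal, H2.
Qed.

Lemma is_CRInt_unique (f : R -> C) (x y : R) (l l' : C) :
  is_CRInt f x y l -> is_CRInt f x y l' -> l = l'.
Proof.
  intros H H'.
  rewrite <- (is_RInt_unique (V := C_R_CompleteNormedModule) _ _ _ _ H).
  now apply (is_RInt_unique (V := C_R_CompleteNormedModule)).
Qed.

Lemma is_CRInt_norm (f : R -> C) (x y : R) (l : C) (M : R) :
  x <= y -> (forall t, x <= t <= y -> Cmod (f t) <= M) -> is_CRInt f x y l ->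
  Cmod l <= (y - x) * M.
Proof.
  intros Hxy HM H. rewrite Cmod_norm.
  apply (norm_RInt_le_const f x y l M Hxy); [|exact H].
  intros t Ht. rewrite <- Cmod_norm. now apply HM.
Qed.

Lemma is_CRInt_minus (f g : R -> C) (x y : R) (lf lg : C) :
  is_CRInt f x y lf -> is_CRInt g x y lg -> is_CRInt (fun t => f t - g t)%C x y (lf - lg)%C.
Proof. exact (is_RInt_minus f g x y lf lg). Qed.

Lemma is_CRInt_plus (f g : R -> C) (x y : R) (lf lg : C) :
  is_CRInt f x y lf -> is_CRInt g x y lg -> is_CRInt (fun t => f t + g t)%C x y (lf + lg)%C.
Proof. exact (is_RInt_plus f g x y lf lg). Qed.

(** The scalars of [C_R_NormedModule] are real, so a complex factor is handled by components. *)
Lemma is_CRInt_scal (a : C) (f : R -> C) (x y : R) (l : C) :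
  is_CRInt f x y l -> is_CRInt (fun t => a * f t)%C x y (a * l)%C.
Proof.
  intros H.
  pose proof (is_RInt_fct_extend_fst _ _ _ _ H) as H1.
  pose proof (is_RInt_fct_extend_snd _ _ _ _ H) as H2.
  unfold Cmult.
  apply (is_RInt_fct_extend_pair (U := R_NormedModule) (V := R_NormedModule)
    (fun t => (fst a * fst (f t) - snd a * snd (f t), fst a * snd (f t) + snd a * fst (f t)))).
  - apply (is_RInt_minus (V := R_NormedModule) (fun t => fst a * fst (f t)) (fun t => snd a * snd (f t)));
      apply (is_RInt_scal (V := R_NormedModule)); assumption.
  - apply (is_RInt_plus (V := R_NormedModule) (fun t => fst a * snd (f t)) (fun t => snd a * fst (f t)));
      apply (is_RInt_scal (V := R_NormedModule)); assumption.
Qed.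

(** * The Euler-Maclaurin constant *)

Lemma pl_decay (n q : nat) (z : C) (x : R) : (1 <= q)%nat -> 0 < x -> x <= Cmod z ->
  Cmod (pl n (n + 1 + q) z) <= Rabs (pl_pow n (n + 1 + q)) / x ^ q.
Proof.
  intros Hq Hx Hz. unfold pl. rewrite pl_log_0 by lia.
  assert (Hz0 : z <> 0%C) by (apply Cmod_gt_0; lra).
  rewrite Cmult_0_l, Cplus_0_l, (Cpow_add_r (/ z) (n + 1)%nat q).
  replace (z ^ (n + 1) * ((/ z) ^ (n + 1) * (/ z) ^ q))%C with ((/ z) ^ q)%C.
  - rewrite Cmod_mult, Cmod_R, Cmod_pow, Cmod_inv by exact Hz0.
    rewrite Rmult_comm. apply Rmult_le_compat_l; [apply Rabs_pos|].
    rewrite pow_inv. apply Rinv_le_contravar; [now apply pow_lt | apply pow_incr; lra].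
  - rewrite Cmult_assoc, <- Cpow_mult_l, Cinv_r, Cpow_1_l by exact Hz0. ring.
Qed.

(** For [j = 0] this is the partial sum minus the Euler-Maclaurin polynomial of degree [L] in [w].
    The index [j] counts derivatives in [w], each of which lowers [L] by one. The sum over [k <= m]
    goes with the evaluation point [m + 1]. *)
Definition em_seq (n L j : nat) (w : C) (m : nat) : C :=
  (sum_n (fun k => pl n (S j) (RtoC (INR k) + w)) m
   - sum_n (fun i => bern i w * pl n (i + j) (RtoC (INR (S m)))) L)%C.

(** At order [n + 3] the steps of the sequence are [O(m^(-3))], which is more than summability asks
    for, and a degree [n + 1 >= 1] is left after the two derivatives used to prove
    differentiability. *)
Definition em_const (n : nat) (w : C) : C := Clim (em_seq n (n + 3) 0 w).

(** The constant of [euler_maclaurin_step], stripped of the power of [m]. It depends on [w] only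
    through its modulus and increasingly, so estimates are uniform on bounded sets. *)
Definition em_rate (n L q : nat) (w : C) : R :=
  Rabs (pl_pow n (n + 1 + q)) * INR (L + 3) * bern_radius w ^ S L.

Lemma em_rate_nonneg (n L q : nat) (w : C) : 0 <= em_rate n L q w.
Proof.
  unfold em_rate. pose proof (bern_radius_ge w).
  apply Rmult_le_pos; [apply Rmult_le_pos; [apply Rabs_pos | apply pos_INR] | apply pow_le; lra].
Qed.

Lemma INR_S_ge_1 (m : nat) : 1 <= INR (S m).
Proof. rewrite S_INR. pose proof (pos_INR m). lra. Qed.

Lemma em_seq_step (n L j q : nat) (w : C) (m : nat) :
  0 < Re w -> (S (S L) + j = n + 1 + q)%nat -> (1 <= q)%nat ->
  Cmod (em_seq n (S L) j w (S m) - em_seq n (S L) j w m)%C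
    <= em_rate n L q w / INR (S m) ^ q.
Proof.
  intros Hw Hq Hq1. pose proof (INR_S_ge_1 m) as Hm.
  (* Both increments, 1 and [w], point to the right, so the derivative is evaluated no closer to 0
     than [m + 1]. *)
  assert (Hseg : forall (z : C) t, z = 1%C \/ z = w -> 0 <= t <= 1 ->
    INR (S m) <= Re (RtoC (INR (S m)) + RtoC t * z)%C).
  { intros z t Hz Ht. rewrite re_plus, re_RtoC, re_scal_l.
    destruct Hz as [->| ->]; [rewrite re_RtoC|]; nra. }
  pose proof (euler_maclaurin_step (fun i => pl n (i + j)) L (RtoC (INR (S m))) w
    (Rabs (pl_pow n (n + 1 + q)) / INR (S m) ^ q)) as H.
  replace (em_seq n (S L) j w (S m) - em_seq n (S L) j w m)%C with
    (- (sum_n (fun i => bern i w * (pl n (i + j) (RtoC (INR (S m)) + 1)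
         - pl n (i + j) (RtoC (INR (S m)))))%C (S L)
        - pl n (1 + j) (RtoC (INR (S m)) + w)))%C.
  - rewrite Cmod_opp. eapply Rle_trans; [apply H|].
    + intros i z t _ Hz Ht. apply (is_Cderive_pl n (i + j)).
      specialize (Hseg z t Hz Ht). lra.
    + intros z t Hz Ht. rewrite Hq. apply pl_decay; [exact Hq1 | lra|].
      eapply Rle_trans; [apply (Hseg z t Hz Ht) | apply Re_le_Cmod].
    + unfold em_rate, Rdiv. apply Req_le. ring.
  - unfold em_seq.
    rewrite (Csum_S (fun k => pl n (S j) (RtoC (INR k) + w)%C) m), (S_INR (S m)), RtoC_plus. simpl Nat.add.
    rewrite (Csum_ext (fun i => bern i w * (_ - _))%C
      (fun i => bern i w * pl n (i + j) (RtoC (INR (S m)) + 1)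
                - bern i w * pl n (i + j) (RtoC (INR (S m))))%C) by (intros i _; Cring).
    rewrite Csum_minus. Cring.
Qed.

(** Freezing [q] of the powers at the starting point [x] leaves a summable [y^(-2)] while the factor
    [x^(-q)] survives in the bound on the tail. *)
Lemma div_pow_split (K x y : R) (q : nat) : 0 <= K -> 0 < x -> x <= y ->
  K / y ^ (q + 2) <= K / x ^ q / y ^ 2.
Proof.
  intros HK Hx Hy. rewrite pow_add. unfold Rdiv. rewrite Rinv_mult, <- Rmult_assoc.
  assert (0 < y ^ 2) by (apply pow_lt; lra).
  apply Rmult_le_compat_r; [left; now apply Rinv_0_lt_compat|].
  apply Rmult_le_compat_l; [exact HK|].
  apply Rinv_le_contravar; [now apply pow_lt | apply pow_incr; lra].
Qed.

(** The total order [S L + j] is unchanged by differentiation in [w], so the sequence and its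
    derivatives obey the same kind of estimate. *)
Lemma em_seq_step_sqr (n L j : nat) (w : C) (m : nat) :
  0 < Re w -> (S L + j = n + 3)%nat ->
  Cmod (em_seq n (S L) j w (S m) - em_seq n (S L) j w m)%C
    <= em_rate n L 3 w / INR (S m) ^ 2.
Proof.
  intros Hw HL. eapply Rle_trans; [apply (em_seq_step n L j 3 w m Hw); lia|].
  change 3%nat with (1 + 2)%nat at 2. pose proof (INR_S_ge_1 m).
  eapply Rle_trans; [apply (div_pow_split _ 1); [apply em_rate_nonneg | lra | lra]|].
  unfold Rdiv at 2. rewrite pow1, Rinv_1, Rmult_1_r. apply Rle_refl.
Qed.

Lemma is_Clim_em_seq (n L j : nat) (w : C) : 0 < Re w -> (S L + j = n + 3)%nat ->
  is_Clim (em_seq n (S L) j w) (Clim (em_seq n (S L) j w)).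
Proof.
  intros Hw HL. apply (Clim_correct _ (em_rate n L 3 w)).
  intros p. now apply em_seq_step_sqr.
Qed.

Lemma is_Clim_em_const (n : nat) (w : C) : 0 < Re w ->
  is_Clim (em_seq n (n + 3) 0 w) (em_const n w).
Proof.
  intros Hw. unfold em_const. rewrite Nat.add_succ_r.
  apply is_Clim_em_seq; [exact Hw | lia].
Qed.

Lemma em_const_rate (n : nat) (w : C) (m : nat) : 0 < Re w ->
  Cmod (em_seq n (n + 3) 0 w m - em_const n w)%C
    <= 2 * em_rate n (n + 2) 3 w / INR (S m).
Proof.
  intros Hw. apply inv_sqr_limit; [|now apply is_Clim_em_const].
  intros p _. rewrite Nat.add_succ_r. apply em_seq_step_sqr; [exact Hw | lia].
Qed.

(** The derivative of [bern (S i)] being [bern i], the polynomial part shifts its index: the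
    constant [bern 0] drops out and the last term is lost. *)
Lemma is_Cderive_em_seq (n L j : nat) (w : C) (m : nat) : 0 < Re w ->
  is_Cderive (fun w => em_seq n (S L) j w m) w (em_seq n L (S j) w m).
Proof.
  intros Hw. unfold em_seq. apply is_Cderive_minus.
  - apply (is_Cderive_sum_n (fun k w => pl n (S j) (RtoC (INR k) + w)%C)
      (fun k w => pl n (S (S j)) (RtoC (INR k) + w)%C)).
    intros k _.
    apply is_derive_ext with (f := fun w => pl n (S j) (w + RtoC (INR k))%C);
      [intros z; now rewrite Cplus_comm|].
    rewrite Cplus_comm. apply is_Cderive_shift, is_Cderive_pl.
    rewrite re_plus, re_RtoC. pose proof (pos_INR k). lra.
  - apply is_derive_ext with (f := fun w => (bern 0 w * pl n (0 + j) (RtoC (INR (S m)))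
      + sum_n (fun i => bern (S i) w * pl n (S i + j) (RtoC (INR (S m)))) L)%C);
      [intros z; now rewrite Csum_shift|].
    rewrite <- (Cplus_0_l (sum_n _ L)).
    apply is_Cderive_plus.
    + apply is_derive_ext with (f := fun _ : C => (1 * pl n (0 + j) (RtoC (INR (S m))))%C);
        [reflexivity | apply is_Cderive_const].
    + apply (is_Cderive_sum_n (fun i w => bern (S i) w * pl n (S i + j) (RtoC (INR (S m))))%C
        (fun i w => bern i w * pl n (i + S j) (RtoC (INR (S m))))%C).
      intros i _. rewrite Nat.add_succ_r. simpl Nat.add.
      apply is_derive_ext with (f := fun w => (pl n (S (i + j)) (RtoC (INR (S m))) * bern (S i) w)%C);
        [intros z; Cring|].
      rewrite Cmult_comm. apply is_Cderive_scal, is_Cderive_bern.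
Qed.

Lemma em_rate_incr (n L q : nat) (w z : C) : Cmod z <= Cmod w ->
  em_rate n L q z <= em_rate n L q w.
Proof.
  intros H. unfold em_rate. apply Rmult_le_compat_l.
  - apply Rmult_le_pos; [apply Rabs_pos | apply pos_INR].
  - apply pow_incr. unfold bern_radius. pose proof (Cmod_ge_0 z). lra.
Qed.

Lemma ball_Re_pos (z w : C) : Cmod (z - w)%C < Re w -> 0 < Re z.
Proof.
  intros H. pose proof (re_le_Cmod (z - w)%C) as K. rewrite re_minus in K.
  unfold Rabs in K. destruct (Rcase_abs (Re z - Re w)); lra.
Qed.

Lemma is_Cderive_em_const (n : nat) (w : C) : 0 < Re w ->
  is_Cderive (em_const n) w (Clim (em_seq n (n + 2) 1 w)).
Proof.
  intros Hw.
  (* The second derivatives must be bounded uniformly in [m] near [w]. Differentiability gives a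
     bound for [m = 0], and the increments add at most [2 * em_rate]. *)
  assert (Hd : is_Cderive (fun w => em_seq n (S n) 2 w 0) w (em_seq n n 3 w 0))
    by now apply is_Cderive_em_seq.
  destruct (is_Cderive_locally_bounded _ _ _ Hd) as [d [B [Hd0 HB]]].
  (* On the disc of radius [Re w <= Cmod w] every modulus is at most [2 * Cmod w], so the rate at
     [W] serves the whole disc. *)
  set (W := RtoC (2 * Cmod w)).
  assert (HW : forall z, Cmod (z - w)%C < Re w -> Cmod z <= Cmod W).
  { intros z Hz. unfold W. pose proof (Cmod_ge_0 w). pose proof (Re_le_Cmod w).
    rewrite Cmod_R, Rabs_pos_eq by lra.
    replace z with ((z - w) + w)%C by ring.
    eapply Rle_trans; [apply Cmod_triangle | lra]. }
  apply (is_Cderive_limit (fun m z => em_seq n (n + 3) 0 z m) (fun m z => em_seq n (n + 2) 1 z m)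
    (fun m z => em_seq n (n + 1) 2 z m) _ w _ (Rmin (Re w) d) (B + 2 * em_rate n n 3 W)).
  - now apply Rmin_glb_lt.
  - intros m z Hz. rewrite (Nat.add_succ_r n 2). apply is_Cderive_em_seq.
    apply (ball_Re_pos z w). eapply Rlt_le_trans; [exact Hz | apply Rmin_l].
  - intros m z Hz. rewrite (Nat.add_succ_r n 1). apply is_Cderive_em_seq.
    apply (ball_Re_pos z w). eapply Rlt_le_trans; [exact Hz | apply Rmin_l].
  - intros m z Hz. rewrite Nat.add_1_r.
    assert (Hz1 : Cmod (z - w)%C < Re w) by (eapply Rlt_le_trans; [exact Hz | apply Rmin_l]).
    pose proof (ball_Re_pos _ _ Hz1) as Hz0.
    specialize (HB z (Rlt_le_trans _ _ _ Hz (Rmin_r _ _))).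
    pose proof (inv_sqr_steps (em_seq n (S n) 2 z) (em_rate n n 3 z) 0
      (fun p _ => em_seq_step_sqr n n 2 z p Hz0 ltac:(lia)) m) as H.
    simpl Nat.add in H.
    pose proof (em_rate_nonneg n n 3 z). pose proof (em_rate_incr n n 3 W z (HW z Hz1)).
    assert (0 < / INR (S m)) by (apply Rinv_0_lt_compat, lt_0_INR; lia).
    simpl (INR 1) in H. rewrite Rinv_1 in H.
    replace (em_seq n (S n) 2 z m) with
      ((em_seq n (S n) 2 z m - em_seq n (S n) 2 z 0) + em_seq n (S n) 2 z 0)%C by ring.
    eapply Rle_trans; [apply Cmod_triangle|]. nra.
  - intros z Hz. apply is_Clim_em_const.
    apply (ball_Re_pos z w). eapply Rlt_le_trans; [exact Hz | apply Rmin_l].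
  - rewrite (Nat.add_succ_r n 1). apply is_Clim_em_seq; [exact Hw | lia].
Qed.

(** This Taylor remainder is all that is left once differences of Euler-Maclaurin polynomials are
    simplified by [bern_translate]: [j = 1] serves the functional equation, [j = 0] the integral
    over a unit interval. *)
Lemma pl_taylor_em (n j : nat) (w : C) (m : nat) : 0 < Re w -> (j <= 1)%nat ->
  Cmod (pl n j (RtoC (INR (S m)) + w)
    - sum_n (fun i => pl n (i + j) (RtoC (INR (S m))) * (w ^ i / RtoC (INR (fact i)))) (n + 3 - j))%C
  <= Rabs (pl_pow n (n + 4)) * Cmod w ^ (S (n + 3 - j)) / INR (S m).
Proof.
  intros Hw Hj. pose proof (INR_S_ge_1 m) as Hm.
  assert (Hseg : forall t, 0 <= t <= 1 -> INR (S m) <= Re (RtoC (INR (S m)) + RtoC t * w)%C).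
  { intros t Ht. rewrite re_plus, re_RtoC, re_scal_l. nra. }
  eapply Rle_trans; [apply (taylor_bound (fun i => pl n (i + j)) _ w
    (Rabs (pl_pow n (n + 4)) / INR (S m)))|].
  - intros i t _ Ht. apply (is_Cderive_pl n (i + j)). specialize (Hseg t Ht). lra.
  - intros t Ht. replace (S (n + 3 - j) + j)%nat with (n + 1 + 3)%nat by lia.
    replace (n + 4)%nat with (n + 1 + 3)%nat by lia.
    eapply Rle_trans; [apply (pl_decay n 3 _ (INR (S m))); [lia | lra|]|].
    + eapply Rle_trans; [apply (Hseg t Ht) | apply Re_le_Cmod].
    + apply Rmult_le_compat_l; [apply Rabs_pos|].
      apply Rinv_le_contravar; [lra|].
      rewrite <- (pow_1 (INR (S m))) at 1. apply Rle_pow; [lra | lia].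
  - apply Req_le. unfold Rdiv. ring.
Qed.

Lemma Csum_translate (u : nat -> C) (m : nat) :
  sum_n (fun k => u (S k)) m = (sum_n u m - u 0%nat + u (S m))%C.
Proof.
  induction m as [|m IH]; [rewrite !sum_O; Cring|].
  rewrite Csum_S, IH, Csum_S. Cring.
Qed.

(** Replacing [w] by [w + 1] shifts the sum by one term, while the Euler-Maclaurin polynomial
    changes by the Taylor polynomial of [pl n 1] at [m + 1] with increment [w]. The new end term of
    the sum and this polynomial cancel in the limit. *)
Lemma em_const_functional (n : nat) (w : C) : 0 < Re w ->
  (em_const n (w + 1) = em_const n w - powlog n w)%C.
Proof.
  intros Hw.
  assert (Hw1 : 0 < Re (w + 1)%C) by (rewrite re_plus, re_RtoC; lra).
  assert (H : is_Clim (fun m => em_seq n (n + 3) 0 (w + 1)%C m + (- (1)) * em_seq n (n + 3) 0 w m)%C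
    (- powlog n w)%C).
  { apply (is_Clim_of_bound _ _ (Rabs (pl_pow n (n + 4)) * Cmod w ^ (S (n + 3 - 1)))).
    intros m. eapply Rle_trans; [|apply (pl_taylor_em n 1 w m Hw); lia].
    apply Req_le. f_equal. unfold em_seq.
    assert (E1 : (sum_n (fun k => pl n 1 (RtoC (INR k) + (w + 1))) m
      = sum_n (fun k => pl n 1 (RtoC (INR k) + w)) m - pl n 1 w
        + pl n 1 (RtoC (INR (S m)) + w))%C).
    { transitivity (sum_n (fun k => pl n 1 (RtoC (INR (S k)) + w)%C) m).
      - apply Csum_ext. intros k _. f_equal. rewrite S_INR, RtoC_plus. ring.
      - rewrite (Csum_translate (fun k => pl n 1 (RtoC (INR k) + w)%C)).
        simpl (INR 0). now rewrite Cplus_0_l. }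
    rewrite E1. rewrite <- (pl_1 n w) by now apply Re_pos_neq_0.
    assert (E2 : (sum_n (fun i => bern i (w + 1) * pl n (i + 0) (RtoC (INR (S m)))) (n + 3)
      - sum_n (fun i => bern i w * pl n (i + 0) (RtoC (INR (S m)))) (n + 3)
      = sum_n (fun i => pl n (i + 1) (RtoC (INR (S m))) * (w ^ i / RtoC (INR (fact i)))) (n + 3 - 1))%C).
    { rewrite <- Csum_minus. rewrite (Nat.add_succ_r n 2) at 1. rewrite Csum_shift, !bern_0.
      replace (n + 3 - 1)%nat with (n + 2)%nat by lia.
      rewrite (Csum_ext (fun j => _ - _)%C (fun i => pl n (i + 1) (RtoC (INR (S m))) * (w ^ i / RtoC (INR (fact i))))%C).
      - Cring.
      - intros i _. rewrite <- bern_translate. replace (S i + 0)%nat with (i + 1)%nat by lia. Cring. }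
    rewrite <- E2. Cring. }
  assert (H' : is_Clim (fun m => em_seq n (n + 3) 0 (w + 1)%C m + (- (1)) * em_seq n (n + 3) 0 w m)%C
    (em_const n (w + 1)%C + (- (1)) * em_const n w)%C).
  { apply is_Clim_plus; [|apply is_Clim_scal]; now apply is_Clim_em_const. }
  pose proof (is_Clim_unique _ _ _ H H') as E.
  replace (em_const n w - powlog n w)%C with (em_const n w + (- powlog n w))%C by ring.
  rewrite E. ring.
Qed.

Lemma ex_CRInt_em_const (n : nat) (v : C) : 0 < Re v ->
  exists I, is_CRInt (fun x => em_const n (v + RtoC x * 1)%C) 0 1 I.
Proof.
  intros Hv. apply (ex_RInt_continuous (V := C_R_CompleteNormedModule)).
  intros t Ht. rewrite Rmin_left, Rmax_right in Ht by lra.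
  apply (ex_derive_continuous (K := R_AbsRing) (V := C_R_NormedModule)).
  eexists. apply is_curve_derive_line, is_Cderive_em_const.
  rewrite re_plus, Cmult_1_r, re_RtoC. lra.
Qed.

(** Raising each [pl n 1] to [pl n 0] and each [bern i] to [bern (S i)] gives a primitive [F] of
    [em_seq]. Its increment over a unit step telescopes to [- pl n 0 v] plus a Taylor remainder at
    [m + 1], which tends to 0. *)
Lemma is_CRInt_em_const (n : nat) (v : C) : 0 < Re v ->
  is_CRInt (fun x => em_const n (v + RtoC x * 1)%C) 0 1 (- pl n 0 v)%C.
Proof.
  intros Hv. destruct (ex_CRInt_em_const n v Hv) as [I HI].
  assert (Hseg : forall x, 0 <= x <= 1 -> 0 < Re (v + RtoC x * 1)%C).
  { intros x Hx. rewrite re_plus, Cmult_1_r, re_RtoC. lra. }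
  set (A := fun m => (pl n 0 (RtoC (INR (S m)) + v) - pl n 0 v
    - sum_n (fun i => pl n (i + 0) (RtoC (INR (S m))) * (v ^ i / RtoC (INR (fact i)))) (n + 3))%C).
  assert (HA : forall m, is_CRInt (fun x => em_seq n (n + 3) 0 (v + RtoC x * 1)%C m) 0 1 (A m)).
  { intros m.
    set (F := fun z => (sum_n (fun k => pl n 0 (RtoC (INR k) + z)) m
      - sum_n (fun i => bern (S i) z * pl n (i + 0) (RtoC (INR (S m)))) (n + 3))%C).
    assert (EA : (F (v + RtoC 1 * 1) - F (v + RtoC 0 * 1) = A m)%C).
    { rewrite Cmult_1_l, Cmult_0_l, Cplus_0_r. unfold F, A.
      replace (sum_n (fun k => pl n 0 (RtoC (INR k) + (v + 1))) m)%C with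
        (sum_n (fun k => pl n 0 (RtoC (INR k) + v)) m - pl n 0 v
        + pl n 0 (RtoC (INR (S m)) + v))%C.
      - rewrite (Csum_ext (fun i => pl n (i + 0) _ * _)%C
          (fun i => bern (S i) (v + 1) * pl n (i + 0) (RtoC (INR (S m)))
                    - bern (S i) v * pl n (i + 0) (RtoC (INR (S m))))%C).
        + rewrite Csum_minus. Cring.
        + intros i _. rewrite <- bern_translate. Cring.
      - symmetry. transitivity (sum_n (fun k => pl n 0 (RtoC (INR (S k)) + v)%C) m).
        + apply Csum_ext. intros k _. f_equal. rewrite S_INR, RtoC_plus. ring.
        + rewrite (Csum_translate (fun k => pl n 0 (RtoC (INR k) + v)%C)).
          simpl (INR 0). now rewrite Cplus_0_l. }
    rewrite <- EA.
    apply is_RInt_ext with (f := fun x => (1 * em_seq n (n + 3) 0 (v + RtoC x * 1)%C m)%C);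
      [intros x _; apply Cmult_1_l|].
    apply (is_CRInt_line F (fun z => em_seq n (n + 3) 0 z m) (fun z => em_seq n (n + 2) 1 z m)).
    - intros t Ht. rewrite Rmin_left, Rmax_right in Ht by lra. specialize (Hseg t Ht).
      set (z := (v + RtoC t * 1)%C) in *. unfold F, em_seq. apply is_Cderive_minus.
      + apply (is_Cderive_sum_n (fun k w => pl n 0 (RtoC (INR k) + w)%C)
          (fun k w => pl n 1 (RtoC (INR k) + w)%C)).
        intros k _.
        apply is_derive_ext with (f := fun w => pl n 0 (w + RtoC (INR k))%C);
          [intros y; now rewrite Cplus_comm|].
        rewrite Cplus_comm. apply is_Cderive_shift, is_Cderive_pl.
        rewrite re_plus, re_RtoC. pose proof (pos_INR k). lra.
      + apply (is_Cderive_sum_n (fun i w => bern (S i) w * pl n (i + 0) (RtoC (INR (S m))))%C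
          (fun i w => bern i w * pl n (i + 0) (RtoC (INR (S m))))%C).
        intros i _.
        apply is_derive_ext with (f := fun w => (pl n (i + 0) (RtoC (INR (S m))) * bern (S i) w)%C);
          [intros y; Cring|].
        rewrite Cmult_comm. apply is_Cderive_scal, is_Cderive_bern.
    - intros t Ht. rewrite Rmin_left, Rmax_right in Ht by lra. specialize (Hseg t Ht).
      rewrite (Nat.add_succ_r n 2). now apply is_Cderive_em_seq. }
  (* On the segment the modulus is at most [Cmod v + 1], so the convergence to [em_const] is uniform
     there and passes to the integral. *)
  assert (H1 : is_Clim A I).
  { set (V := RtoC (Cmod v + 1)).
    apply (is_Clim_of_bound _ _ (2 * em_rate n (n + 2) 3 V)). intros m.
    replace (2 * em_rate n (n + 2) 3 V / INR (S m))
      with ((1 - 0) * (2 * em_rate n (n + 2) 3 V / INR (S m))) by ring.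
    apply (is_CRInt_norm (fun x => em_seq n (n + 3) 0 (v + RtoC x * 1)%C m - em_const n (v + RtoC x * 1)%C)%C);
      [lra| |now apply is_CRInt_minus].
    intros t Ht. eapply Rle_trans; [apply em_const_rate, Hseg, Ht|].
    apply Rmult_le_compat_r; [left; apply Rinv_0_lt_compat, lt_0_INR; lia|].
    apply Rmult_le_compat_l; [lra|]. apply em_rate_incr.
    unfold V. pose proof (Cmod_ge_0 v). rewrite (Cmod_R (Cmod v + 1)), Rabs_pos_eq by lra.
    eapply Rle_trans; [apply Cmod_triangle|].
    rewrite Cmult_1_r, Cmod_R, Rabs_pos_eq by lra. lra. }
  assert (H2 : is_Clim A (- pl n 0 v)%C).
  { apply (is_Clim_of_bound _ _ (Rabs (pl_pow n (n + 4)) * Cmod v ^ (S (n + 3 - 0)))).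
    intros m. eapply Rle_trans; [|apply (pl_taylor_em n 0 v m Hv); lia].
    apply Req_le. f_equal. unfold A. rewrite Nat.sub_0_r. Cring. }
  rewrite <- (is_Clim_unique _ _ _ H1 H2). exact HI.
Qed.

(** * Growth of the Euler-Maclaurin constant *)

Lemma pow_le_exp (x : R) (k : nat) : 0 <= x -> x ^ k <= INR (fact k) * exp x.
Proof.
  intros Hx. pose proof (exp_ge_taylor x k Hx) as H.
  assert (Hk : x ^ k / INR (fact k) <= exp x).
  { eapply Rle_trans; [|exact H]. destruct k as [|k]; [simpl; lra|]. simpl sum_f_R0.
    assert (0 <= sum_f_R0 (fun k => x ^ k / INR (fact k)) k); [|simpl in *; lra].
    apply cond_pos_sum. intros j. apply Rmult_le_pos; [now apply pow_le|].
    left. apply Rinv_0_lt_compat, INR_fact_lt_0. }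
  apply Rmult_le_compat_l with (r := INR (fact k)) in Hk; [|apply pos_INR].
  replace (INR (fact k) * (x ^ k / INR (fact k))) with (x ^ k) in Hk; [exact Hk|].
  field. apply INR_fact_neq_0.
Qed.

Lemma Rabs_ln_le (x : R) : 0 < x -> Rabs (ln x) <= x + / x.
Proof.
  intros Hx. assert (H : forall y, 0 < y -> ln y <= y).
  { intros y Hy. pose proof (exp_ineq1_le (ln y)) as H. rewrite exp_ln in H by exact Hy. lra. }
  pose proof (H x Hx). pose proof (Rinv_0_lt_compat x Hx) as Hi.
  pose proof (H (/ x) Hi) as H'. rewrite ln_Rinv in H' by exact Hx.
  apply Rabs_le. lra.
Qed.

Lemma powlog_bound (n : nat) (r : R) (z : C) : 0 < r -> r <= Cmod z ->
  Cmod (powlog n z) <= bern_radius z ^ n * (bern_radius z + / r + 4).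
Proof.
  intros Hr Hz. unfold powlog. rewrite Cmod_mult, Cmod_pow.
  pose proof (Cmod_ge_0 z) as H0. pose proof PI_4.
  apply Rmult_le_compat; try apply pow_le; try apply Cmod_ge_0.
  - apply pow_incr. unfold bern_radius. lra.
  - eapply Rle_trans; [apply Cmod_le_Re_Im|]. unfold Clog. simpl Re. simpl Im.
    assert (Rabs (Carg z) <= PI).
    { unfold Carg. pose proof (acos_bound (Re z / Cmod z)).
      destruct (Rle_dec 0 (Im z)); apply Rabs_le; lra. }
    assert (Rabs (ln (Cmod z)) <= Cmod z + / Cmod z) by (apply Rabs_ln_le; lra).
    assert (/ Cmod z <= / r) by now apply Rinv_le_contravar.
    unfold bern_radius. lra.
Qed.

(** Already the term [m = 0] of the sequence is within [2 * em_rate] of its limit, which gives a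
    bound polynomial in [Cmod z]; the condition on [Re z] keeps [log z] away from its singularity.
    The rate 2 in the exponential is the slope of [bern_radius]. *)
Lemma em_const_growth (n : nat) : exists A : R, 0 < A /\
  forall z : C, / 2 <= Re z -> Cmod (em_const n z) <= A * exp (2 * Cmod z).
Proof.
  assert (HB : exists B, 0 <= B /\ forall i, (i <= n + 3)%nat -> Cmod (pl n (i + 0) (RtoC (INR 1))) <= B).
  { generalize (n + 3)%nat. intros k. induction k as [|k [B [HB IH]]].
    - exists (Cmod (pl n (0 + 0) (RtoC (INR 1)))). split; [apply Cmod_ge_0|].
      intros i Hi. replace i with 0%nat by lia. apply Rle_refl.
    - exists (Rmax B (Cmod (pl n (S k + 0) (RtoC (INR 1))))). split.
      + eapply Rle_trans; [exact HB | apply Rmax_l].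
      + intros i Hi. destruct (Nat.eq_dec i (S k)) as [->|E]; [apply Rmax_r|].
        eapply Rle_trans; [apply IH; lia | apply Rmax_l]. }
  destruct HB as [B [HB0 HB]].
  set (q := Rabs (pl_pow n (n + 1 + 3)) * INR (n + 2 + 3)).
  assert (Hq : 0 <= q) by (apply Rmult_le_pos; [apply Rabs_pos | apply pos_INR]).
  set (A0 := 4 + INR (S (n + 3)) * B + 2 * q).
  assert (HA0 : 0 < A0).
  { unfold A0. pose proof (Rmult_le_pos _ _ (pos_INR (S (n + 3))) HB0). lra. }
  assert (Hf : 0 < INR (fact (n + 3))) by apply INR_fact_lt_0.
  exists (A0 * INR (fact (n + 3)) * exp 2). split.
  { repeat apply Rmult_lt_0_compat; auto. apply exp_pos. }
  intros z Hz. assert (Hz0 : 0 < Re z) by lra.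
  pose proof (bern_radius_ge z) as HR. set (r := bern_radius z) in *.
  assert (HP : Cmod (em_const n z) <= A0 * r ^ (n + 3)).
  { pose proof (em_const_rate n z 0 Hz0) as H. simpl (INR 1) in H.
    unfold Rdiv in H. rewrite Rinv_1, Rmult_1_r in H. unfold em_rate in H. fold q r in H.
    replace (S (n + 2)) with (n + 3)%nat in H by lia.
    replace (em_const n z) with (em_seq n (n + 3) 0 z 0 + - (em_seq n (n + 3) 0 z 0 - em_const n z))%C by ring.
    eapply Rle_trans; [apply Cmod_triangle|]. rewrite Cmod_opp.
    assert (H1 : Cmod (em_seq n (n + 3) 0 z 0) <= 4 * r ^ (n + 3) + INR (S (n + 3)) * (r ^ (n + 3) * B)).
    { unfold em_seq. rewrite sum_O. simpl (INR 0). rewrite Cplus_0_l, pl_1 by now apply Re_pos_neq_0.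
      unfold Cminus. eapply Rle_trans; [apply Cmod_triangle|]. rewrite Cmod_opp.
      apply Rplus_le_compat.
      - eapply Rle_trans; [apply (powlog_bound n (/ 2)); [lra|]|].
        + eapply Rle_trans; [exact Hz | apply Re_le_Cmod].
        + fold r. rewrite Rinv_inv, pow_add.
          pose proof (pow_le r n ltac:(lra)).
          assert (r + 2 + 4 <= 4 * r ^ 3) by (simpl; nra). nra.
      - apply Csum_bound_const. intros i Hi. rewrite Cmod_mult.
        apply Rmult_le_compat; try apply Cmod_ge_0; [|now apply HB].
        eapply Rle_trans; [apply bern_bound|]. apply Rle_pow; [lra | exact Hi]. }
    unfold A0. lra. }
  eapply Rle_trans; [exact HP|].
  pose proof (pow_le_exp r (n + 3) ltac:(lra)) as He.
  replace (exp r) with (exp 2 * exp (2 * Cmod z)) in He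
    by (rewrite <- exp_plus; f_equal; unfold r, bern_radius; ring).
  replace (A0 * INR (fact (n + 3)) * exp 2 * exp (2 * Cmod z))
    with (A0 * (INR (fact (n + 3)) * (exp 2 * exp (2 * Cmod z)))) by ring.
  apply Rmult_le_compat_l; lra.
Qed.

(** * The modified Bernoulli polynomials *)

Lemma filterlim_Clim (e : nat -> C) (l : C) :
  is_Clim e l -> filterlim e eventually (locally (T := C_UniformSpace) l).
Proof.
  rewrite is_Clim_eps. intros H P [eps HP].
  destruct (H eps (cond_pos eps)) as [N HN]. exists N. intros m Hm.
  apply HP, C_NormedModule_mixin_compat1, (HN m Hm).
Qed.

Lemma Clim_filterlim (e : nat -> C) (l : C) :
  filterlim e eventually (locally (T := C_UniformSpace) l) -> is_Clim e l.
Proof.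
  intros H. apply is_Clim_eps. intros eps Heps.
  assert (Heps2 : 0 < eps / 2) by lra.
  destruct (H _ (locally_ball l (mkposreal _ Heps2))) as [N HN].
  exists N. intros m Hm. destruct (HN m Hm) as [H1 H2].
  change (Rabs (Re (e m) - Re l) < eps / 2) in H1.
  change (Rabs (Im (e m) - Im l) < eps / 2) in H2.
  eapply Rle_lt_trans; [apply Cmod_le_Re_Im|]. rewrite re_minus, im_minus. lra.
Qed.

Lemma pow_n_Cpow (t : C) (k : nat) : pow_n (K := C_Ring) t k = (t ^ k)%C.
Proof. induction k as [|k IH]; [reflexivity|]. simpl. now rewrite IH. Qed.

Lemma is_Cpseries_Clim (b : nat -> C) (t l : C) :
  is_pseries (K := C_AbsRing) (V := C_NormedModule) b t l <->
  is_Clim (fun m => sum_n (fun k => t ^ k * b k)%C m) l.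
Proof.
  assert (E : forall m, sum_n (G := NormedModule.AbelianMonoid C_AbsRing C_NormedModule)
      (fun k => scal (pow_n (K := C_AbsRing) t k) (b k)) m = sum_n (fun k => t ^ k * b k)%C m).
  { intros m. apply Csum_ext. intros k _.
    change (pow_n (K := C_Ring) t k * b k = t ^ k * b k)%C. now rewrite pow_n_Cpow. }
  split.
  - intros H. apply Clim_filterlim.
    apply (filterlim_ext _ _ E). exact H.
  - intros H. apply filterlim_Clim in H.
    apply (filterlim_ext _ _ (fun m => eq_sym (E m))). exact H.
Qed.

(** Converts a geometric error [(L + 3) 2^(-L)] into the form [C/(L + 1)] expected by
    [is_Clim_of_bound]. *)
Lemma sqr_le_pow2 (L : nat) : INR (S L) * INR (L + 3) <= 16 * 2 ^ L.
Proof.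
  assert (H : (INR L + 4) ^ 2 <= 16 * 2 ^ L).
  { induction L as [|L IH]; [simpl; lra|].
    rewrite S_INR. cbn [pow] in IH |- *. pose proof (pos_INR L). nra. }
  rewrite S_INR, plus_INR. simpl (INR 3). pose proof (pos_INR L). nra.
Qed.

(** The signs come from [tau = - t]. At [s = 0] the Euler-Maclaurin error for the exponentials
    equals [1 - Cexp tau] times the difference between a partial sum of the series and its claimed
    value. It carries the factor [(Cmod t * r) ^ S L], which the radius [1/(2 r)] bounds by
    [2^(-L-1)]. *)
Lemma is_modified_bernoulli_bern (w : C) :
  is_modified_bernoulli w (fun k => RtoC (-1) ^ S k * bern (S k) w)%C.
Proof.
  pose proof (bern_radius_ge w) as HR. set (r := bern_radius w) in *.
  exists (/ (2 * r)). split; [apply Rinv_0_lt_compat; lra|].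
  intros t [Ht0 Ht]. apply is_Cpseries_Clim.
  set (tau := (- t)%C).
  assert (Htau : Cmod tau = Cmod t) by apply Cmod_opp.
  assert (Hr : Cmod t * r <= / 2).
  { apply Rmult_lt_compat_r with (r := r) in Ht; [|lra].
    replace (/ (2 * r) * r) with (/ 2) in Ht by (field; lra). lra. }
  assert (Ht4 : Cmod t <= / 4) by nra.
  assert (Htn : t <> 0%C) by now apply Cmod_gt_0.
  assert (Htaun : tau <> 0%C) by (apply Cmod_gt_0; lra).
  assert (Hden : (1 - Cexp tau <> 0)%C).
  { intros E. pose proof (Cexp_bound_small tau ltac:(lra)) as H.
    replace (Cexp tau - 1 - tau)%C with (- ((1 - Cexp tau) + tau))%C in H by ring.
    rewrite E, Cplus_0_l, Cmod_opp, Htau in H. nra. }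
  set (c := Cmod (1 - Cexp tau)%C).
  assert (Hc : 0 < c) by now apply Cmod_gt_0.
  set (E0 := exp (1 + Cmod w)).
  apply (is_Clim_of_bound _ _ (16 * E0 / c)). intros L.
  set (g := fun i z => (tau ^ i / tau * Cexp (tau * z))%C).
  assert (Hg : forall z : C, Cmod z <= 1 + Cmod w -> Cmod (Cexp (tau * z)%C) <= E0).
  { intros z Hz. rewrite Cmod_Cexp. apply exp_le.
    eapply Rle_trans; [apply Re_le_Cmod|]. rewrite Cmod_mult, Htau.
    pose proof (Cmod_ge_0 z). pose proof (Cmod_ge_0 w). nra. }
  pose proof (euler_maclaurin_step g L 0%C w (Cmod t ^ S L * E0)) as H.
  assert (Heq : (sum_n (fun k => t ^ k * (RtoC (-1) ^ S k * bern (S k) w)) L -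
     (Cexp (- (w * t)) / (1 - Cexp (- t)) - 1 / t)
     = (sum_n (fun i => bern i w * (g i (RtoC 0 + 1) - g i (RtoC 0))) (S L) - g 1%nat (RtoC 0 + w))
       / (1 - Cexp tau))%C).
  { rewrite Csum_shift, bern_0.
    rewrite (Csum_ext (fun j => bern (S j) w * _)%C
      (fun k => (1 - Cexp tau) * (t ^ k * (RtoC (-1) ^ S k * bern (S k) w)))%C).
    - rewrite Csum_scal. unfold g. fold tau.
      replace (tau * (RtoC 0 + w))%C with (- (w * t))%C by (unfold tau; ring).
      rewrite Cplus_0_l, Cmult_1_r, Cmult_0_r, Cexp_0.
      replace (1 / t)%C with (- (1 / tau))%C by (unfold tau; field; exact Htn).
      set (A := Cexp (- (w * t))%C). set (X := sum_n _ L).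
      change (tau ^ 0)%C with (RtoC 1). change (tau ^ 1)%C with (tau * 1)%C. Cfield.
      now split.
    - intros k _. unfold g.
      rewrite Cplus_0_l, Cmult_1_r, Cmult_0_r, Cexp_0.
      replace (tau ^ S k / tau)%C with (tau ^ k)%C by (simpl; field; exact Htaun).
      set (e := Cexp tau).
      replace tau with (RtoC (-1) * t)%C by (unfold tau; ring).
      rewrite Cpow_mult_l, (Cpow_S (RtoC (-1))). set (u := (RtoC (-1) ^ k)%C).
      Cring. }
  eapply Rle_trans; [apply Req_le, (f_equal Cmod), Heq|].
  rewrite Cmod_div by exact Hden. fold c.
  unfold Rdiv. rewrite (Rmult_assoc _ (/ c)), (Rmult_comm (/ c)), <- Rmult_assoc.
  apply Rmult_le_compat_r; [left; now apply Rinv_0_lt_compat|].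
  eapply Rle_trans; [apply H|].
  - intros j z s _ Hz Hs. rewrite Cplus_0_l. unfold g.
    replace (tau ^ S j / tau * Cexp (tau * (RtoC s * z)))%C
      with (tau ^ j / tau * ((0 * (RtoC s * z) + tau * 1) * Cexp (tau * (RtoC s * z))))%C
      by (simpl; field; exact Htaun).
    apply is_Cderive_scal. apply (is_Cderive_comp Cexp (fun z => tau * z)%C).
    + apply is_Cderive_Cexp.
    + apply (is_Cderive_mult (fun _ => tau) (fun z => z)); [apply is_Cderive_const | apply is_Cderive_id].
  - intros z s Hz Hs. rewrite Cplus_0_l. unfold g.
    replace (tau ^ S (S L) / tau)%C with (tau ^ S L)%C by (simpl; field; exact Htaun).
    rewrite Cmod_mult, Cmod_pow, Htau. apply Rmult_le_compat_l; [apply pow_le; lra|].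
    apply Hg. rewrite Cmod_mult, Cmod_R, Rabs_pos_eq by lra.
    pose proof (Cmod_ge_0 w).
    destruct Hz as [->| ->]; [rewrite Cmod_1|]; nra.
  - fold r. replace (Cmod t ^ S L * E0 * INR (L + 3) * r ^ S L)
      with (E0 * INR (L + 3) * (Cmod t * r) ^ S L) by (rewrite Rpow_mult_distr; ring).
    assert (HE : 0 < E0) by apply exp_pos.
    assert (Hpow : (Cmod t * r) ^ S L <= (/ 2) ^ S L) by (apply pow_incr; split; [nra | exact Hr]).
    rewrite pow_inv in Hpow.
    pose proof (sqr_le_pow2 L) as Hs.
    assert (H2 : 0 < 2 ^ L) by (apply pow_lt; lra).
    pose proof (INR_S_ge_1 L) as HSL.
    assert (HL3 : 0 <= INR (L + 3)) by apply pos_INR.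
    apply Rle_trans with (E0 * INR (L + 3) * / 2 ^ S L).
    { apply Rmult_le_compat_l; [nra | exact Hpow]. }
    apply Rmult_le_reg_r with (2 ^ S L * INR (S L)); [apply Rmult_lt_0_compat; [apply pow_lt; lra | lra]|].
    replace (E0 * INR (L + 3) * / 2 ^ S L * (2 ^ S L * INR (S L)))
      with (E0 * (INR (S L) * INR (L + 3))) by (field; apply pow_nonzero; lra).
    replace (16 * E0 * / INR (S L) * (2 ^ S L * INR (S L)))
      with (E0 * (2 * (16 * 2 ^ L))) by (simpl (2 ^ S L); field; lra).
    apply Rmult_le_compat_l; lra.
Qed.

(** Nothing is assumed at [x = 0]. Multiplying the series by [x] produces one that vanishes there as
    well, hence on a full neighbourhood, and uniqueness of power series applies to it. *)
Lemma real_pseries_zero (d : nat -> R) (r : R) : 0 < r ->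
  (forall x : R, 0 < Rabs x < r -> is_lim_seq (fun m => sum_n (fun k => x ^ k * d k) m) 0) ->
  forall k, d k = 0.
Proof.
  intros Hr H.
  assert (HP : forall x : R, 0 < Rabs x < r -> is_pseries d x 0).
  { intros x Hx. apply (filterlim_ext (fun m => sum_n (fun k => x ^ k * d k) m)).
    - intros m. apply sum_n_ext. intros k.
      rewrite <- (pow_n_pow x k). reflexivity.
    - exact (H x Hx). }
  assert (HI : forall x : R, 0 < Rabs x < r -> is_pseries (PS_incr_1 d) x 0).
  { intros x Hx. pose proof (is_pseries_incr_1 d x 0 (HP x Hx)) as K.
    change (scal x 0) with (x * 0) in K. now rewrite Rmult_0_r in K. }
  assert (Hx0 : 0 < Rabs (r / 2) < r) by (rewrite Rabs_pos_eq; lra).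
  assert (HR : forall a, is_pseries a (r / 2) 0 -> Rbar_lt 0 (CV_radius a)).
  { intros a Ha. apply Rbar_not_le_lt. intros Hle.
    apply (CV_disk_outside a (r / 2)).
    - eapply Rbar_le_lt_trans; [exact Hle | apply (proj1 Hx0)].
    - apply is_lim_seq_ext with (u := fun k => scal (pow_n (r / 2) k) (a k)).
      + intros k. rewrite (Rmult_comm (a k)), <- (pow_n_pow (r / 2) k). reflexivity.
      + apply ex_series_lim_0. exists 0. exact Ha. }
  intros k.
  replace (d k) with (PS_incr_1 d (S k)) by reflexivity.
  rewrite (PSeries_ext_recip (PS_incr_1 d) (fun _ => 0) (S k)); [reflexivity| | |].
  - apply HR, HI, Hx0.
  - rewrite CV_radius_const_0. exact I.
  - exists (mkposreal r Hr). intros x Hx.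
    change (Rabs (x - 0) < r) in Hx. rewrite Rminus_0_r in Hx.
    rewrite PSeries_const_0.
    destruct (Req_dec x 0) as [->|E].
    + now rewrite PSeries_0.
    + apply is_pseries_unique, HI. split; [now apply Rabs_pos_lt | exact Hx].
Qed.

(** Real [t] suffice: for them the difference of the two series splits into real and imaginary
    parts, each a real power series. *)
Lemma is_modified_bernoulli_unique (w : C) (b b' : nat -> C) :
  is_modified_bernoulli w b -> is_modified_bernoulli w b' -> forall k, b k = b' k.
Proof.
  intros [r [Hr H]] [r' [Hr' H']].
  assert (HD : forall x : R, 0 < Rabs x < Rmin r r' ->
    is_Clim (fun m => sum_n (fun k => RtoC (x ^ k) * (b k - b' k))%C m) 0%C).
  { intros x [Hx0 Hx].
    specialize (H (RtoC x)). specialize (H' (RtoC x)). rewrite Cmod_R in H, H'.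
    specialize (H (conj Hx0 (Rlt_le_trans _ _ _ Hx (Rmin_l _ _)))).
    specialize (H' (conj Hx0 (Rlt_le_trans _ _ _ Hx (Rmin_r _ _)))).
    apply is_Cpseries_Clim in H, H'.
    pose proof (is_Clim_plus _ _ _ _ H (is_Clim_scal (- (1))%C _ _ H')) as K.
    set (l := (_ / _ - _)%C) in K. replace (l + - (1) * l)%C with (RtoC 0) in K by ring.
    apply is_lim_seq_ext with (2 := K). intros m. f_equal. f_equal.
    rewrite (Csum_ext (fun k => RtoC (x ^ k) * (b k - b' k))%C
      (fun k => RtoC x ^ k * b k - RtoC x ^ k * b' k)%C).
    - rewrite Csum_minus. Cring.
    - intros k _. rewrite RtoC_pow. Cring. }
  assert (Hmin : 0 < Rmin r r') by now apply Rmin_glb_lt.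
  assert (HRe : forall u m, Re (sum_n u m) = sum_n (fun k => Re (u k)) m).
  { intros u m. induction m as [|m IH]; [now rewrite !sum_O|].
    rewrite Csum_S, sum_Sn, re_plus, IH. reflexivity. }
  assert (HIm : forall u m, Im (sum_n u m) = sum_n (fun k => Im (u k)) m).
  { intros u m. induction m as [|m IH]; [now rewrite !sum_O|].
    rewrite Csum_S, sum_Sn, im_plus, IH. reflexivity. }
  intros k. apply Ceq_minus. apply injective_projections.
  - apply (real_pseries_zero (fun k => Re (b k - b' k)%C) (Rmin r r') Hmin).
    intros x Hx. specialize (HD x Hx). apply is_Clim_Re in HD.
    apply is_lim_seq_ext with (2 := HD). intros m. rewrite HRe.
    apply sum_n_ext. intros j. apply re_scal_l.
  - apply (real_pseries_zero (fun k => Im (b k - b' k)%C) (Rmin r r') Hmin).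
    intros x Hx. specialize (HD x Hx). apply is_Clim_Im in HD.
    apply is_lim_seq_ext with (2 := HD). intros m. rewrite HIm.
    apply sum_n_ext. intros j. apply im_scal_l.
Qed.

Lemma modified_bernoulli_bern (k : nat) (w : C) :
  modified_bernoulli k w = (RtoC (-1) ^ S k * bern (S k) w)%C.
Proof.
  apply (iota_unique (V := C_CompleteNormedModule)).
  - intros v [b [Hb <-]].
    exact (is_modified_bernoulli_unique w _ _ Hb (is_modified_bernoulli_bern w) k).
  - eexists. split; [apply is_modified_bernoulli_bern | reflexivity].
Qed.

(** * Asymptotic expansions *)

(** Dividing by the largest function of the scale makes all others vanish and isolates the top
    coefficient, after which the argument descends. The bound [1 <= e i s] keeps the quotient of a
    null sequence null. *)
Lemma scale_coef_zero (e : nat -> nat -> R) (c : nat -> C) :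
  (forall i j, (i < j)%nat -> is_lim_seq (fun s => e i s / e j s) 0) ->
  (forall i, exists N, forall s, (N <= s)%nat -> 1 <= e i s) ->
  forall k, is_Clim (fun s => sum_n (fun i => c i * RtoC (e i s))%C k) 0%C ->
  forall i, (i <= k)%nat -> c i = 0%C.
Proof.
  intros Hlt Hge.
  assert (Hsmall : forall j k, (k < j)%nat ->
    is_Clim (fun s => sum_n (fun i => c i * RtoC (e i s / e j s))%C k) 0%C).
  { intros j k Hk. induction k as [|k IH].
    - apply is_lim_seq_ext with (u := fun s => Cmod (c 0%nat * RtoC (e 0%nat s / e j s) - c 0%nat * 0)%C).
      { intros s. rewrite sum_O. f_equal. ring. }
      apply (is_Clim_scal (c 0%nat) (fun s => RtoC (e 0%nat s / e j s)) 0%C).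
      apply is_lim_seq_ext with (u := fun s => Rabs (e 0%nat s / e j s)).
      { intros s. rewrite <- Cmod_R. f_equal. ring. }
      rewrite <- Rabs_R0. apply (is_lim_seq_abs _ 0), Hlt, Hk.
    - replace (RtoC 0) with (RtoC 0 + c (S k) * RtoC 0)%C by ring.
      apply is_lim_seq_ext with (u := fun s => Cmod (sum_n (fun i => c i * RtoC (e i s / e j s))%C k
        + c (S k) * RtoC (e (S k) s / e j s) - (RtoC 0 + c (S k) * RtoC 0))%C).
      { intros s. now rewrite Csum_S. }
      apply is_Clim_plus; [apply IH; lia|].
      apply (is_Clim_scal (c (S k)) (fun s => RtoC (e (S k) s / e j s)) 0%C).
      apply is_lim_seq_ext with (u := fun s => Rabs (e (S k) s / e j s)).
      { intros s. rewrite <- Cmod_R. f_equal. ring. }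
      rewrite <- Rabs_R0. apply (is_lim_seq_abs _ 0), Hlt, Hk. }
  assert (Htop : forall k, is_Clim (fun s => sum_n (fun i => c i * RtoC (e i s))%C k) 0%C ->
    c k = 0%C).
  { intros k Hk. apply is_Clim_unique with (e := fun _ => c k); [apply is_Clim_const|].
    apply is_Clim_eps. intros eps Heps.
    destruct (proj1 (is_Clim_eps _ _) Hk (eps / 2)) as [N1 HN1]; [lra|].
    destruct (Hge k) as [N2 HN2].
    assert (HN3 : exists N3, forall s, (N3 <= s)%nat -> (1 <= k)%nat ->
      Cmod (sum_n (fun i => c i * RtoC (e i s / e k s))%C (pred k)) < eps / 2).
    { destruct k as [|k]; [exists 0%nat; intros; lia|].
      destruct (proj1 (is_Clim_eps _ _) (Hsmall (S k) k ltac:(lia)) (eps / 2)) as [N3 HN3]; [lra|].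
      exists N3. intros s Hs _. specialize (HN3 s Hs).
      rewrite Cminus_0_r in HN3. exact HN3. }
    destruct HN3 as [N3 HN3].
    set (s := max N1 (max N2 N3)). exists 0%nat. intros _ _.
    specialize (HN1 s ltac:(lia)). specialize (HN2 s ltac:(lia)). specialize (HN3 s ltac:(lia)).
    assert (Hek : RtoC (e k s) <> 0%C) by (apply RtoC_neq_0; lra).
    set (X := sum_n (fun i => c i * RtoC (e i s))%C k) in HN1.
    assert (HX : Cmod (X / RtoC (e k s))%C < eps / 2).
    { rewrite Cmod_div, Cmod_R, Rabs_pos_eq by (exact Hek || lra).
      rewrite Cminus_0_r in HN1.
      apply Rle_lt_trans with (Cmod X / 1); [|lra].
      apply Rmult_le_compat_l; [apply Cmod_ge_0|]. apply Rinv_le_contravar; lra. }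
    destruct k as [|k].
    - replace (c 0%nat - 0)%C with (X / RtoC (e 0%nat s))%C; [lra|].
      unfold X. rewrite sum_O. field. exact Hek.
    - specialize (HN3 ltac:(lia)). simpl pred in HN3.
      set (Y := sum_n (fun i => c i * RtoC (e i s / e (S k) s))%C k) in HN3.
      replace (c (S k) - 0)%C with (X / RtoC (e (S k) s) + - Y)%C.
      + eapply Rle_lt_trans; [apply Cmod_triangle|]. rewrite Cmod_opp. lra.
      + unfold X, Y. rewrite Csum_S.
        rewrite (Csum_ext (fun i => c i * RtoC (e i s / _))%C
          (fun i => / RtoC (e (S k) s) * (c i * RtoC (e i s)))%C).
        * rewrite Csum_scal. set (Z := sum_n _ k). Cfield. exact Hek.
        * intros i _. rewrite RtoC_div by lra. Cfield. exact Hek. }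
  induction k as [|k IH]; intros Hk i Hi.
  - replace i with 0%nat by lia. now apply Htop.
  - destruct (Nat.eq_dec i (S k)) as [->|E]; [now apply Htop|].
    apply IH; [|lia].
    apply is_lim_seq_ext with (2 := Hk). intros s. rewrite Csum_S, (Htop (S k) Hk).
    f_equal. Cring.
Qed.

(** The functions [1, log s, s, s log s, s^2, ...] in increasing order of growth, so that index 0
    carries the constant term. *)
Definition log_scale (i s : nat) : R :=
  INR s ^ Nat.div2 i * (if Nat.odd i then ln (INR s) else 1).

Lemma log_scale_even (m s : nat) : log_scale (2 * m) s = INR s ^ m.
Proof. unfold log_scale. rewrite Nat.div2_double, Nat.odd_even. apply Rmult_1_r. Qed.

Lemma log_scale_odd (m s : nat) : log_scale (S (2 * m)) s = INR s ^ m * ln (INR s).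
Proof.
  unfold log_scale. rewrite Nat.div2_succ_double.
  replace (S (2 * m)) with (2 * m + 1)%nat by lia. now rewrite Nat.odd_odd.
Qed.

Lemma ln_INR_ge_1 (s : nat) : (3 <= s)%nat -> 1 <= ln (INR s).
Proof.
  intros Hs. rewrite <- (ln_exp 1). apply Rcomplements.ln_le; [apply exp_pos|].
  apply Rle_trans with (INR 3); [simpl; pose proof exp_le_3; lra | now apply le_INR].
Qed.

Lemma log_scale_ge_1 (i s : nat) : (3 <= s)%nat -> 1 <= log_scale i s.
Proof.
  intros Hs. unfold log_scale.
  assert (H : 1 <= INR s ^ Nat.div2 i).
  { apply pow_R1_Rle. apply (le_INR 1). lia. }
  pose proof (ln_INR_ge_1 s Hs). destruct (Nat.odd i); nra.
Qed.

Lemma log_scale_ratio_succ (i : nat) : is_lim_seq (fun s => log_scale i s / log_scale (S i) s) 0.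
Proof.
  destruct (Nat.Even_or_Odd i) as [[m ->]|[m ->]].
  - apply is_lim_seq_ext_loc with (u := fun s => / ln (INR s)).
    { exists 3%nat. intros s Hs. rewrite log_scale_even, log_scale_odd.
      pose proof (ln_INR_ge_1 s Hs). field.
      split; [lra | apply pow_nonzero, not_0_INR; lia]. }
    replace (Finite 0) with (Rbar_inv p_infty) by reflexivity.
    apply is_lim_seq_inv; [|discriminate].
    apply (is_lim_comp_seq ln INR p_infty p_infty); [apply is_lim_ln_p | | apply is_lim_seq_INR].
    exists 0%nat. intros; discriminate.
  - replace (S (2 * m + 1)) with (2 * S m)%nat by lia.
    replace (2 * m + 1)%nat with (S (2 * m)) by lia.
    apply is_lim_seq_ext_loc with (u := fun s => ln (INR s) / INR s).
    { exists 1%nat. intros s Hs. rewrite log_scale_even, log_scale_odd. simpl pow.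
      assert (INR s <> 0) by (apply not_0_INR; lia).
      field. split; [now apply pow_nonzero | assumption]. }
    apply (is_lim_comp_seq (fun x => ln x / x) INR p_infty 0);
      [apply is_lim_div_ln_p | | apply is_lim_seq_INR].
    exists 0%nat. intros; discriminate.
Qed.

Lemma log_scale_ratio (i j : nat) : (i < j)%nat ->
  is_lim_seq (fun s => log_scale i s / log_scale j s) 0.
Proof.
  intros H. induction j as [|j IH]; [lia|].
  destruct (Nat.eq_dec i j) as [->|E]; [apply log_scale_ratio_succ|].
  apply is_lim_seq_ext_loc with
    (u := fun s => log_scale i s / log_scale j s * (log_scale j s / log_scale (S j) s)).
  { exists 3%nat. intros s Hs. pose proof (log_scale_ge_1 j s Hs).
    pose proof (log_scale_ge_1 (S j) s Hs). field. lra. }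
  replace (Finite 0) with (Rbar_mult 0 0) by (simpl; f_equal; ring).
  apply (is_lim_seq_mult' _ _ 0 0); [apply IH; lia | apply log_scale_ratio_succ].
Qed.

(** Cut off beyond [M], so that two expansions of different lengths can be compared over a common
    range. *)
Definition scale_coef (M : nat) (a : nat -> C) (b : Z -> C) (i : nat) : C :=
  if Nat.leb (Nat.div2 i) M
  then (if Nat.odd i then a (Nat.div2 i) else b (Z.of_nat (Nat.div2 i)))
  else 0%C.

Lemma scale_coef_sum (M p : nat) (a : nat -> C) (b : Z -> C) (s : nat) :
  sum_n (fun i => scale_coef M a b i * RtoC (log_scale i s))%C (S (2 * (M + p)))
  = (sum_n (fun m => a m * RtoC (INR s ^ m * ln (INR s))) M
     + sum_n (fun j => let m := (Z.of_nat M - Z.of_nat j)%Z in b m * RtoC (powerRZ (INR s) m)) M)%C.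
Proof.
  set (x := fun i => (scale_coef M a b i * RtoC (log_scale i s))%C).
  assert (H : forall k, sum_n x (S (2 * k)) = sum_n (fun m => x (2 * m)%nat + x (S (2 * m)))%C k).
  { induction k as [|k IH].
    - rewrite Csum_S, !sum_O. reflexivity.
    - rewrite (Csum_S _ k), <- IH. replace (2 * S k)%nat with (S (S (2 * k))) by lia.
      rewrite !Csum_S. Cring. }
  rewrite H, Csum_pad.
  - rewrite (Csum_rev (fun j => let m := (Z.of_nat M - Z.of_nat j)%Z in
      (b m * RtoC (powerRZ (INR s) m))%C)), <- Csum_plus. apply Csum_ext. intros m Hm. unfold x.
    rewrite log_scale_even, log_scale_odd. unfold scale_coef.
    rewrite Nat.div2_double, Nat.odd_even, Nat.div2_succ_double, (proj2 (Nat.leb_le m M) Hm).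
    replace (S (2 * m)) with (2 * m + 1)%nat by lia. rewrite Nat.odd_odd.
    replace (Z.of_nat M - Z.of_nat (M - m))%Z with (Z.of_nat m) by lia.
    cbv zeta. rewrite <- pow_powerRZ. Cring.
  - intros j Hj. unfold x, scale_coef. rewrite Nat.div2_double, Nat.div2_succ_double.
    rewrite (proj2 (Nat.leb_gt j M) Hj). Cring.
Qed.

(** Truncation at [N = 0] keeps exactly the nonnegative powers, and an error [o(1)] is enough to
    determine the constant term. The padding [p] makes room for the length of a second expansion. *)
Lemma asymptotic_expansion_scale (u : nat -> C) (M p : nat) (a : nat -> C) (b : Z -> C) :
  is_asymptotic_expansion u M a b ->
  is_Clim (fun s => u s - sum_n (fun i => scale_coef M a b i * RtoC (log_scale i s))%C
    (S (2 * (M + p))))%C 0%C.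
Proof.
  intros H. specialize (H 0%nat).
  apply is_lim_seq_ext with (2 := H). intros s.
  rewrite scale_coef_sum, pow_O, Rmult_1_l, Nat.add_0_r. f_equal. Cring.
Qed.

Lemma is_constant_term_unique (u : nat -> C) (c c' : C) :
  is_constant_term u c -> is_constant_term u c' -> c = c'.
Proof.
  intros [M [a [b [H <-]]]] [M' [a' [b' [H' <-]]]].
  apply (asymptotic_expansion_scale u M M') in H.
  apply (asymptotic_expansion_scale u M' M) in H'. rewrite (Nat.add_comm M' M) in H'.
  pose proof (is_Clim_plus _ _ _ _ H' (is_Clim_scal (- (1))%C _ _ H)) as K.
  apply Ceq_minus.
  apply (scale_coef_zero log_scale (fun i => scale_coef M a b i - scale_coef M' a' b' i)%C)
    with (k := S (2 * (M + M'))) (i := 0%nat).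
  - apply log_scale_ratio.
  - intros i. exists 3%nat. intros s. apply log_scale_ge_1.
  - apply is_lim_seq_ext with (2 := K). intros s. f_equal.
    rewrite (Csum_ext (fun i => (_ - _) * _)%C (fun i =>
      scale_coef M a b i * RtoC (log_scale i s) - scale_coef M' a' b' i * RtoC (log_scale i s))%C)
      by (intros i _; Cring).
    rewrite Csum_minus. Cring.
  - lia.
Qed.

(** * Existence of the asymptotic expansion *)

Lemma Clog_RtoC (x : R) : 0 < x -> Clog (RtoC x) = RtoC (ln x).
Proof.
  intros Hx. unfold Clog. rewrite Carg_atan by exact Hx.
  rewrite Cmod_R, Rabs_pos_eq by lra.
  simpl Im. simpl Re. unfold Rdiv. rewrite Rmult_0_l, atan_0. reflexivity.
Qed.

Lemma pl_RtoC (n i : nat) (x : R) : 0 < x ->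
  pl n i (RtoC x) =
  (RtoC (pl_log n i) * RtoC (powerRZ x (Z.of_nat (n + 1) - Z.of_nat i) * ln x)
   + RtoC (pl_pow n i) * RtoC (powerRZ x (Z.of_nat (n + 1) - Z.of_nat i)))%C.
Proof.
  intros Hx. unfold pl. rewrite Clog_RtoC by exact Hx.
  rewrite RtoC_mult.
  replace (RtoC (powerRZ x (Z.of_nat (n + 1) - Z.of_nat i)))
    with (RtoC x ^ (n + 1) * (/ RtoC x) ^ i)%C; [ring|].
  rewrite <- RtoC_inv, <- !RtoC_pow, <- RtoC_mult by lra. f_equal.
  unfold Z.sub. rewrite powerRZ_add, <- pow_powerRZ by lra. f_equal.
  rewrite powerRZ_neg', <- pow_powerRZ. apply pow_inv.
Qed.

(** Terms of index at least [n + 2] tend to 0, so the limit does not depend on the order. This is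
    what lets truncations at every [N] share one constant. *)
Lemma is_Clim_em_seq_order (n p : nat) (w : C) : 0 < Re w ->
  is_Clim (em_seq n (n + 1 + p) 0 w) (em_const n w).
Proof.
  intros Hw.
  assert (E : forall q m, em_seq n (S (n + 1 + q)) 0 w m
    = (em_seq n (n + 1 + q) 0 w m - bern (S (n + 1 + q)) w * pl n (n + 1 + S q) (RtoC (INR (S m))))%C).
  { intros q m. unfold em_seq. rewrite Csum_S.
    replace (n + 1 + S q)%nat with (S (n + 1 + q) + 0)%nat by lia. Cring. }
  assert (T : forall q, is_Clim (fun m => bern (S (n + 1 + q)) w * pl n (n + 1 + S q) (RtoC (INR (S m))))%C 0%C).
  { intros q. apply (is_Clim_of_bound _ _ (Cmod (bern (S (n + 1 + q)) w) * Rabs (pl_pow n (n + 1 + S q)))).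
    intros m. pose proof (INR_S_ge_1 m). rewrite Cminus_0_r, Cmod_mult. unfold Rdiv. rewrite Rmult_assoc.
    apply Rmult_le_compat_l; [apply Cmod_ge_0|].
    eapply Rle_trans; [apply (pl_decay n (S q) _ (INR (S m))); [lia | lra|]|].
    - rewrite Cmod_R, Rabs_pos_eq; lra.
    - apply Rmult_le_compat_l; [apply Rabs_pos|].
      apply Rinv_le_contravar; [lra|].
      rewrite <- (pow_1 (INR (S m))) at 1. apply Rle_pow; [lra | lia]. }
  assert (Up : forall q, is_Clim (em_seq n (n + 1 + q) 0 w) (em_const n w) <->
    is_Clim (em_seq n (n + 1 + S q) 0 w) (em_const n w)).
  { intros q. specialize (T q). rewrite (Nat.add_succ_r (n + 1) q). split; intros H.
    - pose proof (is_Clim_plus _ _ _ _ H (is_Clim_scal (- (1))%C _ _ T)) as K.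
      replace (em_const n w + - (1) * 0)%C with (em_const n w) in K by ring.
      apply is_lim_seq_ext with (2 := K). intros m. rewrite E. f_equal.
      rewrite (Nat.add_succ_r (n + 1) q). ring.
    - pose proof (is_Clim_plus _ _ _ _ H T) as K. rewrite Cplus_0_r in K.
      apply is_lim_seq_ext with (2 := K). intros m. rewrite E. f_equal. ring. }
  pose proof (is_Clim_em_const n w Hw) as H2.
  replace (n + 3)%nat with (n + 1 + 2)%nat in H2 by lia.
  assert (H0 : is_Clim (em_seq n (n + 1 + 0) 0 w) (em_const n w)).
  { exact (proj2 (Up 0%nat) (proj2 (Up 1%nat) H2)). }
  induction p as [|p IH]; [exact H0 | exact (proj1 (Up p) IH)].
Qed.

Definition expansion_log (n : nat) (w : C) (m : nat) : C :=
  (bern (n + 1 - m) w * RtoC (pl_log n (n + 1 - m)))%C.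

(** The power [s^m] comes from [pl n i] with [i = n + 1 - m]; the power 0 also receives the
    Euler-Maclaurin constant. *)
Definition expansion_pow (n : nat) (w : C) (m : Z) : C :=
  let i := Z.to_nat (Z.of_nat (n + 1) - m) in
  (bern i w * RtoC (pl_pow n i) + (if Z.eqb m 0 then em_const n w else 0))%C.

Lemma expansion_sum (n N : nat) (w : C) (x : R) : 0 < x ->
  (sum_n (fun m => expansion_log n w m * RtoC (x ^ m * ln x)) (n + 1)
   + sum_n (fun j => let m := (Z.of_nat (n + 1) - Z.of_nat j)%Z in
       expansion_pow n w m * RtoC (powerRZ x m)) (n + 1 + N)
   = sum_n (fun i => bern i w * pl n (i + 0) (RtoC x)) (n + 1 + N) + em_const n w)%C.
Proof.
  intros Hx. rewrite Csum_rev.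
  rewrite (Csum_ext (fun j => expansion_log n w _ * _)%C
    (fun i => bern i w * (RtoC (pl_log n i) * RtoC (powerRZ x (Z.of_nat (n + 1) - Z.of_nat i) * ln x)))%C).
  2: { intros i Hi. unfold expansion_log. replace (n + 1 - (n + 1 - i))%nat with i by lia.
       rewrite <- Nat2Z.inj_sub, <- pow_powerRZ by exact Hi. Cring. }
  rewrite <- (Csum_pad (fun i => bern i w * (RtoC (pl_log n i) * _))%C (n + 1) N).
  2: { intros i Hi. rewrite pl_log_0 by lia. Cring. }
  rewrite (Csum_ext (fun j => let m := (Z.of_nat (n + 1) - Z.of_nat j)%Z in
      (expansion_pow n w m * RtoC (powerRZ x m))%C) (fun i =>
    bern i w * (RtoC (pl_pow n i) * RtoC (powerRZ x (Z.of_nat (n + 1) - Z.of_nat i)))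
    + (if Nat.eqb i (n + 1) then em_const n w else 0))%C).
  - rewrite Csum_plus, (Csum_single (fun i => if Nat.eqb i (n + 1) then _ else _) (n + 1)) by
      (try lia; intros j Hj; now rewrite (proj2 (Nat.eqb_neq j (n + 1)) Hj)).
    rewrite Nat.eqb_refl, Cplus_assoc, <- Csum_plus. f_equal.
    apply Csum_ext. intros i _. rewrite Nat.add_0_r, pl_RtoC by exact Hx. Cring.
  - intros i _. cbv zeta. unfold expansion_pow.
    replace (Z.to_nat (Z.of_nat (n + 1) - (Z.of_nat (n + 1) - Z.of_nat i))) with i by lia.
    destruct (Nat.eqb_spec i (n + 1)) as [->|Hi].
    + rewrite Z.sub_diag. simpl. Cring.
    + rewrite (proj2 (Z.eqb_neq _ _)) by lia. Cring.
Qed.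

Lemma is_constant_term_powlog (n : nat) (w : C) : 0 < Re w ->
  is_constant_term
    (fun s : nat => sum_n (fun k : nat => powlog n (RtoC (INR k) + w)%C) (pred s))
    (bern (n + 1) w * RtoC (pl_pow n (n + 1)) + em_const n w)%C.
Proof.
  intros Hw. exists (n + 1)%nat, (expansion_log n w), (expansion_pow n w). split.
  2: { unfold expansion_pow. rewrite Z.sub_0_r, Nat2Z.id. reflexivity. }
  (* Passing to [s = m + 1] gives [pred s = m] and leaves [s = 0] aside. *)
  intros N. apply is_lim_seq_incr_1.
  (* one more term of the expansion makes the error [O(s^(-N-1))] *)
  set (K := 2 * em_rate n (n + N + 1) (N + 2) w
    + Cmod (bern (n + 1 + S N) w) * Rabs (pl_pow n (n + 1 + S N))).
  apply is_lim_seq_le_le with (u := fun _ => 0) (w := fun m => K / INR (S m));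
    [| apply is_lim_seq_const | apply is_lim_seq_inv_S].
  intros m. pose proof (INR_S_ge_1 m) as Hm. set (x := INR (S m)) in *.
  assert (HxN : 0 < x ^ N) by (apply pow_lt; lra).
  split; [apply Rmult_le_pos; [lra | apply Cmod_ge_0]|].
  cbv beta. simpl pred.
  assert (E : (sum_n (fun k : nat => powlog n (RtoC (INR k) + w)) m
      - sum_n (fun m => expansion_log n w m * RtoC (x ^ m * ln x)) (n + 1)
      - sum_n (fun j => let m := (Z.of_nat (n + 1) - Z.of_nat j)%Z in
         expansion_pow n w m * RtoC (powerRZ x m)) (n + 1 + N)
    = (em_seq n (n + 1 + S N) 0 w m - em_const n w)
      + bern (n + 1 + S N) w * pl n (n + 1 + S N) (RtoC x))%C).
  { pose proof (expansion_sum n N w x ltac:(lra)) as Ex. revert Ex.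
    unfold em_seq. fold x.
    set (A := sum_n (fun m => expansion_log n w m * _)%C _). set (B := sum_n (fun j => let m := (Z.of_nat (n + 1) - Z.of_nat j)%Z in _) _).
    intros Ex. rewrite (Nat.add_succ_r (n + 1) N), Csum_S.
    rewrite (Csum_ext (fun k => powlog n (RtoC (INR k) + w)%C) (fun k => pl n 1 (RtoC (INR k) + w)%C)).
    - rewrite Nat.add_0_r. set (D := sum_n _ m).
      transitivity (D - (A + B))%C; [Cring|]. rewrite Ex. Cring.
    - intros k _. symmetry. apply pl_1, Re_pos_neq_0. rewrite re_plus, re_RtoC.
      pose proof (pos_INR k). lra. }
  eapply Rle_trans; [exact (Req_le _ _ (f_equal (fun z => x ^ N * Cmod z) E))|].
  (* The steps decay like [p^(-N-2)]; the factor [p^(-N)] is frozen at [x], and summing the rest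
     gives one more factor [1/x]. *)
  assert (H1 : Cmod (em_seq n (n + 1 + S N) 0 w m - em_const n w)%C
    <= 2 * (em_rate n (n + N + 1) (N + 2) w / x ^ N) / x).
  { apply inv_sqr_limit; [|now apply is_Clim_em_seq_order].
    intros p Hp. replace (n + 1 + S N)%nat with (S (n + N + 1)) by lia.
    eapply Rle_trans; [apply (em_seq_step n (n + N + 1) 0 (N + 2)); [exact Hw | lia | lia]|].
    apply div_pow_split; [apply em_rate_nonneg | lra|]. apply le_INR. lia. }
  assert (H2 : Cmod (bern (n + 1 + S N) w * pl n (n + 1 + S N) (RtoC x))%C
    <= Cmod (bern (n + 1 + S N) w) * (Rabs (pl_pow n (n + 1 + S N)) / x ^ S N)).
  { rewrite Cmod_mult. apply Rmult_le_compat_l; [apply Cmod_ge_0|].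
    apply pl_decay; [lia | lra|]. rewrite Cmod_R, Rabs_pos_eq; lra. }
  apply Rle_trans with (x ^ N * (2 * (em_rate n (n + N + 1) (N + 2) w / x ^ N) / x
    + Cmod (bern (n + 1 + S N) w) * (Rabs (pl_pow n (n + 1 + S N)) / x ^ S N))).
  - apply Rmult_le_compat_l; [lra|]. eapply Rle_trans; [apply Cmod_triangle | lra].
  - apply Req_le. unfold K. simpl pow. field. lra.
Qed.

Lemma Sconst_em_const (n : nat) (w : C) : 0 < Re w ->
  Sconst n w = (bern (n + 1) w * RtoC (pl_pow n (n + 1)) + em_const n w)%C.
Proof.
  intros Hw. unfold Sconst, constant_term.
  apply (iota_unique (V := C_CompleteNormedModule)).
  - intros y Hy. apply (is_constant_term_unique _ _ _ Hy). now apply is_constant_term_powlog.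
  - now apply is_constant_term_powlog.
Qed.

(** * Goursat's theorem on a rectangle *)

(** Keeps a quarter on which [P] fails; the last quarter is kept by default, which is right when [P]
    on all four quarters would imply [P] on the box. *)
Definition half_box (P : R -> R -> R -> R -> Prop) (q : (R * R) * (R * R)) : (R * R) * (R * R) :=
  let '((a, b), (c, d)) := q in
  let m := (a + b) / 2 in
  let k := (c + d) / 2 in
  if excluded_middle_informative (P a m c k) then
    if excluded_middle_informative (P m b c k) then
      if excluded_middle_informative (P a m k d) then ((m, b), (k, d))
      else ((a, m), (k, d))
    else ((m, b), (c, k))
  else ((a, m), (c, k)).

(** If [P] failed, one could choose nested failing quarters; they shrink to a point, where the local
    hypothesis contradicts the failure. *)
Lemma bisect_box (P : R -> R -> R -> R -> Prop) (a0 b0 c0 d0 : R) :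
  a0 <= b0 -> c0 <= d0 ->
  (forall a b c d, a0 <= a -> a <= b -> b <= b0 -> c0 <= c -> c <= d -> d <= d0 ->
     let m := (a + b) / 2 in let k := (c + d) / 2 in
     P a m c k -> P m b c k -> P a m k d -> P m b k d -> P a b c d) ->
  (forall x y, a0 <= x <= b0 -> c0 <= y <= d0 -> exists delta, 0 < delta /\
     forall a b c d, a0 <= a -> a <= x <= b -> b <= b0 -> c0 <= c -> c <= y <= d -> d <= d0 ->
     b - a < delta -> d - c < delta -> P a b c d) ->
  P a0 b0 c0 d0.
Proof.
  intros Hab Hcd Hsplit Hloc. apply NNPP. intros HnP.
  set (q := fix q (n : nat) := match n with O => ((a0, b0), (c0, d0)) | S n => half_box P (q n) end).
  set (A := fun n => fst (fst (q n))). set (B := fun n => snd (fst (q n))).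
  set (D := fun n => fst (snd (q n))). set (E := fun n => snd (snd (q n))).
  assert (Hinv : forall n, a0 <= A n /\ A n <= B n /\ B n <= b0 /\ c0 <= D n /\ D n <= E n /\ E n <= d0
    /\ B n - A n = (b0 - a0) * (/ 2) ^ n /\ E n - D n = (d0 - c0) * (/ 2) ^ n
    /\ ~ P (A n) (B n) (D n) (E n)).
  { induction n as [|n IH].
    - unfold A, B, D, E. simpl. rewrite !Rmult_1_r. repeat split; try lra; exact HnP.
    - destruct IH as [H1 [H2 [H3 [H4 [H5 [H6 [H7 [H8 H9]]]]]]]].
      specialize (Hsplit _ _ _ _ H1 H2 H3 H4 H5 H6). cbv zeta in Hsplit.
      unfold A, B, D, E in *. simpl q. destruct (q n) as [[a b] [c d]].
      unfold half_box. simpl fst in *. simpl snd in *. cbn [pow].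
      repeat destruct excluded_middle_informative; simpl; repeat split; try lra; tauto. }
  assert (Hstep : forall n, A n <= A (S n) /\ B (S n) <= B n /\ D n <= D (S n) /\ E (S n) <= E n).
  { intros n. destruct (Hinv n) as [H1 [H2 [H3 [H4 [H5 [H6 _]]]]]].
    unfold A, B, D, E in *. simpl q. destruct (q n) as [[a b] [c d]].
    unfold half_box. simpl fst in *. simpl snd in *.
    repeat destruct excluded_middle_informative; simpl; repeat split; lra. }
  assert (Hmono : forall n k, A n <= A (n + k)%nat /\ B (n + k)%nat <= B n
    /\ D n <= D (n + k)%nat /\ E (n + k)%nat <= E n).
  { intros n k. induction k as [|k IH]; [rewrite Nat.add_0_r; lra|].
    rewrite Nat.add_succ_r. specialize (Hstep (n + k)%nat). lra. }
  assert (Hcross : forall n m, A n <= B m /\ D n <= E m).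
  { intros n m. pose proof (Hmono n m) as H1. pose proof (Hmono m n) as H2.
    rewrite (Nat.add_comm m n) in H2. destruct (Hinv (n + m)%nat) as [_ [H3 [_ [_ [H4 _]]]]]. lra. }
  destruct (completeness (fun z => exists n, z = A n)) as [x [Hx1 Hx2]].
  { exists b0. intros z [n ->]. destruct (Hinv n); lra. }
  { exists (A 0%nat). now exists 0%nat. }
  destruct (completeness (fun z => exists n, z = D n)) as [y [Hy1 Hy2]].
  { exists d0. intros z [n ->]. destruct (Hinv n); lra. }
  { exists (D 0%nat). now exists 0%nat. }
  assert (Hx : forall n, A n <= x <= B n).
  { intros n. split; [apply Hx1; now exists n|]. apply Hx2. intros z [m ->]. apply Hcross. }
  assert (Hy : forall n, D n <= y <= E n).
  { intros n. split; [apply Hy1; now exists n|]. apply Hy2. intros z [m ->]. apply Hcross. }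
  destruct (Hloc x y) as [delta [Hd HP]].
  { exact (Hx 0%nat). }
  { exact (Hy 0%nat). }
  (* [W] dominates both side lengths, and the added 1 keeps it positive for a degenerate box. *)
  set (W := (b0 - a0) + (d0 - c0) + 1).
  destruct (pow_lt_1_zero (/ 2) ltac:(rewrite Rabs_pos_eq; lra) (delta / W)) as [n Hn].
  { apply Rdiv_lt_0_compat; unfold W; lra. }
  specialize (Hn n (Nat.le_refl n)).
  assert (Hp : 0 < (/ 2) ^ n) by (apply pow_lt; lra).
  rewrite Rabs_pos_eq in Hn by lra.
  assert (HWn : W * (/ 2) ^ n < delta).
  { apply Rmult_lt_compat_l with (r := W) in Hn; [|unfold W; lra].
    replace (W * (delta / W)) with delta in Hn by (field; unfold W; lra). exact Hn. }
  destruct (Hinv n) as [H1 [H2 [H3 [H4 [H5 [H6 [H7 [H8 H9]]]]]]]].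
  apply H9. apply HP; try apply Hx; try apply Hy; try assumption; unfold W in HWn; nra.
Qed.

Definition hint (f : C -> C) (y a b : R) : C :=
  RInt (V := C_R_CompleteNormedModule) (fun x => f (x, y)) a b.

Definition vint (f : C -> C) (x c d : R) : C :=
  RInt (V := C_R_CompleteNormedModule) (fun y => Ci * f (x, y))%C c d.

Definition box_int (f : C -> C) (a b c d : R) : C :=
  (hint f c a b + vint f b c d - hint f d a b - vint f a c d)%C.

Definition holomorphic_on (f : C -> C) (D : C -> Prop) : Prop :=
  forall z, D z -> exists l, is_Cderive f z l.

Definition box (a b c d : R) (z : C) : Prop := a <= Re z <= b /\ c <= Im z <= d.

Lemma horizontal_pt (x y : R) : (x, y) = (Ci * RtoC y + RtoC x * 1)%C.
Proof. apply injective_projections; simpl; ring. Qed.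

Lemma vertical_pt (x y : R) : (x, y) = (RtoC x + RtoC y * Ci)%C.
Proof. apply injective_projections; simpl; ring. Qed.

Lemma is_CRInt_hint (f : C -> C) (y a b : R) :
  (forall x, Rmin a b <= x <= Rmax a b -> exists l, is_Cderive f (x, y) l) ->
  is_CRInt (fun x => f (x, y)) a b (hint f y a b).
Proof.
  intros H. apply (RInt_correct (V := C_R_CompleteNormedModule)).
  apply (ex_RInt_continuous (V := C_R_CompleteNormedModule)). intros x Hx.
  destruct (H x Hx) as [l Hl].
  apply (ex_derive_continuous (K := R_AbsRing) (V := C_R_NormedModule)).
  exists (1 * l)%C.
  apply is_derive_ext with (f := fun x : R => f (Ci * RtoC y + RtoC x * 1)%C).
  { intros t. now rewrite <- horizontal_pt. }
  apply is_curve_derive_line. now rewrite <- horizontal_pt.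
Qed.

Lemma is_CRInt_vint (f : C -> C) (x c d : R) :
  (forall y, Rmin c d <= y <= Rmax c d -> exists l, is_Cderive f (x, y) l) ->
  is_CRInt (fun y => Ci * f (x, y))%C c d (vint f x c d).
Proof.
  intros H. apply (RInt_correct (V := C_R_CompleteNormedModule)).
  apply (ex_RInt_continuous (V := C_R_CompleteNormedModule)). intros y Hy.
  destruct (H y Hy) as [l Hl].
  apply (ex_derive_continuous (K := R_AbsRing) (V := C_R_NormedModule)).
  exists (Ci * (Ci * l))%C.
  apply is_derive_ext with (f := fun y : R => (fun z => Ci * f z)%C (RtoC x + RtoC y * Ci)%C).
  { intros t. now rewrite <- vertical_pt. }
  apply (is_curve_derive_line (fun z => Ci * f z)%C).
  apply is_Cderive_scal. now rewrite <- vertical_pt.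
Qed.

Lemma hint_Chasles (f : C -> C) (y a m b : R) : a <= m <= b ->
  (forall x, a <= x <= b -> exists l, is_Cderive f (x, y) l) ->
  hint f y a b = (hint f y a m + hint f y m b)%C.
Proof.
  intros Hm H. symmetry. apply (RInt_Chasles (V := C_R_CompleteNormedModule)).
  - eexists. apply is_CRInt_hint. intros x. rewrite Rmin_left, Rmax_right by lra.
    intros Hx. apply H. lra.
  - eexists. apply is_CRInt_hint. intros x. rewrite Rmin_left, Rmax_right by lra.
    intros Hx. apply H. lra.
Qed.

Lemma vint_Chasles (f : C -> C) (x c k d : R) : c <= k <= d ->
  (forall y, c <= y <= d -> exists l, is_Cderive f (x, y) l) ->
  vint f x c d = (vint f x c k + vint f x k d)%C.
Proof.
  intros Hm H. symmetry. apply (RInt_Chasles (V := C_R_CompleteNormedModule)).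
  - eexists. apply is_CRInt_vint. intros y. rewrite Rmin_left, Rmax_right by lra.
    intros Hx. apply H. lra.
  - eexists. apply is_CRInt_vint. intros y. rewrite Rmin_left, Rmax_right by lra.
    intros Hx. apply H. lra.
Qed.

Lemma box_int_split (f : C -> C) (a b c d m k : R) :
  a <= m <= b -> c <= k <= d -> holomorphic_on f (box a b c d) ->
  box_int f a b c d =
  (box_int f a m c k + box_int f m b c k + box_int f a m k d + box_int f m b k d)%C.
Proof.
  intros Hm Hk H. unfold box_int.
  assert (Hh : forall y, c <= y <= d -> forall x, a <= x <= b -> exists l, is_Cderive f (x, y) l)
    by (intros y Hy x Hx; apply H; split; assumption).
  rewrite (hint_Chasles f c a m b) by (auto; apply Hh; lra).
  rewrite (hint_Chasles f d a m b) by (auto; apply Hh; lra).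
  rewrite (vint_Chasles f b c k d) by (auto; intros y Hy; apply Hh; lra).
  rewrite (vint_Chasles f a c k d) by (auto; intros y Hy; apply Hh; lra).
  ring.
Qed.

(* An affine function has a primitive, so only the first-order remainder
   contributes to the boundary integral. *)
Lemma box_int_local (f : C -> C) (z0 l : C) (eps : R) : 0 < eps -> is_Cderive f z0 l ->
  exists delta, 0 < delta /\ forall a b c d,
    box a b c d z0 -> b - a < delta -> d - c < delta -> holomorphic_on f (box a b c d) ->
    Cmod (box_int f a b c d) <= eps * ((b - a) + (d - c)) ^ 2.
Proof.
  intros Heps Hf.
  destruct (proj1 (is_Cderive_eps f z0 l) Hf (eps / 2)) as [delta [Hd Hdelta]]; [lra|].
  (* The distance from [z0] to a point of the box is at most the sum of the two sides, hence the
     half. *)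
  exists (delta / 2). split; [lra|]. intros a b c d [Hz1 Hz2] Hab Hcd H.
  set (p := (b - a) + (d - c)).
  set (A := fun z => (f z0 + l * (z - z0))%C).
  set (F := fun z => ((f z0 - l * z0) * z + l / 2 * (z ^ 2))%C).
  assert (HF : forall z, is_Cderive F z (A z)).
  { intros z. replace (A z) with ((f z0 - l * z0) * 1 + l / 2 * (RtoC (INR 2) * z ^ pred 2))%C.
    - apply is_Cderive_plus; apply is_Cderive_scal; [apply is_Cderive_id | apply is_Cderive_pow].
    - unfold A. change (INR 2) with 2. simpl. field. }
  assert (HA : forall z, is_Cderive A z (0 + l * (1 - 0))%C).
  { intros z. apply is_Cderive_plus; [apply is_Cderive_const|].
    apply is_Cderive_scal, is_Cderive_minus; [apply is_Cderive_id | apply is_Cderive_const]. }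
  assert (Hbound : forall z, box a b c d z -> Cmod (f z - A z)%C <= eps / 2 * p).
  { intros z [Hx Hy].
    assert (Hz : Cmod (z - z0)%C <= p).
    { eapply Rle_trans; [apply Cmod_le_Re_Im|]. rewrite re_minus, im_minus. unfold p.
      apply Rplus_le_compat; apply Rabs_le; lra. }
    replace (f z - A z)%C with (f z - f z0 - l * (z - z0))%C by (unfold A; ring).
    eapply Rle_trans; [apply Hdelta; unfold p in Hz; lra|].
    apply Rmult_le_compat_l; lra. }
  assert (Hh : forall y, c <= y <= d ->
    Cmod (hint f y a b - (F (b, y) - F (a, y)))%C <= (b - a) * (eps / 2 * p)).
  { intros y Hy. apply (is_CRInt_norm (fun x => f (x, y) - A (x, y))%C); [lra| |].
    - intros x Hx. apply Hbound. split; simpl; lra.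
    - apply is_CRInt_minus.
      + apply is_CRInt_hint. intros x. rewrite Rmin_left, Rmax_right by lra.
        intros Hx. apply H. split; simpl; lra.
      + rewrite !horizontal_pt.
        apply is_RInt_ext with (f := fun x => (1 * A (Ci * RtoC y + RtoC x * 1))%C).
        { intros x _. rewrite <- horizontal_pt. apply Cmult_1_l. }
        apply (is_CRInt_line F A (fun _ => 0 + l * (1 - 0))%C); intros t _; [apply HF | apply HA]. }
  assert (Hv : forall x, a <= x <= b ->
    Cmod (vint f x c d - (F (x, d) - F (x, c)))%C <= (d - c) * (eps / 2 * p)).
  { intros x Hx. apply (is_CRInt_norm (fun y => Ci * f (x, y) - Ci * A (x, y))%C); [lra| |].
    - intros y Hy. replace (Ci * f (x, y) - Ci * A (x, y))%C with (Ci * (f (x, y) - A (x, y)))%C by ring.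
      rewrite Cmod_mult, Cmod_Ci, Rmult_1_l. apply Hbound. split; simpl; lra.
    - apply is_CRInt_minus.
      + apply is_CRInt_vint. intros y. rewrite Rmin_left, Rmax_right by lra.
        intros Hy. apply H. split; simpl; lra.
      + rewrite !vertical_pt.
        apply is_RInt_ext with (f := fun y => (Ci * A (RtoC x + RtoC y * Ci))%C).
        { intros y _. now rewrite <- vertical_pt. }
        apply (is_CRInt_line F A (fun _ => 0 + l * (1 - 0))%C); intros t _; [apply HF | apply HA]. }
  pose proof (Hh c ltac:(lra)) as H1. pose proof (Hh d ltac:(lra)) as H2.
  pose proof (Hv a ltac:(lra)) as H3. pose proof (Hv b ltac:(lra)) as H4.
  unfold box_int.
  replace (hint f c a b + vint f b c d - hint f d a b - vint f a c d)%C with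
    (((hint f c a b - (F (b, c) - F (a, c))) + (vint f b c d - (F (b, d) - F (b, c))))
     + (- (hint f d a b - (F (b, d) - F (a, d))) + - (vint f a c d - (F (a, d) - F (a, c)))))%C by ring.
  eapply Rle_trans; [apply Cmod_triangle|].
  eapply Rle_trans; [apply Rplus_le_compat; apply Cmod_triangle|].
  rewrite !Cmod_opp.
  apply Rle_trans with (2 * ((b - a) * (eps / 2 * p) + (d - c) * (eps / 2 * p))); [lra|].
  apply Req_le. unfold p. field.
Qed.

(** The bound [eps * p^2], with [p] half the perimeter, survives subdivision because
    [4 (p/2)^2 = p^2], and differentiability gives it on small boxes. Bisection extends it to the
    whole box for every [eps]. *)
Lemma goursat_box (f : C -> C) (a b c d : R) : a <= b -> c <= d ->
  holomorphic_on f (box a b c d) -> box_int f a b c d = 0%C.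
Proof.
  intros Hab Hcd H. apply Cmod_eq_0. apply Rle_antisym; [|apply Cmod_ge_0].
  set (p := (b - a) + (d - c)).
  assert (K : forall eps, 0 < eps -> Cmod (box_int f a b c d) <= eps * p ^ 2).
  { intros eps Heps. unfold p.
    apply (bisect_box (fun a b c d => Cmod (box_int f a b c d) <= eps * ((b - a) + (d - c)) ^ 2)
      a b c d Hab Hcd).
    - intros a' b' c' d' H1 H2 H3 H4 H5 H6 m k P1 P2 P3 P4.
      rewrite (box_int_split f a' b' c' d' m k).
      + eapply Rle_trans; [apply Cmod_triangle|].
        eapply Rle_trans; [apply Rplus_le_compat_r, Cmod_triangle|].
        eapply Rle_trans; [apply Rplus_le_compat_r, Rplus_le_compat_r, Cmod_triangle|].
        unfold m, k in *. nra.
      + unfold m; lra.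
      + unfold k; lra.
      + intros z [Hz1 Hz2]. apply H. split; lra.
    - intros x y Hx Hy. destruct (H (x, y)) as [l Hl]; [split; assumption|].
      destruct (box_int_local f (x, y) l eps Heps Hl) as [delta [Hd HP]].
      exists delta. split; [exact Hd|]. intros a' b' c' d' H1 H2 H3 H4 H5 H6 H7 H8.
      apply HP; [split; assumption | assumption | assumption|].
      intros z [Hz1 Hz2]. apply H. split; lra. }
  apply Rle_trans with (0 * (p ^ 2 + 1)); [|lra].
  apply le_epsilon. intros eps Heps. rewrite Rmult_0_l, Rplus_0_l.
  pose proof (pow2_ge_0 p).
  specialize (K (eps / (p ^ 2 + 1))).
  eapply Rle_trans; [apply K; apply Rdiv_lt_0_compat; lra|].
  unfold Rdiv. rewrite Rmult_assoc. rewrite <- (Rmult_1_r eps) at 2.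
  apply Rmult_le_compat_l; [lra|].
  apply Rmult_le_reg_l with (p ^ 2 + 1); [lra|].
  rewrite <- Rmult_assoc, Rinv_r by lra. lra.
Qed.

(** * Periodic functions of exponential type less than [PI] *)

(* The singularity at [s] is removable, and [0 ^ 2 / 0 = 0] happens to be the right value. *)
Lemma is_Cderive_sqr_div (A B : C -> C) (s lA kappa : C) :
  is_Cderive A s lA -> is_Cderive B s kappa -> A s = 0%C -> B s = 0%C -> kappa <> 0%C ->
  is_Cderive (fun z => A z ^ 2 / B z)%C s (lA ^ 2 / kappa)%C.
Proof.
  intros HA HB HA0 HB0 Hk. apply is_Cderive_eps. intros eps Heps.
  set (k := Cmod kappa). set (m := Cmod lA).
  assert (Hk0 : 0 < k) by now apply Cmod_gt_0.
  assert (Hm0 : 0 <= m) by apply Cmod_ge_0.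
  set (T := k * (2 * m + 1) + m ^ 2).
  assert (HT : 0 < T) by (unfold T; nra).
  (* [e] is the error allowed in [A ~ lA u] and [B ~ kappa u]. The numerator of the remainder is
     then at most [e T |u|^2], while its denominator is at least [k^2 |u| / 2]. *)
  set (e := Rmin 1 (Rmin (k / 2) (eps * k ^ 2 / (2 * T)))).
  assert (He : 0 < e).
  { unfold e. repeat apply Rmin_glb_lt; [lra | lra|].
    apply Rdiv_lt_0_compat; [|lra]. apply Rmult_lt_0_compat; [lra | now apply pow_lt]. }
  assert (He1 : e <= 1) by apply Rmin_l.
  assert (He2 : e <= k / 2) by (eapply Rle_trans; [apply Rmin_r | apply Rmin_l]).
  assert (He3 : e <= eps * k ^ 2 / (2 * T)) by (eapply Rle_trans; [apply Rmin_r | apply Rmin_r]).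
  destruct (proj1 (is_Cderive_eps _ _ _) HA e He) as [d1 [Hd1 K1]].
  destruct (proj1 (is_Cderive_eps _ _ _) HB e He) as [d2 [Hd2 K2]].
  exists (Rmin d1 d2). split; [now apply Rmin_glb_lt|].
  intros y Hy.
  specialize (K1 y (Rlt_le_trans _ _ _ Hy (Rmin_l _ _))).
  specialize (K2 y (Rlt_le_trans _ _ _ Hy (Rmin_r _ _))).
  rewrite HA0 in *. rewrite HB0 in *.
  set (u := (y - s)%C) in *. clear Hy.
  pose proof (Cmod_ge_0 u) as Hu0.
  replace (0 ^ 2 / 0)%C with (RtoC 0) by (unfold Cdiv; simpl; ring).
  rewrite !Cminus_0_r in K1, K2. rewrite Cminus_0_r.
  destruct (Ceq_dec u 0%C) as [Eu|Eu].
  - rewrite Eu, Cmult_0_r, Cminus_0_r, Cmod_0, Rmult_0_r in K1.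
    rewrite Eu, Cmod_0, Rmult_0_r, Cmult_0_r, Cminus_0_r.
    assert (EA : A y = 0%C) by (apply Cmod_eq_0; pose proof (Cmod_ge_0 (A y)); lra).
    rewrite EA. unfold Cdiv. replace (0 ^ 2 * / B y)%C with (RtoC 0) by (simpl; ring).
    rewrite Cmod_0. lra.
  - assert (Hu : 0 < Cmod u) by now apply Cmod_gt_0.
    assert (HBy : k / 2 * Cmod u <= Cmod (B y)).
    { assert (k * Cmod u <= Cmod (B y) + e * Cmod u); [|nra].
      unfold k. rewrite <- Cmod_mult.
      replace (kappa * u)%C with (B y + - (B y - kappa * u))%C by ring.
      eapply Rle_trans; [apply Cmod_triangle|]. rewrite Cmod_opp. lra. }
    assert (HBy0 : B y <> 0%C) by (apply Cmod_gt_0; nra).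
    replace (A y ^ 2 / B y - lA ^ 2 / kappa * u)%C
      with ((kappa * ((A y - lA * u) * (A y + lA * u)) + - (lA ^ 2 * u * (B y - kappa * u)))
            / (B y * kappa))%C by (field; now split).
    rewrite Cmod_div by now apply Cmult_neq_0.
    rewrite (Cmod_mult (B y)). fold k.
    assert (HS : Cmod (A y + lA * u)%C <= (2 * m + 1) * Cmod u).
    { replace (A y + lA * u)%C with ((A y - lA * u) + 2 * (lA * u))%C by ring.
      eapply Rle_trans; [apply Cmod_triangle|].
      rewrite !Cmod_mult, Cmod_R, Rabs_pos_eq by lra. fold m. nra. }
    assert (HN : Cmod (kappa * ((A y - lA * u) * (A y + lA * u))
        + - (lA ^ 2 * u * (B y - kappa * u)))%C <= e * T * Cmod u ^ 2).
    { eapply Rle_trans; [apply Cmod_triangle|]. rewrite Cmod_opp, !Cmod_mult, Cmod_pow.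
      fold k m. pose proof (Cmod_ge_0 (A y - lA * u)%C). pose proof (Cmod_ge_0 (A y + lA * u)%C).
      assert (Cmod (A y - lA * u)%C * Cmod (A y + lA * u)%C
        <= e * Cmod u * ((2 * m + 1) * Cmod u)) by (apply Rmult_le_compat; lra).
      assert (m ^ 2 * Cmod u * Cmod (B y - kappa * u)%C <= m ^ 2 * Cmod u * (e * Cmod u)).
      { apply Rmult_le_compat_l; [|lra]. apply Rmult_le_pos; [apply pow_le|]; lra. }
      assert (k * (Cmod (A y - lA * u)%C * Cmod (A y + lA * u)%C)
        <= k * (e * Cmod u * ((2 * m + 1) * Cmod u))) by (apply Rmult_le_compat_l; lra).
      unfold T. nra. }
    assert (HBk : 0 < Cmod (B y) * k) by now apply Rmult_lt_0_compat; [apply Cmod_gt_0|].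
    apply Rmult_le_reg_r with (Cmod (B y) * k); [exact HBk|].
    unfold Rdiv. rewrite Rmult_assoc, Rinv_l, Rmult_1_r by lra.
    eapply Rle_trans; [exact HN|].
    assert (e * T <= eps * k ^ 2 / 2).
    { apply Rmult_le_compat_r with (r := T) in He3; [|lra].
      replace (eps * k ^ 2 / (2 * T) * T) with (eps * k ^ 2 / 2) in He3 by (field; lra). exact He3. }
    apply Rle_trans with (eps * k ^ 2 / 2 * Cmod u ^ 2).
    + apply Rmult_le_compat_r; [apply pow_le; lra | lra].
    + assert (eps * Cmod u * k * (k / 2 * Cmod u) <= eps * Cmod u * k * Cmod (B y)).
      { apply Rmult_le_compat_l; [|exact HBy]. repeat apply Rmult_le_pos; lra. }
      nra.
Qed.

Lemma is_Cderive_div (A B : C -> C) (s lA lB : C) :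
  is_Cderive A s lA -> is_Cderive B s lB -> B s <> 0%C ->
  is_Cderive (fun z => A z / B z)%C s (lA * / B s + A s * (lB * - (/ B s * / B s)))%C.
Proof.
  intros HA HB H. unfold Cdiv. apply (is_Cderive_mult A (fun z => / B z)%C); [exact HA|].
  apply (is_Cderive_comp Cinv B); [now apply is_Cderive_Cinv | exact HB].
Qed.

Definition Cexp_per (z : C) : C := Cexp (2 * RtoC PI * Ci * z).

Lemma Cexp_per_shift (z : C) : Cexp_per (z + 1)%C = Cexp_per z.
Proof.
  unfold Cexp_per. replace (2 * RtoC PI * Ci * (z + 1))%C
    with (2 * RtoC PI * Ci * z + 2 * RtoC PI * Ci)%C by ring.
  rewrite Cexp_plus. replace (Cexp (2 * RtoC PI * Ci)) with (RtoC 1); [ring|].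
  unfold Cexp. apply injective_projections; simpl.
  - replace (((2 * PI - 0 * 0) * 0 - (2 * 0 + 0 * PI) * 1)) with 0 by ring.
    replace ((2 * PI - 0 * 0) * 1 + (2 * 0 + 0 * PI) * 0) with (2 * PI) by ring.
    rewrite exp_0, cos_2PI. ring.
  - replace ((2 * PI - 0 * 0) * 1 + (2 * 0 + 0 * PI) * 0) with (2 * PI) by ring.
    rewrite sin_2PI. ring.
Qed.

Lemma Cmod_Cexp_per (z : C) : Cmod (Cexp_per z) = exp (- (2 * PI * Im z)).
Proof. unfold Cexp_per. rewrite Cmod_Cexp. f_equal. destruct z. simpl. ring. Qed.

Lemma is_Cderive_Cexp_per (a z : C) :
  is_Cderive (fun z => Cexp_per (z - a) - 1)%C z (2 * RtoC PI * Ci * Cexp_per (z - a))%C.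
Proof.
  replace (2 * RtoC PI * Ci * Cexp_per (z - a))%C
    with (2 * RtoC PI * Ci * (1 - 0) * Cexp_per (z - a) - 0)%C by ring.
  apply is_Cderive_minus; [|apply is_Cderive_const].
  apply (is_Cderive_comp Cexp (fun z => 2 * RtoC PI * Ci * (z - a))%C); [apply is_Cderive_Cexp|].
  apply is_Cderive_scal, is_Cderive_minus; [apply is_Cderive_id | apply is_Cderive_const].
Qed.

(** The modulus forces [Im z = 0], and then [cos (2 PI x) = 1] means [sin (PI x) = 0]. This range of
    [Re z] is that of [s - a] for [s] in the unit strip and [a] in [[0, 1]]. *)
Lemma Cexp_per_eq_1 (z : C) : -1 <= Re z <= 1 -> Cexp_per z = 1%C ->
  z = (- (1))%C \/ z = 0%C \/ z = 1%C.
Proof.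
  intros Hz E. pose proof PI_RGT_0 as Hpi.
  assert (Hy : Im z = 0).
  { pose proof (Cmod_Cexp_per z) as H. rewrite E, Cmod_1, <- exp_0 in H.
    apply exp_inv in H. nra. }
  destruct z as [x y]. simpl in Hz, Hy. subst y.
  assert (Hc : cos (2 * (PI * x)) = 1).
  { apply (f_equal Re) in E. unfold Cexp_per, Cexp in E. simpl in E.
    match type of E with exp ?u * cos ?v = 1 =>
      replace u with 0 in E by ring; replace v with (2 * (PI * x)) in E by ring end.
    rewrite exp_0 in E. lra. }
  rewrite cos_2a_sin in Hc.
  assert (Hs : sin (PI * x) = 0) by nra.
  assert (Hx : x = -1 \/ x = 0 \/ x = 1).
  { destruct (Req_dec x (-1)) as [|N1]; [now left|].
    destruct (Req_dec x 0) as [|N2]; [now right; left|].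
    destruct (Req_dec x 1) as [|N3]; [now right; right|]. exfalso.
    destruct (Rlt_le_dec 0 x) as [Hx|Hx].
    - pose proof (sin_gt_0 (PI * x)). nra.
    - pose proof (sin_gt_0 (- (PI * x))) as H. rewrite sin_neg in H. nra. }
  destruct Hx as [->|[->| ->]]; [left | right; left | right; right];
    apply injective_projections; simpl; ring.
Qed.

(** The margin [eta] puts the closed strip [0 <= Re s <= 1] inside the open domain of holomorphy,
    while one period, starting at [Re s >= 0], suffices to match its two sides. *)
Definition periodic_of_type (p : C -> C) (eta c beta : R) : Prop :=
  (0 < eta /\ 0 < c /\ 0 <= beta < PI) /\
  (forall s, - eta < Re s -> exists l, is_Cderive p s l) /\
  (forall s, 0 <= Re s -> p (s + 1)%C = p s) /\
  (forall s, - eta < Re s -> Cmod (p s) <= c * exp (beta * Cmod s)).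

Lemma periodic_square_integral (p : C -> C) (eta c beta a : R) :
  periodic_of_type p eta c beta -> 0 <= a <= 1 ->
  is_CRInt (fun x => (p (RtoC x) - p (RtoC a)) ^ 2)%C 0 1 (RtoC 0).
Proof.
  intros [[Heta [Hc Hbeta]] [Hhol [Hper Hgrowth]]] Ha. pose proof PI_RGT_0 as Hpi.
  set (A := fun s => (p s - p (RtoC a))%C).
  set (B := fun s => (Cexp_per (s - RtoC a) - 1)%C).
  set (P := fun s => (A s ^ 2)%C).
  set (g := fun s => (A s ^ 2 / B s)%C).
  assert (HA : forall s, - eta < Re s -> exists l, is_Cderive A s l).
  { intros s Hs. destruct (Hhol s Hs) as [l Hl]. exists (l - 0)%C.
    apply is_Cderive_minus; [exact Hl | apply is_Cderive_const]. }
  assert (HP : forall s, - eta < Re s -> exists l, is_Cderive P s l).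
  { intros s Hs. destruct (HA s Hs) as [l Hl].
    exists (l * (RtoC (INR 2) * A s ^ pred 2))%C.
    apply (is_Cderive_comp (fun z => z ^ 2)%C A); [apply is_Cderive_pow | exact Hl]. }
  assert (Hg : forall s, 0 <= Re s <= 1 -> exists l, is_Cderive g s l).
  { intros s Hs. destruct (HP s ltac:(lra)) as [lP HlP].
    destruct (HA s ltac:(lra)) as [lA HlA].
    pose proof (is_Cderive_Cexp_per (RtoC a) s) as HlB.
    destruct (Ceq_dec (Cexp_per (s - RtoC a)) 1%C) as [E|E].
    - rewrite E, Cmult_1_r in HlB. eexists. apply (is_Cderive_sqr_div A B s); [exact HlA | exact HlB| | |].
      (* A zero of [B] in the strip is [a] itself or, when [a] is an endpoint of [[0, 1]], possibly
         the opposite endpoint; periodicity makes [A] vanish there too. *)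
      + unfold A. apply Cexp_per_eq_1 in E; [|rewrite re_minus, re_RtoC; lra].
        assert (Es : (s = RtoC a + - (1) \/ s = RtoC a \/ s = RtoC a + 1)%C).
        { destruct E as [E|[E|E]]; [left | right; left | right; right].
          - rewrite <- E. ring.
          - replace s with ((s - RtoC a) + RtoC a)%C by ring. rewrite E. ring.
          - rewrite <- E. ring. }
        destruct Es as [Es|[->|Es]]; [| ring|].
        * replace (RtoC a) with (s + 1)%C by (rewrite Es; ring).
          rewrite Hper by lra. ring.
        * rewrite Es, Hper by (rewrite re_RtoC; lra). ring.
      + unfold B. rewrite E. ring.
      + intros E2. apply (f_equal Im) in E2. simpl in E2. nra.
    - eexists. apply (is_Cderive_div P B); [exact HlP | exact HlB|].
      unfold B. now apply Cminus_eq_contra. }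
  (* The two vertical sides of the rectangle cancel by periodicity, so the horizontal integral does
     not depend on the height. *)
  assert (Hsides : forall f : C -> C, (forall y, f (1, y) = f (0, y)) -> forall y1 y2,
    y1 <= y2 -> holomorphic_on f (box 0 1 y1 y2) -> hint f y1 0 1 = hint f y2 0 1).
  { intros f Hf y1 y2 Hy H.
    pose proof (goursat_box f 0 1 y1 y2 ltac:(lra) Hy H) as G. unfold box_int in G.
    replace (vint f 1 y1 y2) with (vint f 0 y1 y2) in G.
    - apply Ceq_minus. rewrite <- G. ring.
    - apply (RInt_ext (V := C_R_CompleteNormedModule)). intros y _. now rewrite Hf. }
  assert (Hp01 : forall y, p (1, y) = p (0, y)).
  { intros y. rewrite <- (Hper (0, y)) by (simpl; lra). f_equal.
    apply injective_projections; simpl; ring. }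
  assert (HP01 : forall y, P (1, y) = P (0, y)) by (intros y; unfold P, A; now rewrite Hp01).
  assert (Hg01 : forall y, g (1, y) = g (0, y)).
  { intros y. unfold g, A, B. rewrite Hp01.
    replace ((1, y) - RtoC a)%C with (((0, y) - RtoC a) + 1)%C
      by (apply injective_projections; simpl; ring).
    now rewrite Cexp_per_shift. }
  set (K := 4 * c ^ 2 * exp (2 * beta)).
  assert (HK : 0 < K).
  { apply Rmult_lt_0_compat; [|apply exp_pos]. pose proof (pow_lt c 2 Hc). lra. }
  assert (HPb : forall x y Y, 0 <= x <= 1 -> Rabs y = Y ->
    Cmod (P (x, y)) <= K * exp (2 * beta * Y)).
  { intros x y Y Hx HY.
    assert (H1 : Cmod (p (x, y)) <= c * exp (beta * (1 + Y))).
    { eapply Rle_trans; [apply Hgrowth; simpl; lra|].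
      apply Rmult_le_compat_l; [lra|]. apply exp_le. apply Rmult_le_compat_l; [lra|].
      eapply Rle_trans; [apply Cmod_le_Re_Im|]. simpl Re. simpl Im.
      rewrite (Rabs_pos_eq x) by lra. lra. }
    assert (H2 : Cmod (p (RtoC a)) <= c * exp (beta * (1 + Y))).
    { eapply Rle_trans; [apply Hgrowth; rewrite re_RtoC; lra|].
      apply Rmult_le_compat_l; [lra|]. apply exp_le. apply Rmult_le_compat_l; [lra|].
      rewrite Cmod_R, Rabs_pos_eq by lra. pose proof (Rabs_pos y). lra. }
    assert (H3 : Cmod (A (x, y)) <= 2 * c * exp (beta * (1 + Y))).
    { unfold A, Cminus. eapply Rle_trans; [apply Cmod_triangle|]. rewrite Cmod_opp. lra. }
    unfold P. rewrite Cmod_pow.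
    replace (K * exp (2 * beta * Y)) with ((2 * c * exp (beta * (1 + Y))) ^ 2).
    - apply pow_incr. split; [apply Cmod_ge_0 | exact H3].
    - unfold K. replace (2 * beta) with (beta + beta) by ring.
      replace ((beta + beta) * Y) with (beta * Y + beta * Y) by ring.
      replace (beta * (1 + Y)) with (beta + beta * Y) by ring.
      rewrite !exp_plus. ring. }
  set (r := 2 * PI - 2 * beta).
  assert (Hr : 0 < r) by (unfold r; lra).
  assert (Hmain : forall Y, 1 <= Y -> Cmod (hint P 0 0 1) <= 4 * K * exp (- (r * Y))).
  { intros Y HY.
    assert (HeY : 2 <= exp (2 * PI * Y)).
    { pose proof (exp_ineq1_le (2 * PI * Y)). pose proof PI2_3_2. nra. }
    assert (HeYn : exp (- (2 * PI * Y)) <= / 2).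
    { rewrite exp_Ropp. apply Rinv_le_contravar; lra. }
    assert (HB1 : forall x, Cmod (Cexp_per ((x, (- Y)%R) - RtoC a)%C) = exp (2 * PI * Y)).
    { intros x. rewrite Cmod_Cexp_per. f_equal. simpl. ring. }
    assert (HB2 : forall x, Cmod (Cexp_per ((x, Y) - RtoC a)%C) = exp (- (2 * PI * Y))).
    { intros x. rewrite Cmod_Cexp_per. f_equal. simpl. ring. }
    assert (HBm : forall x, exp (2 * PI * Y) / 2 <= Cmod (B (x, - Y))).
    { intros x. specialize (HB1 x). unfold B. set (E := Cexp_per _) in *.
      assert (Cmod E <= Cmod (E - 1)%C + 1); [|lra].
      rewrite <- Cmod_1 at 2. replace E with ((E - 1) + 1)%C at 1 by ring. apply Cmod_triangle. }
    assert (HBp : forall x, / 2 <= Cmod (B (x, Y))).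
    { intros x. specialize (HB2 x). unfold B. set (E := Cexp_per _) in *.
      assert (1 <= Cmod (E - 1)%C + Cmod E); [|lra].
      rewrite <- Cmod_1 at 1. replace (RtoC 1) with (- (E - 1) + E)%C at 1 by ring.
      eapply Rle_trans; [apply Cmod_triangle|]. rewrite Cmod_opp. lra. }
    assert (Hexp : exp (2 * beta * Y) * exp (- (2 * PI * Y)) = exp (- (r * Y))).
    { rewrite <- exp_plus. f_equal. unfold r. ring. }
    assert (Hbottom : Cmod (hint g (- Y) 0 1) <= (1 - 0) * (2 * K * exp (- (r * Y)))).
    { apply (is_CRInt_norm (fun x => g (x, - Y))); [lra| |].
      - intros x Hx. specialize (HBm x).
        pose proof (HPb x (- Y) Y Hx ltac:(rewrite Rabs_Ropp; apply Rabs_pos_eq; lra)) as H.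
        unfold g. rewrite Cmod_div by (apply Cmod_gt_0; lra). fold (P (x, - Y)).
        apply Rle_trans with (K * exp (2 * beta * Y) * / (exp (2 * PI * Y) / 2)).
        + apply Rmult_le_compat; [apply Cmod_ge_0 | left; apply Rinv_0_lt_compat; lra | exact H|].
          apply Rinv_le_contravar; lra.
        + rewrite <- Hexp, exp_Ropp. apply Req_le. field. lra.
      - apply is_CRInt_hint. intros x. rewrite Rmin_left, Rmax_right by lra.
        intros Hx. apply Hg. simpl. lra. }
    (* Near the top [B] is close to -1, so [g] is close to [- P] instead of being small. The small
       quantity is [P + g], which is [P * Cexp_per (s - a) / B]. *)
    assert (Htop : Cmod (hint P Y 0 1 + hint g Y 0 1)%C <= (1 - 0) * (2 * K * exp (- (r * Y)))).
    { apply (is_CRInt_norm (fun x => P (x, Y) + g (x, Y))%C); [lra| |].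
      - intros x Hx. specialize (HBp x). specialize (HB2 x).
        pose proof (HPb x Y Y Hx ltac:(apply Rabs_pos_eq; lra)) as H.
        assert (HB0 : B (x, Y) <> 0%C) by (apply Cmod_gt_0; lra).
        replace (P (x, Y) + g (x, Y))%C with (P (x, Y) * Cexp_per ((x, Y) - RtoC a) / B (x, Y))%C
          by (unfold P, g, B in *; field; exact HB0).
        rewrite Cmod_div, Cmod_mult, HB2 by exact HB0.
        apply Rle_trans with (K * exp (2 * beta * Y) * exp (- (2 * PI * Y)) * / / 2).
        + apply Rmult_le_compat.
          * apply Rmult_le_pos; [apply Cmod_ge_0 | left; apply exp_pos].
          * left. apply Rinv_0_lt_compat. lra.
          * apply Rmult_le_compat_r; [left; apply exp_pos | exact H].
          * apply Rinv_le_contravar; lra.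
        + rewrite Rinv_inv, <- Hexp. apply Req_le. ring.
      - apply is_CRInt_plus; apply is_CRInt_hint; intros x; rewrite Rmin_left, Rmax_right by lra;
          intros Hx; [apply HP | apply Hg]; simpl; lra. }
    (* [P] is moved from height 0 to [Y] and [g] from [- Y] to [Y], where the two estimates combine
       into one for the integral of [P]. *)
    rewrite (Hsides P HP01 0 Y) by (lra || (intros z [Hz _]; apply HP; lra)).
    rewrite (Hsides g Hg01 (- Y) Y) in Hbottom by (lra || (intros z [Hz _]; apply Hg; lra)).
    replace (hint P Y 0 1) with ((hint P Y 0 1 + hint g Y 0 1) + - hint g Y 0 1)%C by ring.
    eapply Rle_trans; [apply Cmod_triangle|]. rewrite Cmod_opp. lra. }
  assert (H0 : hint P 0 0 1 = 0%C).
  { apply Cmod_eq_0. apply Rle_antisym; [|apply Cmod_ge_0].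
    set (X := Cmod (hint P 0 0 1)) in *.
    apply Rnot_lt_le. intros HX.
    assert (HYs : forall Y, 1 <= Y -> X * (1 + r * Y) <= 4 * K).
    { intros Y HY. specialize (Hmain Y HY). rewrite exp_Ropp in Hmain.
      pose proof (exp_pos (r * Y)). pose proof (exp_ineq1_le (r * Y)).
      apply Rle_trans with (X * exp (r * Y)); [apply Rmult_le_compat_l; lra|].
      apply Rmult_le_compat_r with (r := exp (r * Y)) in Hmain; [|lra].
      rewrite Rmult_assoc, Rinv_l in Hmain by lra. lra. }
    assert (Hr' : 0 < r * X) by now apply Rmult_lt_0_compat.
    specialize (HYs (1 + 4 * K / (r * X))).
    assert (0 < 4 * K / (r * X)) by (apply Rdiv_lt_0_compat; lra).
    specialize (HYs ltac:(lra)).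
    replace (X * (1 + r * (1 + 4 * K / (r * X)))) with (X + r * X + 4 * K) in HYs by (field; lra).
    lra. }
  rewrite <- H0. apply is_RInt_ext with (f := fun x => P (x, 0)); [reflexivity|].
  apply is_CRInt_hint. intros x. rewrite Rmin_left, Rmax_right by lra.
  intros Hx. apply HP. simpl. lra.
Qed.

(* Expanding the square gives [m2 - 2 p(a) m1 + p(a)^2 = 0] for the moments [m1], [m2] of
   [p] on [0, 1]; integrating over [a] gives [m2 = m1^2], hence [p(a) = m1]. *)
Lemma periodic_type_constant (p : C -> C) (eta c beta a : R) :
  periodic_of_type p eta c beta -> 0 <= a <= 1 -> p (RtoC a) = p (RtoC 0).
Proof.
  intros Hp. pose proof Hp as [[Heta [Hc Hbeta]] [Hhol _]].
  assert (H1 : is_CRInt (fun x => p (RtoC x)) 0 1 (hint p 0 0 1)).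
  { apply (is_CRInt_hint p 0 0 1). intros x. rewrite Rmin_left, Rmax_right by lra.
    intros Hx. apply Hhol. simpl. lra. }
  set (m1 := hint p 0 0 1) in *.
  set (m2 := hint (fun s => p s ^ 2)%C 0 0 1).
  assert (H2 : is_CRInt (fun x => p (RtoC x) ^ 2)%C 0 1 m2).
  { apply (is_CRInt_hint (fun s => p s ^ 2)%C 0 0 1). intros x. rewrite Rmin_left, Rmax_right by lra.
    intros Hx. destruct (Hhol (x, 0)) as [l Hl]; [simpl; lra|].
    eexists. apply (is_Cderive_comp (fun z => z ^ 2)%C p); [apply is_Cderive_pow | exact Hl]. }
  assert (Hconst : forall b : C, is_CRInt (fun _ => b) 0 1 b).
  { intros b. pose proof (is_RInt_const (V := C_R_NormedModule) 0 1 b) as H.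
    rewrite scal_R_Cmult in H. replace ((1 - 0)%R * b)%C with b in H; [exact H|].
    rewrite Rminus_0_r. ring. }
  assert (E : forall a, 0 <= a <= 1 ->
    (m2 - 2 * p (RtoC a) * m1 + p (RtoC a) ^ 2 = 0)%C).
  { intros b Hb. symmetry.
    apply (is_CRInt_unique _ 0 1 _ _ (periodic_square_integral p eta c beta b Hp Hb)).
    apply is_RInt_ext with (f := fun x => (p (RtoC x) ^ 2 - 2 * p (RtoC b) * p (RtoC x) + p (RtoC b) ^ 2)%C).
    { intros x _. simpl. Cring. }
    apply is_CRInt_plus; [|apply Hconst]. apply is_CRInt_minus; [exact H2|].
    now apply is_CRInt_scal. }
  assert (E2 : (m2 - 2 * m1 * m1 + m2 = 0)%C).
  { apply (is_CRInt_unique (fun x => m2 - 2 * m1 * p (RtoC x) + p (RtoC x) ^ 2)%C 0 1).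
    - apply is_CRInt_plus; [|exact H2]. apply is_CRInt_minus; [apply Hconst|]. now apply is_CRInt_scal.
    - apply is_RInt_ext with (f := fun _ => RtoC 0); [|apply Hconst].
      intros x. rewrite Rmin_left, Rmax_right by lra. intros Hx. rewrite <- (E x) by lra. Cring. }
  assert (E3 : m2 = (m1 * m1)%C).
  { apply Ceq_minus. replace (m2 - m1 * m1)%C with ((m2 - 2 * m1 * m1 + m2) / 2)%C.
    - rewrite E2. unfold Cdiv. ring.
    - field. }
  assert (F : forall a, 0 <= a <= 1 -> p (RtoC a) = m1).
  { intros b Hb. specialize (E b Hb). rewrite E3 in E. apply Ceq_minus.
    apply Cmod_eq_0. apply (f_equal Cmod) in E. rewrite Cmod_0 in E.
    replace (m1 * m1 - 2 * p (RtoC b) * m1 + p (RtoC b) ^ 2)%C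
      with ((p (RtoC b) - m1) * (p (RtoC b) - m1))%C in E by ring.
    rewrite Cmod_mult in E. nra. }
  intros Ha. rewrite (F a Ha), (F 0); [reflexivity | lra].
Qed.

(** * Ramanujan-Candelpergher summation *)

Lemma is_RC_primitive_unique (f phi psi : C -> C) (x : R) :
  is_RC_primitive f phi -> is_RC_primitive f psi -> 0 <= x <= 1 ->
  phi (RtoC x) = psi (RtoC x).
Proof.
  intros [s0 [s1 [Hs0 [_ [Hs1 [[Hd1 [c1 [b1 [Hc1 [Hb1 Hg1]]]]] [He1 H01]]]]]]].
  intros [t0 [t1 [Ht0 [_ [Ht1 [[Hd2 [c2 [b2 [Hc2 [Hb2 Hg2]]]]] [He2 H02]]]]]]] Hx.
  set (eta := - Rmax s1 t1).
  assert (Heta : 0 < eta) by (unfold eta; pose proof (Rmax_lub_lt s1 t1 0 Hs1 Ht1); lra).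
  assert (Hs : forall s : C, - eta < Re s -> s1 < Re s /\ t1 < Re s).
  { intros s H. unfold eta in H. pose proof (Rmax_l s1 t1). pose proof (Rmax_r s1 t1). lra. }
  (* The types in [Opi_on] may be negative; the 0 makes the common one nonnegative. *)
  set (beta := Rmax 0 (Rmax b1 b2)).
  assert (Hbeta : 0 <= beta < PI).
  { unfold beta. split; [apply Rmax_l|]. pose proof PI_RGT_0.
    repeat apply Rmax_lub_lt; lra. }
  assert (Hp : periodic_of_type (fun s => phi s - psi s)%C eta (c1 + c2) beta).
  { split; [repeat split; lra|]. split; [|split].
    - intros s H. destruct (Hs s H) as [K1 K2].
      destruct (Hd1 s K1) as [l1 D1]. destruct (Hd2 s K2) as [l2 D2].
      exists (l1 - l2)%C. now apply is_Cderive_minus.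
    (* The difference equations are used at [s + 1]: for [Re s >= 0] its real part is at least 1,
       beyond both [s0] and [t0], so both equations hold and [f] cancels. *)
    - intros s H. assert (Hr : Re (s + 1)%C = Re s + 1) by now rewrite re_plus, re_RtoC.
      assert (Er : (s + 1 - 1 = s)%C) by ring.
      specialize (He1 (s + 1)%C). specialize (He2 (s + 1)%C). rewrite Er in He1, He2.
      rewrite Hr in He1, He2.
      specialize (He1 ltac:(lra) ltac:(lra)). specialize (He2 ltac:(lra) ltac:(lra)).
      apply Ceq_minus.
      replace (phi (s + 1) - psi (s + 1) - (phi s - psi s))%C
        with ((phi (s + 1) - phi s) - (psi (s + 1) - psi s))%C by ring.
      rewrite He1, He2. ring.
    - intros s H. destruct (Hs s H) as [K1 K2].
      specialize (Hg1 s K1). specialize (Hg2 s K2).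
      assert (Hmono : forall b, b <= beta -> exp (b * Cmod s) <= exp (beta * Cmod s)).
      { intros b Hb. apply exp_le. apply Rmult_le_compat_r; [apply Cmod_ge_0 | exact Hb]. }
      pose proof (Hmono b1) as M1. pose proof (Hmono b2) as M2.
      assert (b1 <= beta) by (eapply Rle_trans; [apply Rmax_l | apply Rmax_r]).
      assert (b2 <= beta) by (eapply Rle_trans; [apply Rmax_r | apply Rmax_r]).
      unfold Cminus. eapply Rle_trans; [apply Cmod_triangle|]. rewrite Cmod_opp.
      rewrite Rmult_plus_distr_r. apply Rplus_le_compat.
      + eapply Rle_trans; [exact Hg1|]. apply Rmult_le_compat_l; [lra | auto].
      + eapply Rle_trans; [exact Hg2|]. apply Rmult_le_compat_l; [lra | auto]. }
  pose proof (periodic_type_constant _ _ _ _ x Hp Hx) as E. cbv beta in E.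
  rewrite H01, H02 in E. apply Ceq_minus. rewrite E. ring.
Qed.

Definition RC_solution (n : nat) (w s : C) : C :=
  (em_const n (w + 1) - em_const n (s + w + 1))%C.

Lemma is_Cderive_powlog (n : nat) (z : C) : 0 < Re z -> is_Cderive (powlog n) z (pl n 2 z).
Proof.
  intros Hz. apply (is_derive_ext_loc (pl n 1)); [|now apply is_Cderive_pl].
  exists (mkposreal _ Hz). intros y Hy. apply pl_1, Re_pos_neq_0.
  now apply (ball_Re_pos y z).
Qed.

Lemma powlog_growth (n : nat) (r : R) : 0 < r -> exists A : R, 0 < A /\
  forall z : C, r <= Cmod z -> Cmod (powlog n z) <= A * exp (2 * Cmod z).
Proof.
  intros Hr. pose proof (Rinv_0_lt_compat r Hr) as Hri.
  exists ((/ r + 5) * (INR (fact (S n)) * exp 2)).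
  assert (0 < INR (fact (S n))) by apply INR_fact_lt_0.
  split; [repeat apply Rmult_lt_0_compat; try apply exp_pos; lra|].
  intros z Hz. eapply Rle_trans; [apply (powlog_bound n r z Hr Hz)|].
  pose proof (bern_radius_ge z) as HR. set (q := bern_radius z) in *.
  pose proof (pow_le_exp q (S n) ltac:(lra)) as He.
  replace (exp q) with (exp 2 * exp (2 * Cmod z)) in He
    by (rewrite <- exp_plus; f_equal; unfold q, bern_radius; ring).
  assert (0 <= q ^ n) by (apply pow_le; lra).
  apply Rle_trans with ((/ r + 5) * q ^ S n).
  - simpl. replace ((/ r + 5) * (q * q ^ n)) with (q ^ n * ((/ r + 5) * q)) by ring.
    apply Rmult_le_compat_l; nra.
  - replace ((/ r + 5) * (INR (fact (S n)) * exp 2) * exp (2 * Cmod z))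
      with ((/ r + 5) * (INR (fact (S n)) * (exp 2 * exp (2 * Cmod z)))) by ring.
    apply Rmult_le_compat_l; lra.
Qed.

Lemma two_lt_PI : 2 < PI.
Proof. pose proof PI2_3_2. lra. Qed.

Lemma exp_shift_growth (f : C -> C) (A : R) (a z : C) : 0 < A ->
  Cmod (f (z + a)%C) <= A * exp (2 * Cmod (z + a)%C) ->
  Cmod (f (z + a)%C) <= A * exp (2 * Cmod a) * exp (2 * Cmod z).
Proof.
  intros HA H. eapply Rle_trans; [exact H|].
  rewrite Rmult_assoc, <- exp_plus. apply Rmult_le_compat_l; [lra|].
  apply exp_le. pose proof (Cmod_triangle z a). lra.
Qed.

Lemma is_RC_primitive_solution (n : nat) (w : C) : 0 < Re w ->
  is_RC_primitive (fun s => powlog n (s + w)%C) (RC_solution n w).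
Proof.
  (* On [Re s > 0] the argument [s + w] stays in the right half plane and away from 0. On
     [Re s > - 1/2] the argument [s + w + 1] has real part above 1/2, as [em_const_growth]
     requires. *)
  intros Hw. exists 0, (- / 2). repeat split.
  - lra.
  - intros s Hs. exists (pl n 2 (s + w)%C).
    apply (is_Cderive_shift (powlog n) w s), is_Cderive_powlog. rewrite re_plus. lra.
  - destruct (powlog_growth n (Re w) Hw) as [A [HA H]].
    exists (A * exp (2 * Cmod w)), 2.
    split; [apply Rmult_lt_0_compat; [exact HA | apply exp_pos]|].
    split; [apply two_lt_PI|]. intros s Hs.
    apply (exp_shift_growth (powlog n)); [exact HA|]. apply H.
    eapply Rle_trans; [|apply Re_le_Cmod]. rewrite re_plus. lra.
  - lra.
  - intros s Hs. eexists. apply is_Cderive_minus; [apply is_Cderive_const|].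
    apply is_derive_ext with (f := fun s : C => em_const n (s + (w + 1))%C);
      [intros z; f_equal; Cring|].
    apply (is_Cderive_shift (em_const n)), is_Cderive_em_const.
    rewrite !re_plus, re_RtoC. lra.
  - destruct (em_const_growth n) as [A [HA H]].
    set (m := Cmod (em_const n (w + 1)%C)). assert (Hm : 0 <= m) by apply Cmod_ge_0.
    assert (Hpos : 0 < A * exp (2 * Cmod (w + 1)%C))
      by (apply Rmult_lt_0_compat; [exact HA | apply exp_pos]).
    exists (m + A * exp (2 * Cmod (w + 1)%C)), 2.
    split; [lra|]. split; [apply two_lt_PI|]. intros s Hs.
    unfold RC_solution, Cminus. eapply Rle_trans; [apply Cmod_triangle|]. rewrite Cmod_opp. fold m.
    rewrite Rmult_plus_distr_r. apply Rplus_le_compat.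
    + rewrite <- (Rmult_1_r m) at 1. apply Rmult_le_compat_l; [exact Hm|].
      rewrite <- exp_0. apply exp_le. pose proof (Cmod_ge_0 s). lra.
    + rewrite <- Cplus_assoc. apply (exp_shift_growth (em_const n)); [exact HA|]. apply H.
      rewrite !re_plus, re_RtoC. lra.
  - intros s Hs _. unfold RC_solution.
    replace (s - 1 + w + 1)%C with (s + w)%C by ring.
    rewrite (em_const_functional n (s + w)%C) by (rewrite re_plus; lra). ring.
  - unfold RC_solution. rewrite Cplus_0_l. ring.
Qed.

Lemma is_RC_sum_solution (n : nat) (w : C) : 0 < Re w ->
  is_RC_sum (fun s => powlog n (s + w)%C) (em_const n (w + 1) + pl n 0 (w + 1))%C.
Proof.
  intros Hw. exists (RC_solution n w). split; [now apply is_RC_primitive_solution|].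
  replace (em_const n (w + 1) + pl n 0 (w + 1))%C
    with (em_const n (w + 1) - - pl n 0 (w + 1))%C by ring.
  apply is_CRInt_minus.
  - pose proof (is_RInt_const (V := C_R_NormedModule) 0 1 (em_const n (w + 1)%C)) as H.
    rewrite scal_R_Cmult in H. rewrite Rminus_0_r, Cmult_1_l in H. exact H.
  - apply is_RInt_ext with (f := fun x => em_const n ((w + 1) + RtoC x * 1)%C).
    + intros x _. f_equal. ring.
    + apply is_CRInt_em_const. rewrite re_plus, re_RtoC. lra.
Qed.

Lemma RC_sum_powlog (n : nat) (w : C) : 0 < Re w ->
  RC_sum (fun s => powlog n (s + w)%C) = (em_const n (w + 1) + pl n 0 (w + 1))%C.
Proof.
  intros Hw. pose proof (is_RC_sum_solution n w Hw) as H.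
  apply (iota_unique (V := C_CompleteNormedModule)); [|exact H].
  intros v [psi [Hpsi Hv]]. destruct H as [phi [Hphi H]].
  apply (is_CRInt_unique (fun x => psi (RtoC x)) 0 1); [exact Hv|].
  apply is_RInt_ext with (f := fun x => phi (RtoC x)); [|exact H].
  intros x. rewrite Rmin_left, Rmax_right by lra. intros Hx.
  apply (is_RC_primitive_unique _ _ _ _ Hphi Hpsi). lra.
Qed.

Theorem theorem1p8 (n : nat) (w : C) (hw : (0 < Re w)%R) :
  Sconst n w =
  (RC_sum (fun s : C => powlog n (s + w))
   + RtoC (-1) ^ (n + 1) * RtoC (INR (fact n)) * modified_bernoulli n w
       * RtoC (harmonic n)
   + (w + 1) ^ (n + 1) / (RtoC (INR n) + 1) ^ 2
   - (w + 1) ^ (n + 1) / (RtoC (INR n) + 1) * Clog (w + 1)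
   + w ^ n * Clog w)%C.
Proof.
  rewrite Sconst_em_const, RC_sum_powlog, modified_bernoulli_bern by exact hw.
  (* Passing from [em_const n (w + 1)] to [em_const n w] costs [w^n log w], the last term of the
     formula; the terms in [w + 1] come from the primitive [pl n 0]. *)
  rewrite em_const_functional, pl_0 by exact hw.
  rewrite Nat.add_1_r, pl_pow_const, RtoC_mult. fold (powlog n w).
  (* The sign in the formula and the one relating [modified_bernoulli n w] to [bern (S n) w]
     cancel. *)
  assert (E : (RtoC (-1) ^ S n * RtoC (-1) ^ S n = 1)%C).
  { rewrite <- Cpow_mult_l. replace (RtoC (-1) * RtoC (-1))%C with (RtoC 1) by ring.
    apply Cpow_1_l. }
  replace (RtoC (-1) ^ S n * RtoC (INR (fact n)) * (RtoC (-1) ^ S n * bern (S n) w)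
      * RtoC (harmonic n))%C
    with ((RtoC (-1) ^ S n * RtoC (-1) ^ S n) * (bern (S n) w * (RtoC (INR (fact n)) * RtoC (harmonic n))))%C
    by ring.
  rewrite E. ring.
Qed.
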